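(* If two virtual 1-knot diagrams $\alpha$ and $\beta$ are fiberwise equivalent, then $\alpha$ and $\beta$ are virtually parity equivalent, i.e. the numbers of virtual crossing points of $\alpha$ and of $\beta$ have the same parity.
   Context: Smooth category. A virtual 1-knot diagram is a generic immersed oriented circle in $\mathbb R^2$ whose transverse double points are each marked as a classical crossing (with over/under information) or a virtual crossing. Fiberwise equivalence: $\alpha$ and $\beta$ are fiberwise equivalent if there is a smooth embedding $g:S^1_b\times[0,1]\times S^1_f\hookrightarrow\mathbb R^2_b\times[0,1]\times\mathbb R^2_f$ (here $S^1_b,S^1_f$ are circles, $\mathbb R^2_b,\mathbb R^2_f$ are planes) such that: (1) $g(S^1_b\times\{t\}\times S^1_f)\subset\mathbb R^2_b\times\{t\}\times\mathbb R^2_f$ for every $t\in[0,1]$; (2) for every $p\in S^1_b$ and $t\in[0,1]$, $g(\{p\}\times\{t\}\times S^1_f)$ is contained in a single fiber $\{q\}\times\mathbb R^2_f$, $q\in\mathbb R^2_b\times[0,1]$; (3) with $\pi:\mathbb R^2_b\times[0,1]\times\mathbb R^2_f\to\mathbb R^2_b\times[0,1]$ the projection, $(\pi\circ g)(S^1_b\times\{0\}\times S^1_f)\subset\mathbb R^2_b\times\{0\}$ (respectively $(\pi\circ g)(S^1_b\times\{1\}\times S^1_f)\subset\mathbb R^2_b\times\{1\}$) is the diagram $\alpha$ (respectively $\beta$) without the classical/virtual information, and that information is given by the two fiber-circles over each crossing point: at a classical crossing one circle is inside the other, the inner (respectively outer) circle belonging to the lower (respectively upper) strand; at a virtual crossing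 each circle is outside the other. Moreover $\pi\circ g$ meets $\mathbb R^2_b\times\{0,1\}$ transversely; (4) writing $g_t=g|_{S^1_b\times\{t\}\times S^1_f}$, there is an ambient isotopy $H_t$ $(0\le t\le1)$ of $\mathbb R^2_b\times\mathbb R^2_f$ (identified with $\mathbb R^2_b\times\{t\}\times\mathbb R^2_f$) with $H_0$ the identity and $g_t=H_t\circ g_0$ for all $t\in[0,1]$. *)

(* Defs.v *)
From mathcomp Require Import all_boot all_order all_algebra finmap.
From mathcomp Require Import all_classical all_reals all_analysis.

Set Implicit Arguments.
Unset Strict Implicit.
Unset Printing Implicit Defensive.

Import Order.TTheory GRing.Theory Num.Theory.
Import numFieldNormedType.Exports.

Local Open Scope classical_set_scope.
Local Open Scope ring_scope.

(* The circle is R / Z: maps out of it are 1-periodic functions of a real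
   parameter, and two parameters name the same point of the circle when they
   differ by an integer. *)
Definition circle_eq {R : realType} (s t : R) : Prop := s - t \is a Num.int.

Section Smooth.
Variables (R : realType) (V W : normedModType R).

(* On an open set U of a finite-dimensional space, f is of class C^k iff all
   its iterated directional derivatives up to order k exist and are
   continuous. *)
Fixpoint Ck_on (k : nat) (U : set V) (f : V -> W) : Prop :=
  (forall x, U x -> {for x, continuous f}) /\
  match k with
  | 0%N => True
  | k'.+1 => forall v : V,
      (forall x, U x -> derivable f x v) /\ Ck_on k' U (fun x => 'D_v f x)
  end.

Definition smooth_on (U : set V) (f : V -> W) : Prop := forall k, Ck_on k U f.

Definition smooth_extension (A : set V) (f : V -> W) (x : V) (F : V -> W) :
    Prop :=
  exists U : set V, [/\ open U, U x, smooth_on U F &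
    forall y, U y -> A y -> F y = f y].

(* Smoothness on a set that need not be open, here a manifold with boundary. *)
Definition smooth_map (A : set V) (f : V -> W) : Prop :=
  forall x, A x -> exists F, smooth_extension A f x F.

(* The differential at a boundary point is that of a local smooth extension;
   it does not depend on the extension when A is contained in the closure of
   its interior, as is the case for all the sets A used below. *)
Definition immersion (A : set V) (f : V -> W) : Prop :=
  smooth_map A f /\
  forall x F, A x -> smooth_extension A f x F ->
    forall v, 'D_v F x = 0 -> v = 0.

End Smooth.

Section Jordan.
Variable R : realType.
Implicit Type C : set (R * R).

(* For a Jordan curve C, the bounded and the unbounded component of its
   complement. *)
Definition inside C : set (R * R) :=
  [set x | ~ C x /\ bounded_set (connected_component (~` C) x)].

Definition outside C : set (R * R) :=
  [set x | ~ C x /\ ~ bounded_set (connected_component (~` C) x)].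

End Jordan.

(* The role of a strand at a crossing: upper or lower strand of a classical
   crossing, or either strand of a virtual crossing. *)
Inductive strand := Over | Under | Virtual.

Definition opposite_strand (m : strand) : strand :=
  match m with Over => Under | Under => Over | Virtual => Virtual end.

Section Diagrams.
Variable R : realType.

(* A parametrized curve passes twice through the same point of the plane. *)
Definition crossing (c : R -> R * R) (s t : R) : Prop :=
  ~ circle_eq s t /\ c s = c t.

Definition crossing_points (c : R -> R * R) : set (R * R) :=
  [set x | exists s t, crossing c s t /\ c s = x].

Record generic_immersed_circle (c : R -> R * R) : Prop := {
  generic_periodic : forall s, c (s + 1) = c s;
  generic_immersion : immersion setT c;
  generic_transverse : forall s t, crossing c s t ->
    forall a b : R, a *: derive1 c s + b *: derive1 c t = 0 -> a = 0 /\ b = 0;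
  generic_no_triple : forall s t u, c s = c t -> c t = c u ->
    [\/ circle_eq s t, circle_eq t u | circle_eq s u];
  (* redundant: follows from the other fields by compactness *)
  generic_finite : finite_set (crossing_points c) }.

(* The orientation of the circle is that of increasing parameters.  The value
   of [mark] at a parameter that is not on a crossing is irrelevant. *)
Record virtual_diagram := VirtualDiagram {
  curve : R -> R * R;
  mark : R -> strand;
  curve_generic : generic_immersed_circle curve;
  mark_periodic : forall s, mark (s + 1) = mark s;
  mark_crossing : forall s t, crossing curve s t ->
    mark t = opposite_strand (mark s) }.

Definition virtual_crossing_points (alpha : virtual_diagram) : set (R * R) :=
  [set x | exists s t, [/\ crossing (curve alpha) s t,
                           mark alpha s = Virtual & curve alpha s = x]].

Definition virtual_crossing_number (alpha : virtual_diagram) : nat :=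
  #|` fset_set (virtual_crossing_points alpha) |.

Definition virtually_parity_equivalent (alpha beta : virtual_diagram) : Prop :=
  odd (virtual_crossing_number alpha) = odd (virtual_crossing_number beta).

End Diagrams.

Section Fiberwise.
Variable R : realType.

(* The orientation-preserving diffeomorphisms of R / Z, via their lifts. *)
Definition oriented_circle_diffeo (phi : R -> R) : Prop :=
  [/\ smooth_map setT phi, forall s, phi (s + 1) = phi s + 1 &
      forall s, 0 < derive1 phi s].

(* Triples (p, t, u) in S^1_b x [0, 1] x S^1_f, the circles being R / Z, are
   mapped to triples (b, t, f) in R^2_b x [0, 1] x R^2_f. *)
Notation source := (R * R * R)%type.
Notation target := ((R * R) * R * (R * R))%type.

Definition thick_torus : set source := [set x | 0 <= x.1.2 <= 1].

(* Since the source is compact, an injective immersion is an embedding. *)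
Record smooth_embedding (g : source -> target) : Prop := {
  embedding_range : forall x, thick_torus x -> 0 <= (g x).1.2 <= 1;
  embedding_periodic_base : forall p t u, 0 <= t <= 1 ->
    g (p + 1, t, u) = g (p, t, u);
  embedding_periodic_fiber : forall p t u, 0 <= t <= 1 ->
    g (p, t, u + 1) = g (p, t, u);
  embedding_immersion : immersion thick_torus g;
  embedding_injective : forall p t u p' t' u',
    0 <= t <= 1 -> 0 <= t' <= 1 -> g (p, t, u) = g (p', t', u') ->
    [/\ circle_eq p p', t = t' & circle_eq u u'] }.

Definition proj (x : target) : (R * R) * R := x.1.

Definition fiber_circle (g : source -> target) (p t : R) : set (R * R) :=
  [set y | exists u, (g (p, t, u)).2 = y].

(* The slice of g at level t lies over the immersed oriented circle underlying
   alpha, and nesting of the two fiber circles over each crossing gives the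
   marking. The case of an [Under] strand is the [Over] case with p and p'
   exchanged. *)
Definition represents (g : source -> target) (t : R)
    (alpha : virtual_diagram R) : Prop :=
  exists phi : R -> R,
  [/\ oriented_circle_diffeo phi,
      forall p u, proj (g (p, t, u)) = (curve alpha (phi p), t) &
      forall p p', crossing (curve alpha) (phi p) (phi p') ->
        let C := fiber_circle g p t in let C' := fiber_circle g p' t in
        match mark alpha (phi p) with
        | Over => C' `<=` inside C
        | Under => C `<=` inside C'
        | Virtual => C `<=` outside C' /\ C' `<=` outside C
        end].

(* The projection of g meets R^2_b x {0, 1} transversely. *)
Definition transverse_ends (g : source -> target) : Prop :=
  forall x F, thick_torus x -> (proj (g x)).2 = 0 \/ (proj (g x)).2 = 1 ->
    smooth_extension thick_torus (proj \o g) x F ->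
    forall w : (R * R) * R, exists (v : source) (h : R * R),
      'D_v F x + (h, 0) = w.

Notation space := ((R * R) * (R * R))%type.

Definition diffeomorphism (f : space -> space) : Prop :=
  smooth_map setT f /\
  exists f' : space -> space, [/\ smooth_map setT f', cancel f f' & cancel f' f].

Record ambient_isotopy (H : R -> space -> space) : Prop := {
  isotopy_smooth :
    smooth_map [set x : space * R | 0 <= x.2 <= 1] (fun x => H x.2 x.1);
  isotopy_diffeo : forall t, 0 <= t <= 1 -> diffeomorphism (H t);
  isotopy_start : forall y, H 0 y = y }.

(* The level R^2_b x {t} x R^2_f is identified with R^2_b x R^2_f. *)
Definition forget_level (x : target) : space := (x.1.1, x.2).

Definition fiberwise_equivalent (alpha beta : virtual_diagram R) : Prop :=
  exists g : source -> target,
  smooth_embedding g /\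
  (forall p t u, 0 <= t <= 1 -> (g (p, t, u)).1.2 = t) /\
  (forall p t, 0 <= t <= 1 -> exists q, forall u, proj (g (p, t, u)) = q) /\
  represents g 0 alpha /\ represents g 1 beta /\ transverse_ends g /\
  exists H, ambient_isotopy H /\
    forall p t u, 0 <= t <= 1 ->
      forget_level (g (p, t, u)) = H t (forget_level (g (p, 0, u))).

End Fiberwise.

(* Main.v *)
(* Over a double point of the base curve at level t lie two disjoint fiber
   circles; call the double point virtual if each circle has winding number
   zero around the other one.  At the two ends these are the virtual crossings.
   By homotopy invariance of winding numbers the virtual double points form an
   open and closed part of all double points of the family, and none of them is
   close to the diagonal: where the base curve is immersed there are no double
   points near the diagonal, and where its velocity vanishes, the velocity of
   the fiber circle is independent of its tangent, so that an unlinked pair of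
   nearby circles would give a simple closed plane curve whose tangent has
   winding number zero.
   Hence the parity of the number of virtual double points is the same at both
   ends.  To see this without any genericity of the family, inscribe a polygon
   in general position in the curve at each of finitely many levels and count
   the pairs of edges that cross close to a virtual double point: moving one
   vertex at a time does not change this number modulo 2, and at the ends a
   transverse virtual crossing contributes an odd number of such pairs. *)

Require Import Defs.
From mathcomp Require Import all_boot all_order all_algebra finmap.
From mathcomp Require Import all_classical all_reals all_analysis.
From mathcomp Require Import ring lra zify.

Set Implicit Arguments.
Unset Strict Implicit.
Unset Printing Implicit Defensive.

Import Order.TTheory GRing.Theory Num.Theory.
Import numFieldNormedType.Exports.

Local Open Scope classical_set_scope.
Local Open Scope ring_scope.

(** * Crossings of segments and triangles *)

(** At intermediate levels the base curve may fail to be immersed and may have infinitely many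
    double points, so nothing can be counted on the curve itself. Which pairs of edges count is
    decided by a boolean label on pairs of parameters, true near virtual double points. The label is
    constant wherever the curve nearly meets itself, because virtual double points have positive
    distance from all other double points and from the diagonal. Winding number zero is expressed by
    a closed continuous angle, which turns homotopy arguments into statements about real functions
    whose values differ by multiples of 2 pi. The link with nesting of circles consists of two
    implications: the loop seen from a point outside a Jordan curve is null, and the loop seen from
    a point inside is not. The second one is Borsuk's extension argument. Derivatives enter through
    estimates uniform in the base point: the fibers over two nearby parameters are compared, and
    neither parameter need be the one at which the derivative is taken. *)

Section Orientation.
Variable R : realFieldType.
Implicit Types a b c d e p q r : R * R.

Definition det3 p q r : R :=
  (q.1 - p.1) * (r.2 - p.2) - (q.2 - p.2) * (r.1 - p.1).

(** Collinear triples count as not positive, so antisymmetry holds only where [det3] is nonzero;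
    hence the role of [general_position]. *)
Definition orient p q r : bool := 0 < det3 p q r.

Definition seg_cross a b c d : bool :=
  (orient a b c (+) orient a b d) && (orient c d a (+) orient c d b).

Definition in_triangle a b c d : bool :=
  (orient a b d == orient b c d) && (orient b c d == orient c a d).

Definition general_position (T : eqType) (x : T -> R * R) : Prop :=
  forall i j k, i != j -> j != k -> i != k -> det3 (x i) (x j) (x k) != 0.

Lemma det3_swap p q r : det3 q p r = - det3 p q r.
Proof. rewrite /det3; ring. Qed.

(** The first factors are unnormalized barycentric coordinates of [d] in the triangle [a b c]; the
    second factors are the values at its vertices of the affine function [det3 d e _], which
    vanishes at [d]. *)
Lemma det3_plucker a b c d e :
  det3 b c d * det3 d e a + det3 c a d * det3 d e b + det3 a b d * det3 d e c
  = 0.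
Proof. rewrite /det3; ring. Qed.

Lemma orient_swap p q r : det3 p q r != 0 -> orient q p r = ~~ orient p q r.
Proof.
by move=> h; rewrite /orient det3_swap oppr_gt0 -leNgt le_eqVlt (negbTE h).
Qed.

Lemma seg_cross_sym a b c d : seg_cross a b c d = seg_cross c d a b.
Proof. by rewrite /seg_cross andbC. Qed.

Lemma seg_cross_swap a b c d : det3 a b c != 0 -> det3 a b d != 0 ->
  seg_cross b a c d = seg_cross a b c d.
Proof.
move=> h1 h2; rewrite /seg_cross !(@orient_swap a b) // addbC.
by rewrite (addbC (orient c d b)) addbN addNb negbK addbC.
Qed.

Let sign_ind (x : R) : x != 0 -> (0 < x) || (x < 0).
Proof. by case: ltgtP. Qed.

(* A linear relation with coefficients A, B, C decides whether x, y, z have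
   the same sign from the two of them whose coefficients have the same sign. *)
Let same_sign (x y z A B C : R) :
  [/\ x != 0, y != 0 & z != 0] -> [/\ A != 0, B != 0 & C != 0] ->
  x * A + y * B + z * C = 0 ->
  ((0 < z) == (0 < x)) && ((0 < x) == (0 < y)) =
  if (0 < A) == (0 < B) then
    if (0 < B) == (0 < C) then false else (0 < x) == (0 < y)
  else if (0 < A) == (0 < C) then (0 < x) == (0 < z) else (0 < y) == (0 < z).
Proof.
move=> [hx hy hz] [hA hB hC] E.
have sM (u v : R) : u != 0 -> v != 0 -> (0 < u * v) = ((0 < u) == (0 < v)).
  move=> /sign_ind /orP[] hu /sign_ind /orP[] hv.
  - by rewrite hu hv mulr_gt0.
  - by rewrite hu pmulr_rgt0 // ltNge (ltW hv).
  - by rewrite hv pmulr_lgt0 // ltNge (ltW hu).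
  - by rewrite nmulr_rgt0 // hv !ltNge (ltW hu) (ltW hv).
have := sM _ _ hx hA; have := sM _ _ hy hB; have := sM _ _ hz hC.
have := mulf_neq0 hx hA; have := mulf_neq0 hy hB; have := mulf_neq0 hz hC.
move: E; move: (x * A) (y * B) (z * C) => u v w E hw hv hu.
have {hw hv hu E} : ~~ ((0 < u) && (0 < v) && (0 < w)) &&
    ((0 < u) || (0 < v) || (0 < w)).
  apply/andP; split; first by apply/negP => /andP[/andP[? ?] ?]; lra.
  apply/negP => /negP; rewrite !negb_or -!leNgt => /andP[/andP[h1 h2] h3].
  by move/eqP: hu; apply; lra.
move=> + wE vE uE; rewrite wE vE uE.
by case: (0 < x); case: (0 < y); case: (0 < z); case: (0 < A); case: (0 < B);
  case: (0 < C).
Qed.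

(** The Plücker relations for [d] and for [e] have the same coefficients up to sign: the sides of
    the line [d e] on which the three vertices lie. Both triangle tests thus reduce to signs that
    also occur in the crossing tests, and a finite case check remains. *)
Lemma seg_cross_triangle (T : eqType) (x : T -> R * R) (a b c d e : T) :
  general_position x -> uniq [:: a; b; c; d; e] ->
  seg_cross (x a) (x b) (x d) (x e) (+) seg_cross (x b) (x c) (x d) (x e)
    (+) seg_cross (x a) (x c) (x d) (x e) =
  in_triangle (x a) (x b) (x c) (x d) (+) in_triangle (x a) (x b) (x c) (x e).
Proof.
move=> gp; rewrite /= !inE !negb_or -!andbA andbT.
move=> /and5P[ab ac ad ae /and5P[bc bd be cd /andP[ce de]]].
have sw i j : i != j -> j != i by rewrite eq_sym.
have [da db dc] : [/\ det3 (x d) (x e) (x a) != 0,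
  det3 (x d) (x e) (x b) != 0 & det3 (x d) (x e) (x c) != 0].
  by split; apply: gp => //; apply: sw.
have [d1 d2 d3] : [/\ det3 (x b) (x c) (x d) != 0,
  det3 (x c) (x a) (x d) != 0 & det3 (x a) (x b) (x d) != 0].
  by split; apply: gp => //; apply: sw.
have [e1 e2 e3] : [/\ det3 (x b) (x c) (x e) != 0,
  det3 (x c) (x a) (x e) != 0 & det3 (x a) (x b) (x e) != 0].
  by split; apply: gp => //; apply: sw.
(* Reversing the third side orients the boundary cyclically, as in the triangle test. *)
rewrite -(@seg_cross_swap (x a) (x c)); first last.
- by apply: gp.
- by apply: gp.
rewrite /in_triangle /seg_cross /orient.
rewrite (same_sign _ _ (det3_plucker (x a) (x b) (x c) (x d) (x e))) //.
have := det3_plucker (x a) (x b) (x c) (x e) (x d).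
rewrite !(det3_swap (x d) (x e)) !mulrN -!opprD => /eqP; rewrite oppr_eq0.
move=> /eqP E; rewrite (same_sign _ _ E) //.
move: (0 < det3 (x d) (x e) (x a)) (0 < det3 (x d) (x e) (x b))
  (0 < det3 (x d) (x e) (x c)) => A B C.
move: (0 < _) (0 < _) (0 < _) (0 < _) (0 < _) (0 < _).
move: A B C; do 9! [case] => //=.
Qed.

Let cross_point a b c d (X : R) (u v : R) : X != 0 ->
  X *: a + u *: (b - a) = X *: c + v *: (d - c) ->
  a + (u / X) *: (b - a) = c + (v / X) *: (d - c).
Proof.
move=> X0 E; apply: (scalerI X0).
by rewrite !(scalerDr X) !scalerA !(mulrC X) !mulfVK.
Qed.

(** Cramer's rule. The common denominator is the change of [det3 a b _] between [d] and [c], nonzero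
    because exactly one of these two values is positive; by [E1] it is also the change of
    [det3 c d _] between [a] and [b]. *)
Lemma seg_crossW a b c d : seg_cross a b c d ->
  exists l m : R, [/\ 0 <= l <= 1, 0 <= m <= 1 &
    a + l *: (b - a) = c + m *: (d - c)].
Proof.
have E1 : det3 a b c - det3 a b d = det3 c d b - det3 c d a.
  rewrite /det3; ring.
have E2 : (det3 a b c - det3 a b d) *: a + (- det3 c d a) *: (b - a) =
    (det3 a b c - det3 a b d) *: c + det3 a b c *: (d - c).
  by apply/eqP; rewrite xpair_eqE /=; apply/andP; split; apply/eqP;
    rewrite /det3 /GRing.scale /=; ring.
rewrite /seg_cross /orient => /andP[hab hcd].
have X0 : det3 a b c - det3 a b d != 0.
  by apply: contraTneq hab => /eqP; rewrite subr_eq0 => /eqP ->; rewrite addbb.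
exists (- det3 c d a / (det3 a b c - det3 a b d)),
  (det3 a b c / (det3 a b c - det3 a b d)).
split; last exact: cross_point.
- move: hab hcd; case: ltrP => h1; case: ltrP => h2 //= _;
    case: ltrP => h3; case: ltrP => h4 //= _; try lra.
  + have h : 0 < det3 a b c - det3 a b d by lra.
    by rewrite divr_ge0 /= ?ler_pdivrMr//; lra.
  + have h : det3 a b c - det3 a b d < 0 by lra.
    by rewrite ler_ndivlMr ?ler_ndivrMr//; lra.
- move: hab hcd; case: ltrP => h1; case: ltrP => h2 //= _;
    case: ltrP => h3; case: ltrP => h4 //= _; try lra.
  + have h : 0 < det3 a b c - det3 a b d by lra.
    by rewrite divr_ge0 /= ?ler_pdivrMr//; lra.
  + have h : det3 a b c - det3 a b d < 0 by lra.
    by rewrite ler_ndivlMr ?ler_ndivrMr//; lra.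
Qed.

(** The three determinants of the test are the barycentric coordinates of [d] multiplied by their
    sum [det3 a b c], so equal signs give nonnegative quotients. *)
Lemma in_triangleW a b c d : det3 a b c != 0 -> in_triangle a b c d ->
  exists l m : R, [/\ 0 <= l, 0 <= m, l + m <= 1 &
    d = a + l *: (b - a) + m *: (c - a)].
Proof.
move=> h0 hd.
have hS : det3 a b d + det3 b c d + det3 c a d = det3 a b c.
  rewrite /det3; ring.
exists (det3 c a d / det3 a b c), (det3 a b d / det3 a b c).
have E : d = a + (det3 c a d / det3 a b c) *: (b - a) +
             (det3 a b d / det3 a b c) *: (c - a).
  apply: (scalerI h0); rewrite !scalerDr !scalerA.
  rewrite !(mulrC (det3 a b c)) !mulfVK //.
  apply/eqP; rewrite xpair_eqE /=; apply/andP; split; apply/eqP;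
    rewrite /det3 /GRing.scale /=; ring.
move: hd; rewrite /in_triangle /orient; case: ltrP => h1;
  case: ltrP => h2 //=; case: ltrP => h3 //= _.
- have h : 0 < det3 a b c by lra.
  by split=> //; rewrite ?divr_ge0 -?mulrDl ?ler_pdivrMr//; lra.
- have h : det3 a b c < 0 by rewrite lt_neqAle h0; lra.
  split=> //; rewrite -?mulrDl ?ler_ndivlMr ?ler_ndivrMr ?mul0r ?mul1r //; lra.
Qed.

End Orientation.

(** * Crossing parity of polygons *)

Notation "\xor_ ( i < n ) F" := (\big[addb/false]_(i < n) F)
  (at level 41, F at level 41, i, n at level 50).
Notation "\xor_ ( i < n | P ) F" := (\big[addb/false]_(i < n | P) F)
  (at level 41, F at level 41, i, n at level 50).
Notation "\xor_ ( m <= i < n ) F" := (\big[addb/false]_(m <= i < n) F)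
  (at level 41, F at level 41, i, m, n at level 50).

Lemma inj_interval_neq (T : eqType) (u : nat -> T) (m0 m : nat) :
  {in [pred k | m0 <= k <= m]%N &, injective u} ->
  forall k l, (m0 <= k < l)%N -> (l <= m)%N -> u k != u l.
Proof.
move=> uinj k l /andP[hk kl] hl; apply/eqP => /uinj E.
suff E' : k = l by rewrite E' ltnn in kl.
by apply: E; rewrite inE ?hk ?hl ?(leq_trans (ltnW kl)) ?(leq_trans _ (ltnW kl)).
Qed.

Section UpperSum.
Variable n : nat.
Implicit Type M : 'I_n -> 'I_n -> bool.

Definition upper_sum M : bool := \xor_(j < n) \xor_(k < n | (j < k)%N) M j k.

Lemma upper_sumD M1 M2 :
  upper_sum M1 (+) upper_sum M2 = upper_sum (fun j k => M1 j k (+) M2 j k).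
Proof.
by rewrite /upper_sum -big_split; apply: eq_bigr => j _; rewrite -big_split.
Qed.

Lemma eq_upper_sum M1 M2 : (forall j k, M1 j k = M2 j k) ->
  upper_sum M1 = upper_sum M2.
Proof. by move=> E; apply: eq_bigr => j _; apply: eq_bigr. Qed.

Lemma upper_sum_row M i : (forall j k, M j k = M k j) -> M i i = false ->
  (forall j k, M j k -> (j == i) || (k == i)) ->
  upper_sum M = \xor_(k < n) M i k.
Proof.
move=> Msym Mii Msupp; rewrite /upper_sum (bigD1 i) //=.
have -> : \big[addb/false]_(j < n | j != i) (\xor_(k < n | (j < k)%N) M j k) =
    \xor_(j < n | (j < i)%N) M i j.
  rewrite big_mkcond [RHS]big_mkcond /=; apply: eq_bigr => j _.
  case: eqVneq => [->|ji] /=; first by rewrite ltnn.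
  case: ifP => jlti.
    rewrite (bigD1 i) //= Msym big1 ?addbF // => k /andP[_ ki].
    by apply/negP => /Msupp; rewrite (negbTE ji) (negbTE ki).
  rewrite big1 // => k jk; apply/negP => /Msupp; rewrite (negbTE ji) /=.
  by move=> /eqP ki; rewrite -ki jk in jlti.
rewrite big_mkcond [X in _ (+) X]big_mkcond -big_split /=.
by apply: eq_bigr => k _; case: ltngtP => // [|/val_inj <-]; rewrite ?addbF.
Qed.

Lemma upper_sum_rows M i i' : i != i' -> (forall j k, M j k = M k j) ->
  M i i = false -> M i' i' = false -> M i i' = false ->
  (forall j k, M j k -> [|| j == i, k == i, j == i' | k == i']) ->
  upper_sum M = \xor_(k < n) M i k (+) \xor_(k < n) M i' k.
Proof.
move=> ii' Msym Mii Mi'i' Mii' Msupp.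
pose N l j k := M j k && ((j == l) || (k == l)).
(* The two crosses of rows and columns meet only at the entries indexed by [i] and [i'], where [M]
   vanishes. *)
have E : forall j k, M j k = N i j k (+) N i' j k.
  move=> j k; rewrite /N; case Mjk: (M j k) => //=.
  have n1 l : (l == i) && (l == i') = false.
    by apply/andP => -[/eqP -> /eqP E]; rewrite E eqxx in ii'.
  have n2 : (j == i) && (k == i') = false.
    by apply/andP => -[/eqP ji /eqP ki]; rewrite -ji -ki Mjk in Mii'.
  have n3 : (k == i) && (j == i') = false.
    by apply/andP => -[/eqP ki /eqP ji]; rewrite -ji -ki Msym Mjk in Mii'.
  move: (n1 j) (n1 k) n2 n3 (Msupp _ _ Mjk).
  by do 4! case: (_ == _).
rewrite (eq_upper_sum E) -upper_sumD.
have row l : M l l = false -> upper_sum (N l) = \xor_(k < n) M l k.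
  move=> Mll; rewrite (@upper_sum_row _ l).
  - by apply: eq_bigr => k _; rewrite /N eqxx andbT.
  - by move=> j k; rewrite /N Msym orbC.
  - by rewrite /N Mll.
  - by move=> j k /andP[].
by rewrite !row.
Qed.

End UpperSum.

Section Polygon.
Variables (R : realFieldType) (T : eqType) (x : T -> R * R).
Hypothesis gp : general_position x.
Variable n : nat.
Hypothesis n_gt1 : (1 < n)%N.
Implicit Types (z : 'I_n -> T) (L : 'I_n -> 'I_n -> bool).

Definition edge_cross z j k : bool :=
  seg_cross (x (z j)) (x (z (ordS j))) (x (z k)) (x (z (ordS k))).

Lemma edge_cross_sym z j k : edge_cross z j k = edge_cross z k j.
Proof. exact: seg_cross_sym. Qed.

(** [L] selects the pairs of edges to be counted. Vertices are indices into one family [x]: moving a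
    vertex changes an index, and a single general position hypothesis covers all polygons. *)
Definition crossing_parity z L : bool :=
  upper_sum (fun j k => L j k && edge_cross z j k).

Lemma ordS_neq (i : 'I_n) : ordS i != i.
Proof.
apply/eqP => /(congr1 val) /=; case: i => i /= hi.
have := hi; rewrite leq_eqVlt => /orP[/eqP E|h].
  by rewrite E modnn => i0; move: n_gt1; rewrite -E -i0.
by rewrite modn_small // => /eqP; rewrite -[X in _ == X]addn0 -addn1 eqn_add2l.
Qed.

(* When the vertex i moves from z i to y, a crossing of the two moving edges
   with the edge k appears or disappears only if the triangles swept by these
   edges contain a vertex of the edge k, or if the edge k crosses the segment
   from z i to y.  The first kind of change occurs for the two edges at that
   vertex, the second one for both moving edges. *)
Lemma crossing_parity_move z L (i : 'I_n) (y : T) :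
  injective z -> (forall j, z j != y) ->
  (forall j k, L j k = L k j) ->
  (forall j, L j j = false) -> (forall j, L j (ordS j) = false) ->
  (forall k, in_triangle (x (z i)) (x y) (x (z (ordS i))) (x (z k)) ->
     L i k = L i (ord_pred k)) ->
  (forall k, in_triangle (x (z (ord_pred i))) (x (z i)) (x y) (x (z k)) ->
     L (ord_pred i) k = L (ord_pred i) (ord_pred k)) ->
  (forall k, seg_cross (x (z i)) (x y) (x (z k)) (x (z (ordS k))) ->
     L i k = L (ord_pred i) k) ->
  crossing_parity (fun j => if j == i then y else z j) L = crossing_parity z L.
Proof.
move=> zinj zy Lsym L0 L1 hT hT' hX.
set z' := fun j => _; set p := ord_pred i.
have Spi : ordS p = i by rewrite /p ord_predK.
have pi : p != i by rewrite -{1}Spi eq_sym ordS_neq.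
have ip : i != p by rewrite eq_sym.
have z'E j : j != i -> z' j = z j by move=> /negbTE ji; rewrite /z' ji.
have z'i : z' i = y by rewrite /z' eqxx.
have Lp j : L (ordS j) j = false by rewrite Lsym.
(* The change of the matrix, supported on the rows and columns of the two edges [p] and [i] that end
   at the moving vertex. *)
pose M j k := (L j k && edge_cross z' j k) (+) (L j k && edge_cross z j k).
suff : upper_sum M = false.
  by rewrite /M -upper_sumD /crossing_parity; do 2! case: upper_sum.
have Msym j k : M j k = M k j.
  by rewrite /M Lsym (edge_cross_sym z') (edge_cross_sym z).
have neqS (j k : 'I_n) : ordS j != ordS k = (j != k).
  by rewrite (inj_eq (can_inj (@ordSK n))).
have Mi k : M i k = L i k && (seg_cross (x (z i)) (x y) (x (z k)) (x (z (ordS k)))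
    (+) (in_triangle (x (z i)) (x y) (x (z (ordS i))) (x (z k)) (+)
         in_triangle (x (z i)) (x y) (x (z (ordS i))) (x (z (ordS k))))).
  rewrite /M; case Lik: (L i k) => //=.
  have ki : k != i by apply: contraTneq Lik => ->; rewrite L0.
  have kSi : k != ordS i by apply: contraTneq Lik => ->; rewrite L1.
  have Ski : ordS k != i by apply: contraTneq Lik => <-; rewrite Lp.
  rewrite -(seg_cross_triangle gp (d := z k) (e := z (ordS k))).
    rewrite /edge_cross z'i !z'E ?ordS_neq // addbA addbA addbC.
    by case: seg_cross; case: seg_cross; case: seg_cross.
  have Sii := ordS_neq i; have Skk := ordS_neq k.
  have SkSi : ordS k != ordS i by rewrite neqS.
  rewrite /= !inE !negb_or !(inj_eq zinj) !(eq_sym y) !zy /= ?andbT.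
  by do ?[apply/andP; split]; rewrite // eq_sym.
have Mp k : M p k = L p k && (seg_cross (x (z i)) (x y) (x (z k)) (x (z (ordS k)))
    (+) (in_triangle (x (z p)) (x (z i)) (x y) (x (z k)) (+)
         in_triangle (x (z p)) (x (z i)) (x y) (x (z (ordS k))))).
  rewrite /M; case Lpk: (L p k) => //=.
  have kp : k != p by apply: contraTneq Lpk => ->; rewrite L0.
  have ki : k != i by apply: contraTneq Lpk => ->; rewrite -Spi L1.
  have Skp : ordS k != p by apply: contraTneq Lpk => <-; rewrite Lp.
  have Ski : ordS k != i by rewrite -Spi neqS.
  rewrite -(seg_cross_triangle gp (d := z k) (e := z (ordS k))).
    rewrite /edge_cross Spi z'i !z'E // addbA addbA.
    by case: seg_cross; case: seg_cross; case: seg_cross.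
  have Skk := ordS_neq k.
  rewrite /= !inE !negb_or !(inj_eq zinj) !(eq_sym y) !zy /= ?andbT.
  by do ?[apply/andP; split]; rewrite // eq_sym.
rewrite (upper_sum_rows ip) //; first last.
- move=> j k; rewrite /M; case: (eqVneq j i) => //= ji; case: (eqVneq k i) => //= ki.
  case: (eqVneq j p) => //= jp; case: (eqVneq k p) => //= kp.
  have Sji : ordS j != i by rewrite -Spi neqS.
  have Ski : ordS k != i by rewrite -Spi neqS.
  by rewrite /edge_cross !z'E // addbb.
- by rewrite /M -Spi Lp.
- by rewrite /M L0.
- by rewrite /M L0.
rewrite (eq_bigr _ (fun k _ => Mi k)) (eq_bigr _ (fun k _ => Mp k)) -big_split.
(* Summation by parts: the vertex [k] belongs to the edges [k] and [ord_pred k], which carry equal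
   labels whenever [f k] holds, so its two contributions cancel. *)
have vertices (l : 'I_n) (f : 'I_n -> bool) :
    (forall k, f k -> L l k = L l (ord_pred k)) ->
    \xor_(k < n) (L l k && (f k (+) f (ordS k))) = false.
  move=> hf; under eq_bigr do rewrite andb_addr.
  rewrite big_split /= [X in _ (+) X](reindex_inj (can_inj (@ord_predK n))) /=.
  rewrite -big_split big1 // => k _ /=; rewrite ord_predK.
  by case fk: (f k); rewrite ?andbF // (hf _ fk) addbb.
(* The segment from the old to the new position is a side of both swept triangles; its crossings
   enter both rows and cancel by [hX]. *)
under eq_bigr do rewrite /= !(andb_addr _ (seg_cross _ _ _ _)) addbACA.
rewrite big_split /= big1 /=; last first.
  move=> k _; case h: (seg_cross _ _ _ _); last by rewrite !andbF.
  by rewrite (hX _ h) addbb.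
by rewrite big_split /= !vertices.
Qed.

(* A chain from u 0 to u n' has the same crossing parity with a segment as the
   segment from u 0 to u n', as long as the triangles of the fan from u 0 do
   not separate the end points of that segment. *)
Lemma seg_cross_fan (u : nat -> T) (m0 m : nat) (d e : T) : (m0 < m)%N ->
  {in [pred k | m0 <= k <= m]%N &, injective u} -> d != e ->
  (forall k, (m0 <= k <= m)%N -> u k != d /\ u k != e) ->
  \xor_(m0 <= k < m) seg_cross (x (u k)) (x (u k.+1)) (x d) (x e) =
  seg_cross (x (u m0)) (x (u m)) (x d) (x e) (+)
  \xor_(m0.+1 <= k < m)
    (in_triangle (x (u m0)) (x (u k)) (x (u k.+1)) (x d) (+)
     in_triangle (x (u m0)) (x (u k)) (x (u k.+1)) (x e)).
Proof.
elim: m => // m IH; rewrite ltnS leq_eqVlt => /orP[/eqP -> _ _ _|m0m uinj de ude].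
  by rewrite big_nat1 big_geq // addbF.
have lem k : (m0 <= k <= m)%N -> (m0 <= k <= m.+1)%N.
  by case/andP=> -> /leqW.
rewrite (@big_nat_recr _ _ _ m m0) ?(ltnW m0m) // IH //; first last.
- by move=> k /lem /ude.
- by move=> k l /lem hk /lem hl; exact: uinj.
rewrite [in RHS](@big_nat_recr _ _ _ m m0.+1) //.
rewrite -(seg_cross_triangle gp (d := d) (e := e)); first last.
  have u_neq := inj_interval_neq uinj.
  have [ud ue] := ude m0 (introT andP (conj (leqnn _) (leqW (ltnW m0m)))).
  have [ud' ue'] := ude m (introT andP (conj (ltnW m0m) (leqnSn _))).
  have [ud2 ue2] := ude m.+1 (introT andP (conj (leqW (ltnW m0m)) (leqnn _))).
  rewrite /= !inE !negb_or ud ue ud' ue' ud2 ue2 de !u_neq ?leqnn ?m0m //=.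
  - by rewrite (ltnW m0m).
  - by rewrite ltnS (ltnW m0m).
rewrite /=; move: (\big[_/_]_(_ <= i < _) _) => B.
by case: B; do 3! case: (seg_cross _ _ _ _).
Qed.

End Polygon.

Lemma scale_mul (R : realFieldType) (a b : R) : a *: b = a * b.
Proof. by []. Qed.

(** The product [p * q] is at most 5/16 in absolute value and [r * e] at least 21/16. The bounds are
    those of coordinate differences for two segments whose ends are within 1/8 of the points at
    distance 1 on the two axes. *)
Lemma corner_gt0 (R : realFieldType) (p q r e : R) :
  `|p| <= 4^-1 -> `|q| <= 5 / 4 -> 7 / 4 <= r -> 3 / 4 <= e ->
  0 < p * q + r * e.
Proof.
move=> hp hq hr he.
have := ler_pM (normr_ge0 _) (normr_ge0 _) hp hq; rewrite -normrM ler_norml.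
have : 7 / 4 * (3 / 4) <= r * e by apply: ler_pM; lra.
move: (p * q) (r * e) => ? ?; lra.
Qed.

(** * Two chains along transverse axes *)

Section TransverseChains.
Variables (R : realFieldType) (c v w : R * R).

Definition det2 (v w : R * R) : R := v.1 * w.2 - v.2 * w.1.

Hypothesis vw : det2 v w != 0.

(** Coordinates of [z - c] in the basis [v], [w], by Cramer's rule. *)
Definition coord1 (z : R * R) : R := det2 (z - c) w / det2 v w.
Definition coord2 (z : R * R) : R := det2 v (z - c) / det2 v w.

Lemma det3_coord p q r : det3 p q r = det2 v w *
  ((coord1 q - coord1 p) * (coord2 r - coord2 p) -
   (coord2 q - coord2 p) * (coord1 r - coord1 p)).
Proof.
by rewrite /det3 /coord1 /coord2; move: vw => h; rewrite /det2 /= in h *; field.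
Qed.

Lemma coord1_convex (a b d : R * R) (l m : R) :
  coord1 (a + l *: (b - a) + m *: (d - a)) =
  coord1 a + l * (coord1 b - coord1 a) + m * (coord1 d - coord1 a).
Proof.
rewrite /coord1 -!mulrBl !mulrA -!mulrDl; congr (_ / _).
by rewrite /det2 /= !scale_mul; ring.
Qed.

Lemma coord2_convex (a b d : R * R) (l m : R) :
  coord2 (a + l *: (b - a) + m *: (d - a)) =
  coord2 a + l * (coord2 b - coord2 a) + m * (coord2 d - coord2 a).
Proof.
rewrite /coord2 -!mulrBl !mulrA -!mulrDl; congr (_ / _).
by rewrite /det2 /= !scale_mul; ring.
Qed.

Lemma convex_bound (R' : realFieldType) (k a b d l m : R') :
  0 <= l -> 0 <= m -> l + m <= 1 -> `|a| <= k -> `|b| <= k -> `|d| <= k ->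
  `|a + l * (b - a) + m * (d - a)| <= k.
Proof.
move=> l0 m0 lm; rewrite !ler_norml => /andP[a1 a2] /andP[b1 b2] /andP[d1 d2].
have n0 : 0 <= 1 - l - m by lra.
have -> : a + l * (b - a) + m * (d - a) = (1 - l - m) * a + l * b + m * d by ring.
have := (ler_wpM2l n0 a1, ler_wpM2l n0 a2, ler_wpM2l l0 b1, ler_wpM2l l0 b2,
  ler_wpM2l m0 d1, ler_wpM2l m0 d2).
by move=> [[[[[]]]]]; rewrite !mulrN => *; apply/andP; split; lra.
Qed.

Variables (T : eqType) (x : T -> R * R).
Hypothesis gp : general_position x.
Variables (u s : nat -> T) (m0 m l0 l : nat).
Hypotheses (m0m : (m0 < m)%N) (l0l : (l0 < l)%N).
Hypotheses (uinj : {in [pred k | m0 <= k <= m]%N &, injective u})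
  (sinj : {in [pred k | l0 <= k <= l]%N &, injective s}).
Hypothesis us :
  forall k j, (m0 <= k <= m)%N -> (l0 <= j <= l)%N -> u k != s j.
Hypothesis u_near : forall k, (m0 <= k <= m)%N -> `|coord2 (x (u k))| <= 8^-1.
Hypothesis s_near : forall k, (l0 <= k <= l)%N -> `|coord1 (x (s k))| <= 8^-1.
Hypotheses (u_start : `|coord1 (x (u m0)) + 1| <= 8^-1)
  (u_end : `|coord1 (x (u m)) - 1| <= 8^-1)
  (s_start : `|coord2 (x (s l0)) + 1| <= 8^-1)
  (s_end : `|coord2 (x (s l)) - 1| <= 8^-1).

Let no_triangle_u k d : 8^-1 < `|coord2 (x d)| -> (m0 < k < m)%N ->
  in_triangle (x (u m0)) (x (u k)) (x (u k.+1)) (x d) = false.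
Proof.
move=> hd /andP[m0k km]; apply/negP => /in_triangleW[].
  have u_neq := inj_interval_neq uinj.
  by apply: gp; apply: u_neq; clear -m0k km; lia.
move=> a [b [a0 b0 ab E]]; move: hd; rewrite E coord2_convex ltNge.
by rewrite convex_bound // u_near //; clear -m0k km; lia.
Qed.

Let no_triangle_s k d : 8^-1 < `|coord1 (x d)| -> (l0 < k < l)%N ->
  in_triangle (x (s l0)) (x (s k)) (x (s k.+1)) (x d) = false.
Proof.
move=> hd /andP[l0k kl]; apply/negP => /in_triangleW[].
  have s_neq := inj_interval_neq sinj.
  by apply: gp; apply: s_neq; clear -l0k kl; lia.
move=> a [b [a0 b0 ab E]]; move: hd; rewrite E coord1_convex ltNge.
by rewrite convex_bound // s_near //; clear -l0k kl; lia.
Qed.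

(** Each chain may be replaced by the segment joining its ends. The fan triangles of a chain stay in
    the strip of width 1/8 around its axis, which contains no end of the other chain. The two
    remaining segments cross once. *)
Lemma transverse_chains_parity :
  \xor_(m0 <= k < m) \xor_(l0 <= j < l)
    seg_cross (x (u k)) (x (u k.+1)) (x (s j)) (x (s j.+1)).
Proof.
have s_neq := inj_interval_neq sinj.
have u_neq := inj_interval_neq uinj.
rewrite exchange_big /=.
pose t k j := in_triangle (x (u m0)) (x (u k)) (x (u k.+1)) (x (s j)).
have E1 : \xor_(l0 <= j < l) \xor_(m0 <= k < m)
      seg_cross (x (u k)) (x (u k.+1)) (x (s j)) (x (s j.+1)) =
    \xor_(l0 <= j < l)
      seg_cross (x (u m0)) (x (u m)) (x (s j)) (x (s j.+1)) (+)
    \xor_(m0.+1 <= k < m) \xor_(l0 <= j < l) (t k j (+) t k j.+1).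
  rewrite [X in _ (+) X]exchange_big -big_split /=.
  apply: eq_big_nat => j /andP[l0j jl].
  rewrite (seg_cross_fan gp) //; first by apply: s_neq; clear -l0j jl; lia.
  by move=> k hk; split; apply: us => //; clear -l0j jl; lia.
(* Inner vertices of [s] may well lie in fan triangles of [u]; along [s] the sum telescopes to its
   two ends, which do not. *)
have E2 : \xor_(m0.+1 <= k < m) \xor_(l0 <= j < l) (t k j (+) t k j.+1) = false.
  have tele k : \xor_(l0 <= j < l) (t k j (+) t k j.+1) = t k l0 (+) t k l.
    elim: (l) (l0l) => // i IH; rewrite ltnS leq_eqVlt => /orP[/eqP ->|h].
      by rewrite big_nat1.
    by rewrite big_nat_recr ?(ltnW h) //= IH // addbA -(addbA (t k l0)) addbb addbF.
  rewrite big1_seq // => k /andP[_]; rewrite mem_index_iota => hk.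
  rewrite tele /t !no_triangle_u //.
  - by move: s_end; rewrite ler_distl ltr_normr; lra.
  - by move: s_start; rewrite -[1]opprK ler_distl ltr_normr; lra.
rewrite E1 E2 addbF; under eq_bigr do rewrite seg_cross_sym.
rewrite (seg_cross_fan gp) //; first last.
- by move=> k hk; split; rewrite eq_sym us //; clear -m0m; lia.
- by apply: u_neq; clear -m0m; lia.
rewrite big1_seq ?addbF; last first.
  move=> k /andP[_]; rewrite mem_index_iota => hk.
  rewrite !no_triangle_s //.
  - by move: u_end; rewrite ler_distl ltr_normr; lra.
  - by move: u_start; rewrite -[1]opprK ler_distl ltr_normr; lra.
rewrite /seg_cross /orient !det3_coord.
have [? ? ? ?] : [/\ (m0 <= m0 <= m)%N, (m0 <= m <= m)%N, (l0 <= l0 <= l)%N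
  & (l0 <= l <= l)%N] by rewrite !leqnn (ltnW m0m) (ltnW l0l).
move: (@u_near m0) (@u_near m) (@s_near l0) (@s_near l) u_start u_end s_start s_end.
move=> /(_ ltac:(done)) + /(_ ltac:(done)) + /(_ ltac:(done)) + /(_ ltac:(done)).
move: (coord1 (x (u m0))) (coord2 (x (u m0))) (coord1 (x (u m)))
  (coord2 (x (u m))) (coord1 (x (s l0))) (coord2 (x (s l0))) (coord1 (x (s l)))
  (coord2 (x (s l))) => a1 a2 b1 b2 c1 c2 d1 d2.
rewrite !ler_norml.
move=> /andP[? ?] /andP[? ?] /andP[? ?] /andP[? ?].
move=> /andP[? ?] /andP[? ?] /andP[? ?] /andP[? ?].
(* The unknown sign of [det2 v w] flips all four orientations at once, which [seg_cross] does not
   notice. *)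
have sgn (q : R) : q != 0 -> (0 < det2 v w * q) = ((0 < det2 v w) == (0 < q)).
  move: vw; move: (det2 v w) => D; case: (ltgtP D 0) => // hD _.
    by case: (ltgtP q 0) => // hq _; [rewrite nmulr_rgt0 | rewrite nmulr_rgt0 // ltNge ltW].
  by move=> _; rewrite pmulr_rgt0.
have h1 : 0 < (d1 - c1) * (a2 - c2) + (d2 - c2) * (c1 - a1).
  by apply: corner_gt0; rewrite ?ler_norml; lra.
have h2 : 0 < (d1 - c1) * (c2 - b2) + (d2 - c2) * (b1 - c1).
  by apply: corner_gt0; rewrite ?ler_norml; lra.
have h3 : 0 < (b2 - a2) * (c1 - a1) + (b1 - a1) * (a2 - c2).
  by apply: corner_gt0; rewrite ?ler_norml; lra.
have h4 : 0 < (b2 - a2) * (a1 - d1) + (b1 - a1) * (d2 - a2).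
  by apply: corner_gt0; rewrite ?ler_norml; lra.
have {}h1 : 0 < (d1 - c1) * (a2 - c2) - (d2 - c2) * (a1 - c1).
  by rewrite -mulrN opprB.
have {}h2 : (d1 - c1) * (b2 - c2) - (d2 - c2) * (b1 - c1) < 0.
  by rewrite -oppr_gt0 opprD opprK -mulrN opprB.
have {}h3 : (b1 - a1) * (c2 - a2) - (b2 - a2) * (c1 - a1) < 0.
  by rewrite -oppr_gt0 opprD opprK -mulrN opprB addrC.
have {}h4 : 0 < (b1 - a1) * (d2 - a2) - (b2 - a2) * (d1 - a1).
  by rewrite -mulrN opprB addrC.
rewrite !sgn ?(gt_eqF h1) ?(lt_eqF h2) ?(lt_eqF h3) ?(gt_eqF h4) // h1 h4.
by rewrite !ltNge !(ltW h2) !(ltW h3); case: (_ <= _).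
Qed.

End TransverseChains.

Lemma poly_small_nonroot (R : realFieldType) (p : {poly R}) (e : R) :
  p != 0 -> 0 < e -> exists s, [/\ 0 < s, s < e & p.[s] != 0].
Proof.
(* [size p] distinct points between 0 and [e]: one more than [p] can have roots. *)
move=> p0 e0; pose rs := [seq e / (k.+2)%:R | k <- iota 0 (size p)].
have rs_uniq : uniq rs.
  rewrite map_inj_uniq ?iota_uniq // => k l /(mulfI (lt0r_neq0 e0)) /invr_inj.
  by move/eqP; rewrite eqr_nat !eqSS => /eqP.
have : ~~ all (root p) rs.
  apply/negP => /(max_poly_roots p0) /(_ rs_uniq).
  by rewrite size_map size_iota ltnn.
move=> /allPn[_ /mapP[k _ ->]] hr; exists (e / k.+2%:R); split=> //.
- by rewrite divr_gt0 // ltr0n.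
- by rewrite ltr_pdivrMr ?ltr0n // ltr_pMr // ltr1n.
Qed.

(* Adding s (r, r^2) for pairwise distinct numbers r turns every determinant
   into a polynomial in s whose leading coefficient is a Vandermonde
   determinant. *)
Lemma general_position_near (R : realFieldType) (T : finType) (q : T -> R * R)
    (e : R) : 0 < e ->
  exists x : T -> R * R, general_position x /\
    forall t, `|(x t).1 - (q t).1| < e /\ `|(x t).2 - (q t).2| < e.
Proof.
move=> e0; pose r (t : T) : R := (enum_rank t)%:R.
have r_neq i j : i != j -> r j - r i != 0.
  apply: contra_neq => /eqP; rewrite subr_eq0 eqr_nat => /eqP h.
  by apply: enum_rank_inj; apply: val_inj.
pose A i j k := det3 (q i) (q j) (q k).
pose B i j k := ((q j).1 - (q i).1) * (r k ^+ 2 - r i ^+ 2) +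
  (r j - r i) * ((q k).2 - (q i).2) - ((q j).2 - (q i).2) * (r k - r i) -
  (r j ^+ 2 - r i ^+ 2) * ((q k).1 - (q i).1).
pose C i j k := (r j - r i) * (r k - r i) * (r k - r j).
pose D i j k := (A i j k)%:P + B i j k *: 'X + C i j k *: 'X^2.
pose P := \prod_(h : T * T * T | [&& h.1.1 != h.1.2, h.1.2 != h.2 & h.1.1 != h.2])
  D h.1.1 h.1.2 h.2.
have P0 : P != 0.
  apply/prodf_neq0 => -[[i j] k] /= /and3P[ij jk ik].
  apply/eqP => /(congr1 (fun p : {poly R} => p`_2)).
  rewrite /D !coefD coefC !coefZ coefX coefXn coef0 /= mulr0 mulr1 !add0r.
  by apply/eqP; rewrite !mulf_neq0 ?r_neq.
(* [N] exceeds every [r t] and its square, so [s < e / N] bounds both displacements. *)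
pose N : R := #|T|%:R ^+ 2 + #|T|%:R + 1.
have T0 : 0 <= #|T|%:R ^+ 2 :> R by rewrite exprn_ge0.
have T1 : 0 <= #|T|%:R :> R by [].
have N0 : 0 < N by rewrite /N; lra.
have [s [s0 se Ps]] := poly_small_nonroot P0 (divr_gt0 e0 N0).
exists (fun t => ((q t).1 + s * r t, (q t).2 + s * r t ^+ 2)); split.
  move=> i j k ij jk ik; move: Ps; rewrite /P horner_prod => /prodf_neq0.
  move=> /(_ (i, j, k)) /=; rewrite ij jk ik => /(_ isT).
  rewrite /D !hornerE /det3 /= /A /B /C /det3; apply: contra_neq => <-; ring.
move=> t /=; rewrite !(addrC (_ t).1) !(addrC (_ t).2) !addrK.
have r0 : 0 <= r t by rewrite ler0n.
have rT : r t <= #|T|%:R by rewrite ler_nat ltnW // ltn_ord.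
have seN : s * N < e by rewrite -ltr_pdivlMr.
have rN : r t ^+ 2 < N.
  have : r t ^+ 2 <= #|T|%:R ^+ 2 by rewrite ler_pXn2r ?nnegrE.
  by rewrite /N; lra.
have rN' : r t < N by rewrite /N; lra.
rewrite !ger0_norm ?mulr_ge0 ?exprn_ge0 ?(ltW s0) //; split.
- by apply: lt_trans seN; rewrite ltr_pM2l.
- by apply: lt_trans seN; rewrite ltr_pM2l.
Qed.

Ltac pair_ring :=
  apply/eqP; rewrite xpair_eqE /=; apply/andP; split; apply/eqP;
  rewrite ?scale_mul; ring.

Lemma pair_normZ (R : realType) (k : R) (a : R * R) : `|k *: a| = `|k| * `|a|.
Proof. exact: normrZ. Qed.

(** * Moving a whole polygon *)

Section PolygonMove.
Variables (R : realType) (T : eqType) (x : T -> R * R).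
Hypothesis gp : general_position x.

Lemma seg_cross_dist (a b c d : R * R) : seg_cross a b c d ->
  `|a - c| <= `|b - a| + `|d - c|.
Proof.
move=> /seg_crossW[l [m [/andP[l0 l1] /andP[m0 m1] E]]].
have -> : a - c = m *: (d - c) - l *: (b - a).
  have -> : m *: (d - c) = a + l *: (b - a) - c by rewrite E; pair_ring.
  by pair_ring.
rewrite (le_trans (ler_normB _ _)) // addrC lerD // pair_normZ ger0_norm //.
  by rewrite ler_piMl.
by rewrite ler_piMl.
Qed.

Lemma in_triangle_dist (a b c d : R * R) (e : R) : det3 a b c != 0 ->
  in_triangle a b c d -> `|b - a| <= e -> `|c - a| <= e -> `|d - a| <= e.
Proof.
move=> h /in_triangleW-/(_ h)[l [m [l0 m0 lm ->]]] hb hc.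
have -> : a + l *: (b - a) + m *: (c - a) - a = l *: (b - a) + m *: (c - a).
  by pair_ring.
rewrite (le_trans (ler_normD _ _)) // !pair_normZ !ger0_norm //.
have := ler_wpM2l l0 hb; have := ler_wpM2l m0 hc.
have : (l + m) * e <= e by rewrite ler_piMl // (le_trans _ hb).
by rewrite mulrDl; lra.
Qed.

Variable n : nat.
Hypothesis n_gt1 : (1 < n)%N.

Lemma eq_crossing_parity (z z' : 'I_n -> T) L L' : (forall i, z i = z' i) ->
  (forall i j, edge_cross x z i j -> L i j = L' i j) ->
  crossing_parity x z L = crossing_parity x z' L'.
Proof.
move=> zE LE; have {zE} -> : z' = z by apply/funext => i; rewrite zE.
apply: eq_upper_sum => j k; case h: (edge_cross _ _ _ _); last by rewrite !andbF.
by rewrite !andbT; apply: LE; rewrite h.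
Qed.

Variables (z z' : 'I_n -> T) (L : 'I_n -> 'I_n -> bool) (B : 'I_n -> R * R).
Variable e : R.
Hypotheses (zinj : injective z) (z'inj : injective z')
  (zz' : forall i j, z i != z' j).
Hypotheses (Lsym : forall j k, L j k = L k j) (L0 : forall j, L j j = false)
  (L1 : forall j, L j (ordS j) = false).
Hypotheses (xz : forall i, `|x (z i) - B i| <= e)
  (xz' : forall i, `|x (z' i) - B i| <= e)
  (BS : forall i, `|B (ordS i) - B i| <= e)
  (L_pred : forall i j, `|B i - B j| <= 7 * e -> L i j = L i (ord_pred j)).

(** The polygons [w l], with the first [l] vertices moved, interpolate between [z] and [z']. All
    vertices concerned in one move are close to each other, so the reference points [B] are close
    and [L_pred] supplies the label conditions of [crossing_parity_move]. *)
Lemma crossing_parity_polygon_move :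
  crossing_parity x z' L = crossing_parity x z L.
Proof.
pose w l (j : 'I_n) := if (j < l)%N then z' j else z j.
have wn l (i j : 'I_n) : (i < l)%N = false -> w l j != z' i.
  rewrite /w => il; case: ifP => jl; last exact: zz'.
  by rewrite (inj_eq z'inj); apply: contraFneq il => <-.
have w_inj l : injective (w l).
  move=> i j; rewrite /w; case: ifP => _; case: ifP => _.
  - exact: z'inj.
  - by move=> /eqP; rewrite eq_sym (negbTE (zz' _ _)).
  - by move=> /eqP; rewrite (negbTE (zz' _ _)).
  - exact: zinj.
have xw l i : `|x (w l i) - B i| <= e by rewrite /w; case: ifP.
(* Origin of [7 * e]: a moving segment has length at most [2 * e] and an edge at most [3 * e], so
   starting points of crossing ones are [5 * e] apart; passing to the points of [B] costs
   [2 * e]. *)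
have near (u v : R * R) i j k l : `|u - B i| <= k -> `|v - B j| <= l ->
    `|u - v| <= 7 * e - k - l -> `|B i - B j| <= 7 * e.
  move=> hu hv huv; have := ler_distD u (B i) (B j); rewrite (distrC (B i) u).
  by have := ler_distD v u (B j); lra.
suff step l : (l <= n)%N -> crossing_parity x (w l) L = crossing_parity x (w 0%N) L.
  have := step n (leqnn n); rewrite /w.
  by under eq_fun do rewrite ltn_ord.
elim: l => // l IH ln; rewrite -IH ?(ltnW ln) //; pose i := Ordinal ln.
have e0 : 0 <= e by apply: le_trans (xz i).
have -> : w l.+1 = fun j => if j == i then z' i else w l j.
  apply/funext => j; rewrite /w ltnS leq_eqVlt -[_ == l]/(_ == val i) val_eqE.
  by case: eqVneq => [->|].
have zi : w l i = z i by rewrite /w ltnn.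
have xwS k j : `|x (w k (ordS j)) - B j| <= 2 * e.
  have := ler_distD (B (ordS j)) (x (w k (ordS j))) (B j).
  by have := xw k (ordS j); have := BS j; lra.
apply: crossing_parity_move => //.
- by move=> j; apply: wn; rewrite ltnn.
- move=> k hk; apply: L_pred.
  have hd : det3 (x (w l i)) (x (z' i)) (x (w l (ordS i))) != 0.
    apply: gp; rewrite ?wn ?ltnn ?(inj_eq (@w_inj l)) //.
    + by rewrite eq_sym wn ?ltnn.
    + by rewrite eq_sym ordS_neq.
  apply: (near _ _ _ _ _ _ (xw l i) (xw l k)); rewrite -normrN opprB.
  apply: (in_triangle_dist hd hk).
  + have := ler_distD (B i) (x (z' i)) (x (w l i)).
    by rewrite (distrC (B i)); have := xw l i; have := xz' i; lra.
  + have := ler_distD (B i) (x (w l (ordS i))) (x (w l i)).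
    by rewrite (distrC (B i)); have := xw l i; have := xwS l i; lra.
- move=> k hk; apply: L_pred.
  have Sp : ordS (ord_pred i) = i by rewrite ord_predK.
  have hd : det3 (x (w l (ord_pred i))) (x (w l i)) (x (z' i)) != 0.
    apply: gp; rewrite ?wn ?ltnn //.
      by rewrite (inj_eq (@w_inj l)) -{2}Sp eq_sym ordS_neq.
  have xwp := xwS l (ord_pred i); rewrite Sp in xwp.
  apply: (near _ _ _ _ _ _ (xw l (ord_pred i)) (xw l k)); rewrite -normrN opprB.
  apply: (in_triangle_dist hd hk).
  + have := ler_distD (B (ord_pred i)) (x (w l i)) (x (w l (ord_pred i))).
    rewrite (distrC (B _)); have := xw l (ord_pred i); lra.
  + have := ler_distD (B (ord_pred i)) (x (z' i)) (x (w l (ord_pred i))).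
    rewrite (distrC (B _)); have := xw l (ord_pred i).
    have := ler_distD (B i) (x (z' i)) (B (ord_pred i)).
    by have := BS (ord_pred i); rewrite Sp; have := xz' i; lra.
- move=> k /seg_cross_dist hk; rewrite Lsym (Lsym _ k); apply: L_pred.
  apply: (near _ _ _ _ _ _ (xw l k) (xw l i)); rewrite distrC.
  apply: le_trans hk _.
  have := ler_distD (B i) (x (z' i)) (x (w l i)).
  rewrite (distrC (B i)); have := xw l i; have := xz' i.
  have := ler_distD (B k) (x (w l (ordS k))) (x (w l k)).
  by rewrite (distrC (B k)); have := xw l k; have := xwS l k; lra.
Qed.

End PolygonMove.

(** * Virtual double points of a one-parameter family of curves *)

Section PairContinuity.
Variables T U V : topologicalType.

Lemma continuous_pairing (f : T -> U) (g : T -> V) :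
  continuous f -> continuous g -> continuous (fun x => (f x, g x)).
Proof. by move=> cf cg x; apply: cvg_pair; [exact: cf | exact: cg]. Qed.

Lemma continuous_fst (f : T -> U * V) :
  continuous f -> continuous (fun x => (f x).1).
Proof. by move=> cf x; apply: (cvg_comp _ _ (cf x)); exact: cvg_fst. Qed.

Lemma continuous_snd (f : T -> U * V) :
  continuous f -> continuous (fun x => (f x).2).
Proof. by move=> cf x; apply: (cvg_comp _ _ (cf x)); exact: cvg_snd. Qed.

Lemma continuous_compose (f : T -> U) (g : U -> V) :
  continuous f -> continuous g -> continuous (fun x => g (f x)).
Proof. by move=> cf cg x; apply: (cvg_comp _ _ (cf x)); exact: cg. Qed.

End PairContinuity.

Lemma near_normP (R : realType) (V : normedModType R) (x : V) (P : V -> Prop) :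
  (\forall y \near x, P y) <->
  exists2 e, 0 < e & forall y, `|y - x| < e -> P y.
Proof.
split=> [/nbhs_normP[e /= e0 he]|[e e0 he]].
  by exists e => // y yx; apply: he; rewrite /ball_ /= distrC.
by apply/nbhs_normP; exists e => //= y yx; apply: he; rewrite distrC.
Qed.

(** * Uniformity from compactness *)

Section Compactness.
Variable R : realType.

(** The near-covering form of compactness, applied to the filter of right neighbourhoods of 0. *)
Lemma compact_uniform (X : topologicalType) (K : set X) (Q : R -> X -> Prop) :
  compact K ->
  (forall e e' y, 0 < e' -> e' <= e -> Q e y -> Q e' y) ->
  (forall x, K x -> exists2 e, 0 < e & \forall y \near x, Q e y) ->
  exists2 e, 0 < e & forall y, K y -> Q e y.
Proof.
move=> /compact_near_coveringP Kcov Qmono Qloc.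
have [|e [e0 Qe]] := @filter_ex _ (0 : R)^'+ _ (fun e => 0 < e /\ K `<=` Q e).
  apply: filterI; first exact: nbhs_right_gt.
  apply: (Kcov R 0^'+ Q) => x Kx; have [e e0 Qx] := Qloc x Kx.
  exists ([set y | Q e y], [set e' | 0 < e' /\ e' <= e]) => /=.
    split; first exact: Qx.
    by apply: filterI; [exact: nbhs_right_gt | exact: nbhs_right_le].
  by move=> [y e'] [/= Qy [e'0 e'e]]; apply: Qmono Qy.
by exists e.
Qed.

(** The tube lemma for the compact factor [0, 1]. *)
Lemma near_segment (X : topologicalType) (y : X) (P : R -> X -> Prop) :
  (forall u : R, 0 <= u <= 1 -> \forall p \near (u, y), P p.1 p.2) ->
  \forall z \near y, forall u, 0 <= u <= 1 -> P u z.
Proof.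
move=> Ploc; have /compact_near_coveringP cov := @segment_compact R 0 1.
have : \forall z \near y, `[0, 1] `<=` P^~ z.
  apply: (cov X (nbhs y) (fun z u => P u z)) => u; rewrite /= in_itv /=.
  exact: Ploc.
by apply: filterS => z hz u u01; apply: hz; rewrite /= in_itv.
Qed.

Lemma int_periodic (Y : Type) (f : R -> Y) : (forall p, f (p + 1) = f p) ->
  forall (k : int) p, f (p + k%:~R) = f p.
Proof.
move=> f1; have fn (n : nat) p : f (p + n%:R) = f p.
  by elim: n => [|n IH]; rewrite ?addr0 // -natr1 addrA f1.
move=> [n|n] p; first exact: fn.
by rewrite NegzE -[RHS](fn n.+1) mulrNz -[in LHS](fn n.+1) subrK.
Qed.

End Compactness.

Section DoublePoints.
Variable R : realType.
Variables (b : R -> R -> R * R) (V : R -> R -> R -> Prop).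
Hypothesis b_cont : continuous (fun z : R * R => b z.1 z.2).
Hypothesis b_per : forall p t, b (p + 1) t = b p t.
Hypothesis V_sym : forall p q t, V p q t -> V q p t.
Hypothesis V_per : forall p q t, V (p + 1) q t = V p q t.
Hypothesis V_loc : forall p q t, b p t = b q t ->
  \forall y \near (p, q, t), b y.1.1 y.2 = b y.1.2 y.2 ->
    (V y.1.1 y.1.2 y.2 <-> V p q t).
Local Notation R3 := (R * R * R)%type.
Implicit Types y z : R3.

Definition gap y : R * R := b y.1.1 y.2 - b y.1.2 y.2.

Let W y : Prop := V y.1.1 y.1.2 y.2.

Let shift (k l : int) y : R3 := (y.1.1 + k%:~R, y.1.2 + l%:~R, y.2).

Let gap_shift k l y : gap (shift k l y) = gap y.
Proof. by rewrite /gap /= !(int_periodic (f := b^~ y.2)). Qed.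

Let W_shift k l y : W (shift k l y) = W y.
Proof.
rewrite /W /= (int_periodic (f := fun p => V p _ y.2)); last by move=> p.
have Vsym p q t : V p q t = V q p t by apply/propext; split; exact: V_sym.
by rewrite Vsym (int_periodic (f := fun p => V p _ y.2)).
Qed.

Let shift_sub k l y z : shift k l y - shift k l z = y - z.
Proof.
by rewrite /shift; apply/eqP; rewrite !xpair_eqE /= eqxx andbT;
  apply/andP; split; apply/eqP; ring.
Qed.

(** Compactness of the unit cube; integer shifts bring any pair of circle parameters into it. *)
Let cube_uniform (Q : R -> R3 -> Prop) :
  (forall e e' y, 0 < e' -> e' <= e -> Q e y -> Q e' y) ->
  (forall x : R3, exists2 e, 0 < e & \forall y \near x, Q e y) ->
  (forall k l e y, Q e (shift k l y) -> Q e y) ->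
  exists2 e, 0 < e & forall y, 0 <= y.2 <= 1 -> Q e y.
Proof.
move=> Qmono Qloc Qshift.
have K : compact ((`[0, 1] `*` `[0, 1]) `*` `[0, 1] : set R3).
  by do !apply: compact_setX; exact: segment_compact.
have [e e0 Qe] := compact_uniform K Qmono (fun x _ => Qloc x).
exists e => // y yt; apply: (Qshift (- Num.floor y.1.1) (- Num.floor y.1.2)).
apply: Qe; rewrite /shift /= !in_itv /= yt !mulrNz.
split=> //; split.
- by have := floor_le y.1.1; have := ltW (floorD1_gt y.1.1); rewrite intrD1; lra.
- by have := floor_le y.1.2; have := ltW (floorD1_gt y.1.2); rewrite intrD1; lra.
Qed.

Let b_near (e : R) (p t : R) : 0 < e ->
  \forall z \near (p, t), `|b z.1 z.2 - b p t| < e.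
Proof.
move=> e0; have /cvgr_dist_lt/(_ e e0) := @b_cont (p, t).
by apply: filterS => z; rewrite distrC.
Qed.

Let gap_cont : continuous gap.
Proof.
have cid : continuous (id : R3 -> R3) by move=> ?; exact: cvg_id.
move=> y; apply: cvgB.
  apply: (@continuous_compose _ _ _ (fun y : R3 => (y.1.1, y.2)) _ _ b_cont).
  by apply: continuous_pairing; do ?[apply: continuous_fst|apply: continuous_snd].
apply: (@continuous_compose _ _ _ (fun y : R3 => (y.1.2, y.2)) _ _ b_cont).
by apply: continuous_pairing; do ?[apply: continuous_fst|apply: continuous_snd].
Qed.

(** Approximate double points are close to true ones: near a zero of [gap] that zero serves, and
    near any other point [gap] is bounded below. The zero found may lie at another level, even
    outside [0, 1]. *)
Lemma gap_near_zero (r : R) : 0 < r -> exists2 e, 0 < e & forall y,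
  0 <= y.2 <= 1 -> `|gap y| < e -> exists2 z, gap z = 0 & `|z - y| < r.
Proof.
move=> r0; pose Q e y := `|gap y| < e -> exists2 z, gap z = 0 & `|z - y| < r.
apply: (@cube_uniform Q).
- by move=> e e' y _ e'e Qe h; apply: Qe; apply: lt_le_trans e'e.
- move=> x; have [gx|gx] := eqVneq (gap x) 0.
    exists 1 => //; apply/near_normP; exists r => // y yx _.
    by exists x => //; rewrite distrC.
  exists (`|gap x| / 2); first by rewrite divr_gt0 ?normr_gt0.
  have h0 : 0 < `|gap x| / 2 by rewrite divr_gt0 ?normr_gt0.
  have /cvgr_dist_lt/(_ _ h0) := @gap_cont x.
  apply: filterS => y hy; rewrite /Q => hy'; exfalso.
  have := ler_distD (gap y) (gap x) 0; rewrite !subr0; lra.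
- move=> k l e y; rewrite /Q gap_shift => h /h[z z0 zy].
  exists (shift (- k) (- l) z); first by rewrite gap_shift.
  rewrite -(shift_sub k l); congr (`|_| < r): zy; congr (_ - _).
  by rewrite /shift /= !mulrNz !subrK; case: (z) => [[]].
Qed.

(** Uniform version of [V_loc]. Diagonal triples are zeros of [gap] too, so this also keeps virtual
    double points away from the diagonal when [V] is irreflexive. *)
Lemma virtual_separated : exists2 d, 0 < d & forall y z z', 0 <= y.2 <= 1 ->
  `|z - y| < d -> `|z' - y| < d -> gap z = 0 -> gap z' = 0 ->
  V z.1.1 z.1.2 z.2 -> V z'.1.1 z'.1.2 z'.2.
Proof.
pose Q d y := forall z z', `|z - y| < d -> `|z' - y| < d ->
  gap z = 0 -> gap z' = 0 -> W z -> W z'.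
suff [d d0 Qd] : exists2 d, 0 < d & forall y, 0 <= y.2 <= 1 -> Q d y.
  by exists d => // y z z' yt; exact: Qd.
apply: cube_uniform.
- move=> e e' y _ e'e Qe z z' zy z'y; apply: Qe.
    exact: lt_le_trans e'e.
  exact: lt_le_trans e'e.
- move=> x.
  have : \forall y \near x, gap y = 0 -> (W y <-> W x).
    have [gx|gx] := eqVneq (gap x) 0.
      have /V_loc : b x.1.1 x.2 = b x.1.2 x.2 by apply/eqP; rewrite -subr_eq0 -/(gap x) gx.
      case: (x) => -[p q] t /=; apply: filterS => y hy gy; apply: hy.
      by apply/eqP; rewrite -subr_eq0 -/(gap y) gy.
    have h0 : 0 < `|gap x| by rewrite normr_gt0.
    have /cvgr_dist_lt/(_ _ h0) := @gap_cont x.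
    by apply: filterS => y hy gy; move: hy; rewrite gy subr0 ltxx.
  move=> /near_normP[e e0 he]; exists (e / 2); first by rewrite divr_gt0.
  have e2 : 0 < e / 2 by rewrite divr_gt0.
  apply/near_normP; exists (e / 2) => // y yx.
  move=> z z' zy z'y gz gz' Wz.
  have zx : `|z - x| < e.
    by have := ler_distD y z x; lra.
  have z'x : `|z' - x| < e.
    by have := ler_distD y z' x; lra.
  by apply/(he _ z'x gz'); apply/(he _ zx gz).
- move=> k l e y Qe z z' zy z'y gz gz' Wz.
  rewrite -(W_shift k l); apply: (Qe (shift k l z)); rewrite ?shift_sub //.
  + by rewrite gap_shift.
  + by rewrite gap_shift.
  + by rewrite W_shift.
Qed.

Lemma b_uniform (e : R) : 0 < e -> exists2 d, 0 < d & forall p t p' t',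
  0 <= t <= 1 -> `|p' - p| < d -> `|t' - t| < d -> `|b p' t' - b p t| < e.
Proof.
move=> e0; pose Q d y := forall p' t', `|p' - y.1.1| < d -> `|t' - y.2| < d ->
  `|b p' t' - b y.1.1 y.2| < e.
suff [d d0 Qd] : exists2 d, 0 < d & forall y, 0 <= y.2 <= 1 -> Q d y.
  by exists d => // p t p' t' ht; exact: (Qd (p, p, t)).
apply: cube_uniform.
- move=> d d' y _ d'd Qd p' t' hp ht; apply: Qd.
    exact: lt_le_trans d'd.
  exact: lt_le_trans d'd.
- move=> [[p q] t]; have e2 : 0 < e / 2 by rewrite divr_gt0.
  have /near_normP[d d0 hd] := b_near p t e2.
  have d2 : 0 < d / 2 by rewrite divr_gt0.
  exists (d / 2) => //; apply/near_normP; exists (d / 2) => // -[[p1 q1] t1].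
  rewrite !prod_normE /= !gt_max => /andP[/andP[pp1 qq1] tt1].
  move=> p' t' /= p'p1 t't1.
  have hd' p2 t2 : `|p2 - p| < d -> `|t2 - t| < d -> `|b p2 t2 - b p t| < e / 2.
    by move=> h1 h2; apply: (hd (p2, t2)); rewrite prod_normE /= gt_max h1.
  have := ler_distD (b p t) (b p' t') (b p1 t1).
  rewrite (distrC (b p t)).
  have : `|b p' t' - b p t| < e / 2.
    apply: hd'.
      by have := ler_distD p1 p' p; lra.
    by have := ler_distD t1 t' t; lra.
  have : `|b p1 t1 - b p t| < e / 2 by apply: hd'; lra.
  lra.
- move=> k l d y Qd p' t' hp ht; have := Qd (p' + k%:~R) t'.
  rewrite /= !(int_periodic (f := b^~ _)) // => -> //.
  by rewrite opprD addrACA subrr addr0.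
Qed.

End DoublePoints.

(** * Counting crossings at the ends *)

Section Windows.
Variable R : realType.

Lemma det2_bound (a b : R * R) : `|det2 a b| <= 2 * (`|a| * `|b|).
Proof.
have le1 (x : R * R) : `|x.1| <= `|x| by rewrite prod_normE le_max lexx.
have le2 (x : R * R) : `|x.2| <= `|x| by rewrite prod_normE le_max lexx orbT.
rewrite (le_trans (ler_normB _ _)) // !normrM.
have : `|a.1| * `|b.2| <= `|a| * `|b| by apply: ler_pM.
have : `|a.2| * `|b.1| <= `|a| * `|b| by apply: ler_pM.
lra.
Qed.

Lemma seq_uniform (A : eqType) (s : seq A) (Q : R -> A -> Prop) :
  (forall e e' x, 0 < e' -> e' <= e -> Q e x -> Q e' x) ->
  (forall x, x \in s -> exists2 e, 0 < e & Q e x) ->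
  exists2 e, 0 < e & forall x, x \in s -> Q e x.
Proof.
move=> Qmono; elim: s => [|x s IH] Qs; first by exists 1.
have [e e0 Qe] := Qs x (mem_head _ _).
have [|e' e'0 Qe'] := IH; first by move=> y ys; apply: Qs; rewrite inE ys orbT.
have m0 : 0 < Num.min e e' by rewrite lt_min e0.
exists (Num.min e e') => // y; rewrite inE => /predU1P[->|ys].
  by apply: Qmono Qe; rewrite ?ge_min ?lexx.
by apply: Qmono (Qe' _ ys); rewrite ?ge_min ?lexx ?orbT.
Qed.

Variable c : R -> R * R.

Definition slope (p : R) (v : R * R) : Prop := forall k, 0 < k ->
  exists2 r, 0 < r & forall h, `|h| <= r ->
    `|c (p + h) - c p - h *: v| <= k * `|h|.

(* In suitable affine coordinates the points close to the curve near the
   parameters x.1 and x.2 are close to the two coordinate axes. *)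
Definition window (r e : R) (x : R * R) : Prop := exists v w : R * R,
  det2 v w != 0 /\ forall z h, `|h| <= r ->
    (`|z - c (x.1 + h)| <= e -> `|coord2 (c x.1) v w z| <= 16^-1 /\
       `|coord1 (c x.1) v w z - h / r| <= 16^-1) /\
    (`|z - c (x.2 + h)| <= e -> `|coord1 (c x.1) v w z| <= 16^-1 /\
       `|coord2 (c x.1) v w z - h / r| <= 16^-1).

(** The axes are the two velocities scaled by [r], so parameter offsets between [- r] and [r]
    correspond to coordinates between -1 and 1. *)
Lemma window_exists (x v w : R * R) : c x.1 = c x.2 ->
  slope x.1 v -> slope x.2 w -> det2 v w != 0 ->
  exists2 r0, 0 < r0 & forall r, 0 < r -> r <= r0 ->
    exists2 e, 0 < e & window r e x.
Proof.
(* A point within [k * r] of the curve is within [2 * (k * r)] of the tangent line point; with the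
   factor 2 of [det2_bound] the coordinate error is at most 4/64. *)
move=> cx sv sw D0; pose k := `|det2 v w| / (64 * (`|v| + `|w| + 1)).
have M0 : 0 < 64 * (`|v| + `|w| + 1).
  by have := normr_ge0 v; have := normr_ge0 w; lra.
have k0 : 0 < k by rewrite divr_gt0 ?normr_gt0.
have [r1 r10 hr1] := sv _ k0; have [r2 r20 hr2] := sw _ k0.
exists (Num.min r1 r2); first by rewrite lt_min r10.
move=> r r0; rewrite le_min => /andP[rr1 rr2].
exists (k * r); first exact: mulr_gt0.
have rn0 : r != 0 by rewrite gt_eqF.
have err (u y : R * R) h (p : R) : `|h| <= r -> `|u| <= `|v| + `|w| ->
    `|c (p + h) - c p - h *: y| <= k * `|h| ->
    forall z, `|z - c (p + h)| <= k * r ->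
    `|det2 u (z - c p - h *: y) / (r * det2 v w)| <= 16^-1.
  move=> hr uvw hk z hz.
  have hE : `|z - c p - h *: y| <= 2 * (k * r).
    have -> : z - c p - h *: y = (z - c (p + h)) + (c (p + h) - c p - h *: y).
      by pair_ring.
    rewrite (le_trans (ler_normD _ _)) //.
    have : k * `|h| <= k * r by rewrite ler_pM2l.
    lra.
  rewrite normrM normfV normrM (gtr0_norm r0) ler_pdivrMr; last first.
    by rewrite mulr_gt0 ?normr_gt0.
  apply: le_trans (det2_bound _ _) _.
  have h1 : `|u| * `|z - c p - h *: y| <= (`|v| + `|w| + 1) * (2 * (k * r)).
    by apply: ler_pM => //; lra.
  have h2 : k * (64 * (`|v| + `|w| + 1)) = `|det2 v w|.
    by rewrite /k divfK // gt_eqF.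
  have h3 : (`|v| + `|w| + 1) * (2 * (k * r)) = r * `|det2 v w| / 32.
    by rewrite -h2; field.
  lra.
have D1 : r * v.1 * (r * w.2) - r * v.2 * (r * w.1) != 0.
  have -> : r * v.1 * (r * w.2) - r * v.2 * (r * w.1) = r * r * det2 v w.
    by rewrite /det2; ring.
  by rewrite !mulf_neq0.
have vle : `|v| <= `|v| + `|w| by rewrite lerDl.
have wle : `|w| <= `|v| + `|w| by rewrite lerDr.
exists (r *: v), (r *: w); split.
  have -> : det2 (r *: v) (r *: w) = r * r * det2 v w.
    by rewrite /det2 /= !scale_mul; ring.
  by rewrite !mulf_neq0.
move=> z h hr; split=> hz; split.
- have -> : coord2 (c x.1) (r *: v) (r *: w) z =
     det2 v (z - c x.1 - h *: v) / (r * det2 v w).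
    rewrite /coord2; move: D0; rewrite /det2 /= !scale_mul => D0; field.
    by apply/and3P; split; [exact: D0 | exact: rn0 | exact: D1].
  by apply: err hz => //; apply: hr1; lra.
- have -> : coord1 (c x.1) (r *: v) (r *: w) z - h / r =
     - (det2 w (z - c x.1 - h *: v) / (r * det2 v w)).
    rewrite /coord1; move: D0; rewrite /det2 /= !scale_mul => D0; field.
    by apply/and3P; split; [exact: D0 | exact: rn0 | exact: D1].
  by rewrite normrN; apply: err hz => //; apply: hr1; lra.
- have -> : coord1 (c x.1) (r *: v) (r *: w) z =
     - (det2 w (z - c x.1 - h *: w) / (r * det2 v w)).
    rewrite /coord1; move: D0; rewrite /det2 /= !scale_mul => D0; field.
    by apply/and3P; split; [exact: D0 | exact: rn0 | exact: D1].
  by rewrite normrN cx; apply: err hz => //; apply: hr2; lra.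
- have -> : coord2 (c x.1) (r *: v) (r *: w) z - h / r =
     det2 v (z - c x.1 - h *: w) / (r * det2 v w).
    rewrite /coord2; move: D0; rewrite /det2 /= !scale_mul => D0; field.
    by apply/and3P; split; [exact: D0 | exact: rn0 | exact: D1].
  by rewrite cx; apply: err hz => //; apply: hr2; lra.
Qed.

End Windows.

Section WindowParity.
Variables (R : realType) (c : R -> R * R) (T : eqType) (x : T -> R * R).
Hypothesis gp : general_position x.
Variables (n : nat) (z : 'I_n.+1 -> T) (a e : R).
Hypothesis zinj : injective z.

Definition grid (k : nat) : R := a + k%:R / n.+1%:R.

Hypothesis xz : forall i, `|x (z i) - c (grid i)| <= e.

Definition grid_vertex (k : nat) : T := z (inord k).

Let vertex_near k : (k <= n)%N -> `|x (grid_vertex k) - c (grid k)| <= e.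
Proof. by move=> kn; have := xz (inord k); rewrite inordK. Qed.

Let vertex_inj k l : (k <= n)%N -> (l <= n)%N ->
  grid_vertex k = grid_vertex l -> k = l.
Proof.
by move=> kn ln /zinj /(congr1 (@nat_of_ord _)); rewrite !inordK.
Qed.

Lemma grid_le k l : (k <= l)%N -> grid k <= grid l.
Proof. by move=> kl; rewrite lerD2l ler_pM2r ?invr_gt0 ?ltr0n // ler_nat. Qed.

(** A mesh of at most [r / 32] puts the chain ends within 1/32 of the coordinates -1 and 1; with the
    window error 1/16 this stays below the 1/8 required for transverse chains. *)
Lemma window_parity (r : R) (y : R * R) (m0 m l0 l : nat) : window c r e y ->
  0 < r -> n.+1%:R^-1 <= r / 32 -> (m0 < m)%N -> (m < l0)%N -> (l0 < l)%N ->
  (l <= n)%N ->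
  y.1 - r <= grid m0 <= y.1 - r + n.+1%:R^-1 ->
  y.1 + r - n.+1%:R^-1 <= grid m <= y.1 + r ->
  y.2 - r <= grid l0 <= y.2 - r + n.+1%:R^-1 ->
  y.2 + r - n.+1%:R^-1 <= grid l <= y.2 + r ->
  \xor_(m0 <= k < m) \xor_(l0 <= j < l)
    seg_cross (x (grid_vertex k)) (x (grid_vertex k.+1))
      (x (grid_vertex j)) (x (grid_vertex j.+1)).
Proof.
have : 0 < n.+1%:R^-1 :> R by rewrite invr_gt0 ltr0n.
move: (n.+1%:R^-1) => N1 N10 [v [w [D0 win]]] r0 nr m0m ml0 l0l ln.
move=> /andP[m0a m0b] /andP[ma mb] /andP[l0a l0b] /andP[la lb].
have in1 k : (m0 <= k <= m)%N -> `|grid k - y.1| <= r /\ (k <= n)%N.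
  move=> /andP[h1 h2]; split; last by apply: leq_trans h2 _; clear -ml0 l0l ln; lia.
  by have := grid_le h1; have := grid_le h2; rewrite ler_norml; lra.
have in2 k : (l0 <= k <= l)%N -> `|grid k - y.2| <= r /\ (k <= n)%N.
  move=> /andP[h1 h2]; split; last exact: leq_trans h2 _.
  by have := grid_le h1; have := grid_le h2; rewrite ler_norml; lra.
have w1 k : (m0 <= k <= m)%N -> `|coord2 (c y.1) v w (x (grid_vertex k))| <= 16^-1 /\
    `|coord1 (c y.1) v w (x (grid_vertex k)) - (grid k - y.1) / r| <= 16^-1.
  move=> /in1[hr kn]; apply: (win _ _ hr).1; rewrite (addrC y.1) subrK.
  exact: vertex_near.
have w2 k : (l0 <= k <= l)%N -> `|coord1 (c y.1) v w (x (grid_vertex k))| <= 16^-1 /\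
    `|coord2 (c y.1) v w (x (grid_vertex k)) - (grid k - y.2) / r| <= 16^-1.
  move=> /in2[hr kn]; apply: (win _ _ hr).2; rewrite (addrC y.2) subrK.
  exact: vertex_near.
have close (u p q : R) : `|u - p / r| <= 16^-1 -> q * r <= p <= q * r + r / 32 ->
    `|u - q| <= 8^-1.
  move=> hu /andP[p1 p2]; have : q <= p / r by rewrite ler_pdivlMr.
  have : p / r <= q + 32^-1 by rewrite ler_pdivrMr // mulrDl; lra.
  by move: hu; rewrite !ler_norml; lra.
have close' (u p q : R) : `|u - p / r| <= 16^-1 -> q * r - r / 32 <= p <= q * r ->
    `|u - q| <= 8^-1.
  move=> hu /andP[p1 p2]; have : p / r <= q by rewrite ler_pdivrMr.
  have : q - 32^-1 <= p / r by rewrite ler_pdivlMr // mulrBl; lra.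
  by move: hu; rewrite !ler_norml; lra.
have [mm0 mm ll0 ll] : [/\ (m0 <= m0 <= m)%N, (m0 <= m <= m)%N, (l0 <= l0 <= l)%N
  & (l0 <= l <= l)%N] by rewrite !leqnn (ltnW m0m) (ltnW l0l).
apply: (transverse_chains_parity D0 gp) => //.
- move=> i j; rewrite !inE => /in1[_ hi] /in1[_ hj]; exact: vertex_inj.
- move=> i j; rewrite !inE => /in2[_ hi] /in2[_ hj]; exact: vertex_inj.
- move=> i j hi hj; apply/eqP => /vertex_inj.
  move=> /(_ (in1 _ hi).2 (in2 _ hj).2) E; move: hi hj; rewrite E.
  by clear -ml0; lia.
- by move=> k /w1[h _]; move: h; lra.
- by move=> k /w2[h _]; move: h; lra.
- have [_ h] := w1 _ mm0; have := close _ _ (- 1) h; rewrite opprK; apply.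
  by rewrite mulN1r; lra.
- have [_ h] := w1 _ mm; apply: (close' _ _ 1 h).
  by rewrite mul1r; lra.
- have [_ h] := w2 _ ll0; have := close _ _ (- 1) h; rewrite opprK; apply.
  by rewrite mulN1r; lra.
- have [_ h] := w2 _ ll; apply: (close' _ _ 1 h).
  by rewrite mul1r; lra.
Qed.

End WindowParity.

Section Grid.
Variables (R : realType) (n : nat) (a : R).

Lemma gridE (k : nat) : grid n a k.+1 = grid n a k + n.+1%:R^-1.
Proof. by rewrite /grid -natr1 mulrDl mul1r addrA. Qed.

Lemma grid_lt (k l : nat) : grid n a k < grid n a l -> (k < l)%N.
Proof. by move=> h; rewrite ltnNge; apply/negP => /(grid_le n a); lra. Qed.

Lemma grid_end : grid n a n.+1 = a + 1.
Proof. by rewrite /grid divff // pnatr_eq0. Qed.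

(** The step from the last index wraps around to the first; periodicity makes it a step like all
    others. *)
Lemma grid_ordS (Y : Type) (f : R -> Y) (i : 'I_n.+1) :
  (forall p, f (p + 1) = f p) ->
  f (grid n a (ordS i)) = f (grid n a i + n.+1%:R^-1).
Proof.
move=> f1; rewrite -gridE /=; have := ltn_ord i; rewrite leq_eqVlt.
move=> /orP[/eqP E|h]; last by rewrite modn_small.
by rewrite E modnn grid_end f1 /grid mul0r addr0.
Qed.

Definition grid_index (t : R) : nat := Num.truncn ((t - a) * n.+1%:R).

Lemma grid_indexP t : a <= t ->
  grid n a (grid_index t) <= t < grid n a (grid_index t) + n.+1%:R^-1.
Proof.
move=> at_; rewrite -gridE /grid -lerBrDl -ltrBlDl.
rewrite ler_pdivrMr ?ltr0n // ltr_pdivlMr ?ltr0n //.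
by apply: truncn_itv; rewrite mulr_ge0 // subr_ge0.
Qed.

End Grid.

Lemma xor_size (A : Type) (s : seq A) :
  \big[addb/false]_(y <- s) true = odd (size s).
Proof. by elim: s => [|y s IH]; rewrite ?big_nil // big_cons IH. Qed.

Lemma xor_ord (G : nat -> bool) (m0 m n : nat) : (m <= n)%N ->
  \xor_(m0 <= k < m) G k = \xor_(i < n) ((m0 <= i < m)%N && G i).
Proof.
move=> mn; rewrite (big_nat_widenl m0 0) // (big_nat_widen _ _ n) // big_mkord.
by rewrite big_mkcond; apply: eq_bigr => i _; case: (m0 <= i)%N; case: (i < m)%N.
Qed.

(** The first index range ends before the second begins, so the condition [i < j] is automatic. *)
Lemma xor_window (F : nat -> nat -> bool) (m0 m l0 l n : nat) :
  (m <= l0)%N -> (m <= n)%N -> (l <= n)%N ->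
  \xor_(i < n) \xor_(j < n | (i < j)%N)
    ((m0 <= i < m)%N && (l0 <= j < l)%N && F i j) =
  \xor_(m0 <= k < m) \xor_(l0 <= j < l) F k j.
Proof.
move=> ml0 mn ln; rewrite (xor_ord _ _ mn); apply: eq_bigr => i _.
case: (boolP (m0 <= i < m)%N) => [im|_] /=; last by rewrite big1.
rewrite (xor_ord _ _ ln) big_mkcond; apply: eq_bigr => j _.
case: ifP => // ij; case: (boolP (l0 <= j < l)%N) => //= jl.
by move: ij im jl ml0; lia.
Qed.

Lemma int_not_in01 (R : realType) (k : int) : ~ (0 < k%:~R :> R /\ k%:~R < 1 :> R).
Proof.
by rewrite ltr0z -[1]/(1%:~R) ltr_int => -[h1 h2]; move: h1 h2; lia.
Qed.

(** * The crossing parity at a generic end *)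

Section EndCount.
Variables (R : realType) (c : R -> R * R) (V : R -> R -> Prop).
Variables (lam : R -> R -> bool) (a d : R) (s : seq (R * R)).
Hypothesis c_per : forall p, c (p + 1) = c p.
Hypothesis c_unif : forall e : R, 0 < e -> exists2 h : R, 0 < h &
  forall p p', `|p' - p| < h -> `|c p' - c p| < e.
Hypothesis near_zero : forall r : R, 0 < r -> exists2 e : R, 0 < e &
  forall p q, `|c p - c q| < e ->
  exists p' q', [/\ c p' = c q', `|p' - p| < r & `|q' - q| < r].
Hypothesis V_sym : forall p q, V p q -> V q p.
Hypothesis V_per : forall p q, V (p + 1) q = V p q.
Hypothesis V_irr : forall p, ~ V p p.
Hypothesis V_zero : forall p q, V p q -> c p = c q.
Hypothesis d_gt0 : 0 < d.
Hypothesis lam_near : forall p q p' q', V p q -> `|p' - p| < d ->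
  `|q' - q| < d -> lam p' q'.
Hypothesis lam_zero : forall p q p' q', lam p q -> c p' = c q' ->
  `|p' - p| < d -> `|q' - q| < d -> V p' q'.
Hypothesis V_avoid : forall p q (k : int), V p q -> p <> a + k%:~R.
Hypothesis s_uniq : uniq s.
Hypothesis s_mem : forall p q, (p, q) \in s -> [/\ a < p, p < q, q < a + 1 & V p q].
Hypothesis s_all : forall p q, V p q -> a < p -> p < q -> q < a + 1 ->
  (p, q) \in s.
Hypothesis s_slope : forall p q, (p, q) \in s ->
  exists v w, [/\ slope c p v, slope c q w & det2 v w != 0].

Let V_normalize p q : V p q -> exists k l : int,
  (p + k%:~R, q + l%:~R) \in s \/ (q + l%:~R, p + k%:~R) \in s.
Proof.
move=> Vpq; pose k := - Num.floor (p - a); pose l := - Num.floor (q - a).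
have V_perC p' q' : V p' (q' + 1) = V p' q'.
  by apply/propext; split=> /V_sym h; apply: V_sym; rewrite ?V_per // -V_per.
have Vkl : V (p + k%:~R) (q + l%:~R).
  by rewrite (int_periodic (f := V^~ _)) // (int_periodic (f := V _)).
exists k, l.
have range p' q' : V p' q' -> a < p' + (- Num.floor (p' - a))%:~R < a + 1.
  move=> V'; have := floor_le (p' - a); have := floorD1_gt (p' - a).
  rewrite intrD1 mulrNz; have := @V_avoid p' q' (Num.floor (p' - a)) V'.
  move=> ne h1 h2; apply/andP; split; last lra.
  by rewrite lt_neqAle; apply/andP; split; [apply/eqP => E; apply: ne; lra | lra].
have /andP[p1 p2] := range _ _ Vpq; have /andP[q1 q2] := range _ _ (V_sym Vpq).
rewrite -/k in p1 p2; rewrite -/l in q1 q2.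
case: (ltgtP (p + k%:~R) (q + l%:~R)) => h.
- by left; apply: s_all.
- by right; apply: s_all => //; apply: V_sym.
- by move: Vkl; rewrite h => /V_irr.
Qed.

(** A common radius for which windows exist, the two parameter intervals of each window are disjoint
    and stay inside the interval from [a] to [a + 1], and different windows share no pair of
    parameters. *)
Let radius : exists2 r, 0 < r & [/\ r <= d / 2,
  (forall y, y \in s -> [/\ a + 2 * r < y.1, y.1 + 4 * r < y.2, y.2 + 2 * r < a + 1 &
     exists2 e, 0 < e & window c r e y]) &
  forall y y', y \in s -> y' \in s -> y != y' ->
     4 * r <= `|y.1 - y'.1| \/ 4 * r <= `|y.2 - y'.2|].
Proof.
pose Q1 r y := [/\ a + 2 * r < y.1, y.1 + 4 * r < y.2, y.2 + 2 * r < a + 1 &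
  forall r', 0 < r' -> r' <= r -> exists2 e, 0 < e & window c r' e y].
have [r1 r10 hr1] : exists2 r, 0 < r & forall y, y \in s -> Q1 r y.
  apply: seq_uniform.
    move=> e e' y e'0 e'e [h1 h2 h3 h4]; split; try lra.
    by move=> r' r'0 r'e'; apply: h4 => //; lra.
  move=> [p q] ys; have [ap pq qa Vpq] := s_mem ys.
  have [v [w [sv sw vw]]] := s_slope ys.
  have [r0 r00 hr0] := window_exists (V_zero Vpq : c (p, q).1 = c (p, q).2) sv sw vw.
  pose r := Num.min r0 (Num.min ((p - a) / 4) (Num.min ((q - p) / 8) ((a + 1 - q) / 4))).
  exists r; first by rewrite !lt_min r00 /=; apply/and3P; split; lra.
  have : r <= r by []. rewrite {2}/r !le_min => /and4P[h1 h2 h3 h4].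
  split=> /=; try lra.
  by move=> r' r'0 r'r; apply: hr0 => //; lra.
pose Q2 r (y : R * R) := forall y', y' \in s -> y != y' ->
     4 * r <= `|y.1 - y'.1| \/ 4 * r <= `|y.2 - y'.2|.
have [r2 r20 hr2] : exists2 r, 0 < r & forall y, y \in s -> Q2 r y.
  apply: seq_uniform.
    by move=> e e' y e'0 e'e h y' y's yy'; have [h'|h'] := h y' y's yy'; [left|right]; lra.
  move=> y _; apply: seq_uniform.
    by move=> e e' y' e'0 e'e h yy'; have [h'|h'] := h yy'; [left|right]; lra.
  move=> y' _; have [->|yy'] := eqVneq y y'; first by exists 1.
  pose m := `|y.1 - y'.1| + `|y.2 - y'.2|.
  have m0 : 0 < m.
    rewrite lt_neqAle addr_ge0 // andbT eq_sym; apply: contraNneq yy' => /eqP.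
    rewrite paddr_eq0 // !normr_eq0 !subr_eq0.
    by case: (y) (y') => [y1 y2] [y'1 y'2].
  exists (m / 8); first by rewrite divr_gt0.
  move=> _; have [h|h] := leP (m / 2) `|y.1 - y'.1|; [left|right]; rewrite /m in h *; lra.
pose r := Num.min (d / 2) (Num.min r1 r2).
exists r; first by rewrite !lt_min r10 r20 andbT divr_gt0.
have : r <= r by []. rewrite {2}/r !le_min => /and3P[h1 h2 h3].
have r0 : 0 < r by rewrite !lt_min r10 r20 andbT divr_gt0.
split=> //.
- move=> y /hr1[k1 k2 k3 k4]; split; try lra.
  exact: k4.
- move=> y y' ys y's yy'; have [h|h] := hr2 _ ys _ y's yy'; [left|right]; lra.
Qed.

(** A labelled pair of crossing edges lies in exactly one window, and every pair in a window is
    labelled. Hence the count is a sum over windows, each contributing an odd number. *)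
Lemma end_parity : exists2 e : R, 0 < e & exists2 h : R, 0 < h &
  forall (n : nat) (T : eqType) (x : T -> R * R) (z : 'I_n.+1 -> T),
  general_position x -> injective z -> n.+1%:R^-1 <= h ->
  (forall i, `|x (z i) - c (grid n a i)| <= e) ->
  crossing_parity x z (fun i j => lam (grid n a i) (grid n a j)) =
  odd (size s).
Proof.
have [r r0 [rd hs sep]] := radius.
have [ew ew0 hew] : exists2 e, 0 < e & forall y, y \in s -> window c r e y.
  apply: seq_uniform.
    move=> e e' y e'0 e'e [v [w [D win]]]; exists v, w; split=> // z h hr.
    by split=> hz; apply win => //; exact: le_trans e'e.
  by move=> y /hs[].
have r2 : 0 < r / 2 by rewrite divr_gt0.
have [e2 e20 he2] := near_zero r2.
(* With this unit, edges have length at most 3 units, so starting points of crossing edges are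
   within 6 and the corresponding points of the curve within 8 units, which is below [e2]. *)
have e16 : 0 < e2 / 16 by rewrite divr_gt0.
have [h3 h30 hh3] := c_unif e16.
pose e1 := Num.min ew (e2 / 16).
have e10 : 0 < e1 by rewrite lt_min ew0.
exists e1 => //; exists (Num.min (r / 32) (h3 / 2)).
  by rewrite lt_min !divr_gt0.
move=> n T x z gp zinj; rewrite le_min => /andP[Nr Nh3] xz.
have [e1w e1e2] : e1 <= ew /\ e1 <= e2 / 16.
  by rewrite /e1 !ge_min !lexx orbT.
have N0 : 0 < n.+1%:R^-1 :> R by rewrite invr_gt0 ltr0n.
have gridS i := gridE n a i.
have cS (i : 'I_n.+1) : c (grid n a (ordS i)) = c (grid n a i + n.+1%:R^-1) by rewrite (@grid_ordS R n a _ c).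
have grid_a i : a <= grid n a i by rewrite /grid lerDl divr_ge0.
have grid_a1 (i : 'I_n.+1) : grid n a i < a + 1.
  by rewrite -(grid_end n a) /grid ltrD2l ltr_pM2r // ltr_nat ltn_ord.
have index := @grid_indexP R n a.
have win_parity (y : R * R) (m0 m l0 l : nat) win :=
  @window_parity R c T x gp n z a e1 zinj xz r y m0 m l0 l win r0 Nr.
move: N0 Nr Nh3 gridS cS index win_parity; move: (n.+1%:R^-1).
move=> N1 N0 Nr Nh3 gridS cS index win_parity.
(* [grid_index] rounds down; the successor makes the lower ends round up, so that the chains stay
   inside the window. *)
pose m0 (y : R * R) := (grid_index n a (y.1 - r)).+1.
pose m (y : R * R) := grid_index n a (y.1 + r).
pose l0 (y : R * R) := (grid_index n a (y.2 - r)).+1.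
pose l (y : R * R) := grid_index n a (y.2 + r).
have bounds y : y \in s ->
    [/\ y.1 - r <= grid n a (m0 y) <= y.1 - r + N1,
        y.1 + r - N1 <= grid n a (m y) <= y.1 + r,
        y.2 - r <= grid n a (l0 y) <= y.2 - r + N1 &
        y.2 + r - N1 <= grid n a (l y) <= y.2 + r].
  move=> ys; have [h1 h2 h3' _] := hs _ ys.
  have := index (y.1 - r) ltac:(lra); have := index (y.1 + r) ltac:(lra).
  have := index (y.2 - r) ltac:(lra); have := index (y.2 + r) ltac:(lra).
  by rewrite /m0 /m /l0 /l !gridS; split; lra.
pose inW (y : R * R) (i j : nat) :=
  (m0 y <= i < m y)%N && (l0 y <= j < l y)%N.
have inWP y i j : y \in s -> inW y i j ->
    `|grid n a i - y.1| <= r /\ `|grid n a j - y.2| <= r.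
  move=> ys /andP[/andP[i1 i2] /andP[j1 j2]].
  have [/andP[b1 b2] /andP[b3 b4] /andP[b5 b6] /andP[b7 b8]] := bounds _ ys.
  have := grid_le n a i1; have := grid_le n a (ltnW i2).
  have := grid_le n a j1; have := grid_le n a (ltnW j2).
  by rewrite !ler_norml; split; lra.
have order y : y \in s -> [/\ (m0 y < m y)%N, (m y < l0 y)%N, (l0 y < l y)%N & (l y <= n)%N].
  move=> ys; have [h1 h2 h3' _] := hs _ ys; have [b1 b2 b3 b4] := bounds _ ys.
  split; [| | |rewrite -ltnS]; apply: (@grid_lt R n a); rewrite ?grid_end; lra.
pose X := edge_cross x z.
have XW (i j : 'I_n.+1) : X i j -> `|c (grid n a i) - c (grid n a j)| < e2.
  move=> /seg_cross_dist h.
  have edge (k : 'I_n.+1) : `|x (z (ordS k)) - x (z k)| <= 3 * (e2 / 16).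
    have := ler_distD (c (grid n a (ordS k))) (x (z (ordS k))) (x (z k)).
    have := ler_distD (c (grid n a k)) (c (grid n a (ordS k))) (x (z k)).
    rewrite (distrC (c (grid n a k))); have := xz k; have := xz (ordS k).
    have : `|c (grid n a (ordS k)) - c (grid n a k)| < e2 / 16.
      by rewrite cS; apply: hh3; rewrite addrAC subrr add0r gtr0_norm //; lra.
    lra.
  have := ler_distD (x (z i)) (c (grid n a i)) (c (grid n a j)).
  have := ler_distD (x (z j)) (x (z i)) (c (grid n a j)).
  have := edge i; have := edge j; have := xz i; have := xz j.
  by rewrite (distrC (c (grid n a i)) (x _)); lra.
(* Virtual parameters, normalized or not, avoid the ends of the grid; so a virtual pair found near
   two grid points lies between [a] and [a + 1] and no wrapping occurs. *)
have V_far p q : V p q -> r < `|p - a| /\ r < `|p - (a + 1)|.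
  move=> /V_normalize[k [l' h]].
  have {h} [k1 k2] : a + 2 * r < p + k%:~R /\ p + k%:~R + 2 * r < a + 1.
    by case: h => /hs[/= ? ? ? _]; split; lra.
  split; rewrite ltNge; apply/negP; rewrite ler_norml => hp.
  - by apply: (@int_not_in01 R k); split; lra.
  - by apply: (@int_not_in01 R (k + 1)); rewrite intrD; split; lra.
(* Nearly coinciding curve points give a double point within [r / 2], virtual because of the label;
   the other half of [r] absorbs the mesh at the window ends. *)
have exW (i j : 'I_n.+1) : (i < j)%N -> X i j ->
    lam (grid n a i) (grid n a j) -> exists2 y, y \in s & inW y i j.
  move=> ij Xij lij; have [p [q [cpq pi qj]]] := he2 _ _ (XW _ _ Xij).
  have Vpq : V p q by apply: (lam_zero lij cpq); lra.
  have [pa pa1] := V_far _ _ Vpq; have [qa qa1] := V_far _ _ (V_sym Vpq).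
  have gi := grid_a i; have gj := grid_a j; have gi1 := grid_a1 i.
  have gj1 := grid_a1 j; have gij := grid_le n a (ltnW ij).
  move: pi qj pa pa1 qa qa1; rewrite !ltr_norml !lter_normr.
  move=> /andP[pi1 pi2] /andP[qj1 qj2] /orP pa /orP pa1 /orP qa /orP qa1.
  have [p1 p2] : a < p /\ p < a + 1 by split; [case: pa|case: pa1]; lra.
  have [q1 q2] : a < q /\ q < a + 1 by split; [case: qa|case: qa1]; lra.
  have pq : p < q.
    case: (ltgtP p q) => // h.
      have /hs[/= _ + _ _] := s_all (V_sym Vpq) q1 h p2; lra.
    by move: Vpq; rewrite h => /V_irr.
  have ys := s_all Vpq p1 pq q2; exists (p, q) => //.
  have [/= b1 b2 b3 b4] := bounds _ ys.
  move/andP: b1 => [_ b1]; move/andP: b2 => [b2 _].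
  move/andP: b3 => [_ b3]; move/andP: b4 => [b4 _].
  clear -Nr N0 r0 pi1 pi2 qj1 qj2 b1 b2 b3 b4.
  by rewrite /inW; apply/andP; split; (apply/andP; split; [apply: ltnW |]);
    apply: (@grid_lt R n a); lra.
have pointwise (i j : 'I_n.+1) : (i < j)%N ->
    lam (grid n a i) (grid n a j) && X i j =
    \big[addb/false]_(y <- s) (inW y i j && X i j).
  move=> ij; case Xij: (X i j); last first.
    by rewrite andbF big1 // => y _; rewrite andbF.
  rewrite andbT; case lij: (lam _ _); last first.
    rewrite big1_seq // => y /andP[_ ys]; apply/negbTE; rewrite andbT.
    apply: contraFN lij => /(inWP _ _ _ ys)[h1 h2].
    have [|_ _ _ Vy] := @s_mem y.1 y.2; first by rewrite -surjective_pairing.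
    by apply: (lam_near Vy); lra.
  have [y ys yW] := exW _ _ ij Xij lij.
  rewrite (bigD1_seq y) //= yW big1_seq // => y' /andP[y'y y's].
  apply/negbTE; rewrite andbT; apply/negP => /(inWP _ _ _ y's)[].
  have [] := inWP _ _ _ ys yW; have := sep _ _ y's ys y'y.
  rewrite !ler_norml !ler_normr => -[/orP[]|/orP[]]; lra.
rewrite /crossing_parity /upper_sum -(xor_size s).
transitivity (\xor_(i < n.+1) \xor_(j < n.+1 | (i < j)%N)
    \big[addb/false]_(y <- s) (inW y i j && X i j)).
  by apply: eq_bigr => i _; apply: eq_bigr => j; exact: pointwise.
transitivity (\big[addb/false]_(y <- s) \xor_(i < n.+1)
    \xor_(j < n.+1 | (i < j)%N) (inW y i j && X i j)).
  rewrite [RHS]exchange_big /=; apply: eq_bigr => i _.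
  by rewrite [RHS]exchange_big.
apply: eq_big_seq => y ys.
have [w1 w2 w3 w4] := order _ ys.
have [b1 b2 b3 b4] := bounds _ ys.
have win : window c r e1 y.
  have [v [w [D win]]] := hew _ ys; exists v, w; split=> // z' h hr.
  by split=> hz; apply win => //; apply: le_trans e1w.
apply: etrans (win_parity _ _ _ _ _ win w1 w2 w3 w4 b1 b2 b3 b4).
have ml0 := ltnW w2; have ln := leqW w4; have mn := leq_trans (leq_trans ml0 (ltnW w3)) ln.
rewrite -(xor_window _ _ ml0 mn ln).
apply: eq_bigr => i _; apply: eq_bigr => j _; rewrite /inW.
case H : ((m0 y <= i < m y)%N && (l0 y <= j < l y)%N) => //=.
move/andP: H => [/andP[_ im] /andP[_ jl]].
have in_lt (k p : nat) : (k < p)%N -> (p <= n)%N -> (k.+1 < n.+1)%N.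
  by move=> kp pn; rewrite ltnS; apply: leq_trans pn.
have ordSE (k : 'I_n.+1) : (k.+1 < n.+1)%N -> inord k.+1 = ordS k.
  by move=> kn; apply: val_inj; rewrite /= inordK // modn_small.
rewrite /grid_vertex !inord_val !ordSE //.
  exact: in_lt jl w4.
by apply: (in_lt _ _ im); apply: leq_trans ml0 (leq_trans (ltnW w3) w4).
Qed.

End EndCount.

(** * Invariance of the parity *)

Lemma small_inverse (R : realType) (e : R) : 0 < e ->
  exists n : nat, n.+1%:R^-1 <= e :> R.
Proof.
move=> e0; exists (Num.truncn e^-1); rewrite -[leRHS]invrK lef_pV2 ?posrE ?invr_gt0 //.
by rewrite ltW // truncnS_gt.
Qed.

Section Invariance.
Variable R : realType.
Variables (b : R -> R -> R * R) (V : R -> R -> R -> Prop).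
Hypothesis b_cont : continuous (fun z : R * R => b z.1 z.2).
Hypothesis b_per : forall p t, b (p + 1) t = b p t.
Hypothesis V_sym : forall p q t, V p q t -> V q p t.
Hypothesis V_per : forall p q t, V (p + 1) q t = V p q t.
Hypothesis V_irr : forall p t, ~ V p p t.
Hypothesis V_zero : forall p q t, V p q t -> b p t = b q t.
Hypothesis V_loc : forall p q t, b p t = b q t ->
  \forall y \near (p, q, t), b y.1.1 y.2 = b y.1.2 y.2 ->
    (V y.1.1 y.1.2 y.2 <-> V p q t).
Variables (a : R) (s : R -> seq (R * R)).
Hypothesis V_avoid : forall t p q (k : int), t = 0 \/ t = 1 ->
  V p q t -> p <> a + k%:~R.
Hypothesis s_uniq : forall t, uniq (s t).
Hypothesis s_mem : forall t p q, t = 0 \/ t = 1 -> (p, q) \in s t ->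
  [/\ a < p, p < q, q < a + 1 & V p q t].
Hypothesis s_all : forall t p q, t = 0 \/ t = 1 -> V p q t ->
  a < p -> p < q -> q < a + 1 -> (p, q) \in s t.
Hypothesis s_slope : forall t p q, t = 0 \/ t = 1 -> (p, q) \in s t ->
  exists v w, [/\ slope (b^~ t) p v, slope (b^~ t) q w & det2 v w != 0].

Lemma virtual_parity_invariant : odd (size (s 0)) = odd (size (s 1)).
Proof.
have [d3 d30 sep] := virtual_separated b_cont b_per V_sym V_per V_loc.
(* A label at [y] comes from a virtual triple within [d]; it is compared with zeros of [gap] within
   [2 * d] of [y], all inside the separation radius. *)
pose d := d3 / 3; have d0 : 0 < d by rewrite divr_gt0.
have dE : d3 = 3 * d by rewrite /d; field.
have [e0 e00 he0] := gap_near_zero b_cont b_per d0.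
pose lam t p q := `[< exists z : R * R * R, V z.1.1 z.1.2 z.2 /\ `|z - (p, q, t)| < d >].
have norm3 (p q t p' q' t' : R) (e : R) :
    (`|(p, q, t) - (p', q', t')| < e) = [&& `|p - p'| < e, `|q - q'| < e & `|t - t'| < e].
  by rewrite !prod_normE /= !gt_max andbA.
have lamW (y z' : R * R * R) : 0 <= y.2 <= 1 -> lam y.2 y.1.1 y.1.2 ->
    gap b z' = 0 -> `|z' - y| < 2 * d -> V z'.1.1 z'.1.2 z'.2.
  case: y => -[p q] t /= ht /asboolP[z [Vz zy]] gz' z'y.
  have zd : `|z - (p, q, t)| < d3 by rewrite dE; lra.
  have zd' : `|z' - (p, q, t)| < d3 by rewrite dE; lra.
  apply: (sep (p, q, t) z z') => //.
  by rewrite /gap (V_zero Vz) subrr.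
(* Where [gap] is small there is a true double point within [d]; by separation it inherits
   virtuality and carries the label over to [y']. *)
have lam_const_imp (y y' : R * R * R) : 0 <= y.2 <= 1 -> 0 <= y'.2 <= 1 ->
    `|gap b y'| < e0 -> `|y' - y| < d ->
    lam y.2 y.1.1 y.1.2 -> lam y'.2 y'.1.1 y'.1.2.
  move=> hy hy' gy' yy' ly; have [z gz zy'] := he0 _ hy' gy'.
  apply/asboolP; exists z; split; last by case: (y') zy' => -[].
  by apply: (lamW y) => //; have := ler_distD y' z y; lra.
have lam_const (y y' : R * R * R) : 0 <= y.2 <= 1 -> 0 <= y'.2 <= 1 ->
    `|gap b y| < e0 -> `|gap b y'| < e0 -> `|y' - y| < d ->
    lam y.2 y.1.1 y.1.2 = lam y'.2 y'.1.1 y'.1.2.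
  move=> hy hy' gy gy' yy'; apply/idP/idP; apply: lam_const_imp => //.
  by rewrite distrC.
have lam_sym t p q : lam t p q = lam t q p.
  have imp p' q' : lam t p' q' -> lam t q' p'.
    move=> /asboolP[[[p1 q1] t1] [/= /V_sym Vz]]; rewrite norm3 => /and3P[h1 h2 h3].
    by apply/asboolP; exists (q1, p1, t1); rewrite norm3 h1 h2 h3.
  by apply/idP/idP; exact: imp.
have lam_per t p q : lam t p (q + 1) = lam t p q.
  have V_per2 p' q' t' : V p' (q' + 1) t' = V p' q' t'.
    by apply/propext; split=> /V_sym h; apply: V_sym; rewrite ?V_per // -V_per.
  apply/asboolP/asboolP => -[[[p1 q1] t1] [/= Vz]]; rewrite norm3 => /and3P[h1 h2 h3].
    exists (p1, q1 - 1, t1); rewrite /= -V_per2 subrK norm3 h1 h3 andbT; split=> //=.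
    by rewrite addrAC -addrA -opprD.
  exists (p1, q1 + 1, t1); rewrite /= V_per2 norm3 h1 h3 andbT; split=> //=.
  by rewrite opprD addrACA subrr addr0.
(* A label this close to the diagonal would make the diagonal triple virtual. In particular,
   adjacent edges are never counted. *)
have lam_diag t p q : 0 <= t <= 1 -> `|q - p| < d -> lam t p q = false.
  move=> ht pq; apply/negP => lpq.
  apply: (@V_irr p t); apply: (lamW (p, q, t) (p, p, t)) => //=.
    by rewrite /gap subrr.
  by rewrite norm3 !subrr normr0 -normrN opprB; apply/and3P; split; lra.
have ends t : t = 0 \/ t = 1 -> exists2 e : R, 0 < e & exists2 h : R, 0 < h &
  forall (n : nat) (T : eqType) (x : T -> R * R) (z : 'I_n.+1 -> T),
  general_position x -> injective z -> n.+1%:R^-1 <= h ->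
  (forall i, `|x (z i) - b (grid n a i) t| <= e) ->
  crossing_parity x z (fun i j => lam t (grid n a i) (grid n a j)) =
  odd (size (s t)).
  move=> ht; have t01 : 0 <= t <= 1 by case: ht => ->; rewrite ?lexx ?ler01.
  apply: (@end_parity R (b^~ t) (fun p q => V p q t) (lam t) a d (s t)) => //.
  - move=> e h0; have [h h00 hh] := b_uniform b_cont b_per h0.
    by exists h => // p p' pp'; apply: hh => //; rewrite subrr normr0.
  - move=> r r0.
    have bt_cont : continuous (fun z : R * R => b z.1 t).
      apply: (@continuous_compose _ _ _ (fun z : R * R => (z.1, t)) _ _ b_cont).
      apply: continuous_pairing; last by move=> ?; exact: cvg_cst.
      by apply: continuous_fst => ?; exact: cvg_id.
    (* Freezing the family at level [t] forces the double point to lie on the end curve itself. *)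
    have [e he hz] := @gap_near_zero R (fun p _ => b p t) bt_cont (fun p _ => b_per p t) r r0.
    exists e => // p q pq; have [|[[p' q'] t'] gz] := hz (p, q, 0) _ pq.
      by rewrite lexx ler01.
    rewrite norm3 => /and3P[h1 h2 _]; exists p', q'; split=> //.
    by apply/eqP; rewrite -subr_eq0; apply/eqP.
  - by move=> p q; exact: V_sym.
  - by move=> p q; exact: V_zero.
  - by move=> p q p' q' Vpq h1 h2; apply/asboolP; exists (p, q, t);
      rewrite norm3 subrr normr0 -normrN opprB h1 -normrN opprB h2.
  - move=> p q p' q' lpq cE h1 h2; apply: (lamW (p, q, t) (p', q', t)) => //=.
      by rewrite /gap cE subrr.
    by rewrite norm3 subrr normr0; apply/and3P; split; lra.
  - by move=> p q k; exact: V_avoid.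
  - by move=> p q; exact: s_mem.
  - by move=> p q; exact: s_all.
  - by move=> p q; exact: s_slope.
have [eA eA0 [hA hA0 endA]] := ends 0 (or_introl erefl).
have [eB eB0 [hB hB0 endB]] := ends 1 (or_intror erefl).
have e160 : 0 < e0 / 16 by rewrite divr_gt0.
(* The largest gap at which labels are compared below is [7 * e] plus one edge, that is, less than
   [8 * e]. *)
pose e := Num.min (e0 / 16) (Num.min eA eB).
have e_gt0 : 0 < e by rewrite !lt_min eA0 eB0 !andbT.
have [ee0 eeA eeB] : [/\ e <= e0 / 16, e <= eA & e <= eB].
  by rewrite /e !ge_min !lexx !orbT.
have e2 : 0 < e / 2 by rewrite divr_gt0.
have [h h0 hb] := b_uniform b_cont b_per e2.
pose h' := Num.min (Num.min hA hB) (Num.min (Num.min (h / 2) (d / 2)) (1 / 2)).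
have [|n nh'] := @small_inverse R h'.
  by rewrite !lt_min hA0 hB0 !divr_gt0.
move: nh'; rewrite !le_min -!andbA => /and5P[nA nB nh nd n2].
have nh2 : n.+1%:R^-1 < h by apply: le_lt_trans nh _; lra.
have nd2 : n.+1%:R^-1 < d by apply: le_lt_trans nd _; lra.
have n_gt1 : (1 < n.+1)%N.
  rewrite ltnS lt0n; apply: contraTN n2 => /eqP ->; rewrite invr1; lra.
have N0 : 0 < n.+1%:R^-1 :> R by rewrite invr_gt0 ltr0n.
pose tm (k : nat) : R := k%:R / n.+1%:R.
have tm01 k : (k <= n.+1)%N -> 0 <= tm k <= 1.
  by move=> kn; rewrite /tm divr_ge0 //= ler_pdivrMr ?ltr0n // mul1r ler_nat.
have tmS k : tm k.+1 = tm k + n.+1%:R^-1 by rewrite /tm -natr1 mulrDl mul1r.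
pose B (k : nat) (i : 'I_n.+1) := b (grid n a i) (tm k).
(* The vertices of the polygons at all levels are perturbed together, so general position also holds
   between consecutive polygons. *)
have [x [gp hx]] := general_position_near
  (fun y : 'I_n.+2 * 'I_n.+1 => B y.1 y.2) e2.
pose z (k : nat) (i : 'I_n.+1) : 'I_n.+2 * 'I_n.+1 := (inord k, i).
have zinj k : injective (z k) by move=> i j [].
have xz k i : (k <= n.+1)%N -> `|x (z k i) - B k i| <= e / 2.
  move=> kn; have := hx (z k i); rewrite /= inordK // => -[h1 h2].
  by rewrite prod_normE ge_max !ltW.
pose L k i j := lam (tm k) (grid n a i) (grid n a j).
have lamS t p (j : 'I_n.+1) : lam t p (grid n a (ordS j)) = lam t p (grid n a j + n.+1%:R^-1).
  by rewrite (@grid_ordS R n a _ (lam t p)).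
have BS k j : B k (ordS j) = b (grid n a j + n.+1%:R^-1) (tm k).
  by rewrite /B (@grid_ordS R n a _ (b^~ (tm k))).
have tm_last : tm n.+1 = 1 by rewrite /tm divff // pnatr_eq0.
have tm_first : tm 0 = 0 by rewrite /tm mul0r.
have BSd k j : (k <= n.+1)%N -> `|B k (ordS j) - B k j| <= e / 2.
  move=> kn; rewrite BS; apply/ltW/hb; rewrite ?tm01 //.
    by rewrite addrAC subrr add0r gtr0_norm.
  by rewrite subrr normr0.
have BT k j : (k < n.+1)%N -> `|B k.+1 j - B k j| <= e / 2.
  move=> kn; apply/ltW/hb; rewrite ?tm01 ?(ltnW kn) //.
    by rewrite subrr normr0.
  by rewrite tmS addrAC subrr add0r gtr0_norm.
have step k : (k < n.+1)%N -> crossing_parity x (z k.+1) (L k.+1) = crossing_parity x (z k) (L k).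
  move=> kn; have kn' := ltnW kn.
  have tk := tm01 _ kn'; have tSk := tm01 _ kn.
  (* The labels change while the polygon is fixed, and only on crossing edges do they matter; there
     [gap] is small at both levels. *)
  transitivity (crossing_parity x (z k.+1) (L k)).
    apply: eq_crossing_parity => // i j /seg_cross_dist Xij.
    have edge (l : 'I_n.+1) :
        `|x (z k.+1 (ordS l)) - x (z k.+1 l)| <= 3 * (e / 2).
      have := ler_distD (B k.+1 (ordS l)) (x (z k.+1 (ordS l))) (x (z k.+1 l)).
      have := ler_distD (B k.+1 l) (B k.+1 (ordS l)) (x (z k.+1 l)).
      rewrite (distrC (B k.+1 l) (x _)); have := xz _ l kn; have := xz _ (ordS l) kn.
      by have := BSd _ l kn; lra.
    have gS : `|B k.+1 i - B k.+1 j| <= 4 * e.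
      have := ler_distD (x (z k.+1 i)) (B k.+1 i) (B k.+1 j).
      have := ler_distD (x (z k.+1 j)) (x (z k.+1 i)) (B k.+1 j).
      rewrite (distrC (B k.+1 i) (x _)); have := xz _ i kn; have := xz _ j kn.
      by have := edge i; have := edge j; lra.
    have gk : `|B k i - B k j| <= 5 * e.
      have := ler_distD (B k.+1 i) (B k i) (B k j).
      have := ler_distD (B k.+1 j) (B k.+1 i) (B k j).
      by rewrite (distrC (B k i) (B k.+1 i)); have := BT _ i kn; have := BT _ j kn; lra.
    rewrite /L; apply: (lam_const (grid n a i, grid n a j, tm k.+1)
      (grid n a i, grid n a j, tm k)) => //.
    - by rewrite /gap /= -/(B k.+1 i) -/(B k.+1 j); lra.
    - by rewrite /gap /= -/(B k i) -/(B k j); lra.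
    - rewrite norm3 !subrr normr0 d0 /= distrC tmS [tm k + _]addrC addrK.
      by rewrite gtr0_norm.
  apply: (crossing_parity_polygon_move (B := B k) (e := e) gp n_gt1) => //.
  - move=> i j; apply/eqP => -[/(congr1 (@nat_of_ord _))].
    by rewrite !inordK ?(ltnW kn') // => /eqP; rewrite eqn_leq ltnn andbF.
  - by move=> i j; rewrite /L lam_sym.
  - by move=> j; rewrite /L lam_diag // subrr normr0.
  - move=> j; rewrite /L lamS lam_diag // [grid n a j + _]addrC addrK.
    by rewrite gtr0_norm.
  - by move=> i; have := xz _ i kn'; lra.
  - move=> i; have := ler_distD (B k.+1 i) (x (z k.+1 i)) (B k i).
    by have := xz _ i kn; have := BT _ i kn; lra.
  - by move=> i; have := BSd _ i kn'; lra.
  move=> i j hij; have Sj : ordS (ord_pred j) = j by rewrite ord_predK.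
  rewrite /L -{1}Sj lamS.
  apply: (lam_const (grid n a i, grid n a (ord_pred j) + n.+1%:R^-1, tm k)
      (grid n a i, grid n a (ord_pred j), tm k)) => //.
  - have gj : `|B k i - B k j| < e0 by lra.
    by rewrite -{1}Sj BS in gj; exact: gj.
  - rewrite /gap /= -/(B k i) -/(B k (ord_pred j)).
    have := ler_distD (B k j) (B k i) (B k (ord_pred j)).
    by have := BSd _ (ord_pred j) kn'; rewrite Sj; lra.
  - rewrite norm3 !subrr normr0 d0 andbT /= distrC addrAC subrr add0r.
    by rewrite gtr0_norm.
suff all k : (k <= n.+1)%N -> crossing_parity x (z k) (L k) = crossing_parity x (z 0%N) (L 0%N).
  have E0 : crossing_parity x (z 0%N) (L 0%N) = odd (size (s 0)).
    rewrite -(endA n _ x (z 0%N) gp (zinj 0%N) nA).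
      by rewrite /L tm_first.
    by move=> i; have := @xz 0%N i isT; rewrite /B tm_first; lra.
  have E1 : crossing_parity x (z n.+1) (L n.+1) = odd (size (s 1)).
    rewrite -(endB n _ x (z n.+1) gp (zinj n.+1) nB).
      by rewrite /L tm_last.
    by move=> i; have := @xz n.+1 i (leqnn _); rewrite /B tm_last; lra.
  by rewrite -E0 -E1 all.
elim: k => // k IH kn; rewrite step // IH //; exact: ltnW.
Qed.

End Invariance.

(** * Winding numbers *)

Section Angles.
Variable R : realType.
Implicit Types v w : R * R.

Definition dot v w : R := v.1 * w.1 + v.2 * w.2.

Definition is_angle v (t : R) : Prop :=
  exists2 r, 0 < r & v = (r * cos t, r * sin t).

Lemma dot_gt0 v : v != 0 -> 0 < dot v v.
Proof.
case: v => [x y]; rewrite /dot /= -!expr2 => xy0.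
rewrite lt_neqAle addr_ge0 ?sqr_ge0 // andbT eq_sym paddr_eq0 ?sqr_ge0 //.
by rewrite !sqrf_eq0; apply: contra xy0 => /andP[/eqP -> /eqP ->].
Qed.

(** The signed angle from [v] to [w] when it is acute; it has this meaning only for positive
    [dot v w]. *)
Definition turn v w : R := atan (det2 v w / dot v w).

Lemma is_angle_turn v w t : is_angle v t -> 0 < dot v w ->
  is_angle w (t + turn v w).
Proof.
move=> [r r0 ->]; set d := dot _ _ => d0; rewrite /turn -/d.
set q := det2 _ _ / d; have cq : cos (atan q) != 0.
  by rewrite cos_atan invr_neq0 // gt_eqF // sqrtr_gt0 ltr_wpDr ?sqr_ge0.
have cq0 : 0 < cos (atan q).
  by rewrite cos_atan invr_gt0 sqrtr_gt0 ltr_wpDr ?sqr_ge0.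
have rn0 : r != 0 by rewrite gt_eqF.
have sq : sin (atan q) = q * cos (atan q) by rewrite -{2}(atanK q) /tan divfK.
exists (d / r / cos (atan q)); first by rewrite !divr_gt0.
rewrite cosD sinD sq.
have dn0 : d != 0 by rewrite gt_eqF.
have cs := cos2Dsin2 t.
have -> : d / r / cos (atan q) * (cos t * cos (atan q) - sin t * (q * cos (atan q)))
    = d / r * cos t - d * q / r * sin t by field; rewrite cq rn0.
have -> : d / r / cos (atan q) * (sin t * cos (atan q) + cos t * (q * cos (atan q)))
    = d / r * sin t + d * q / r * cos t by field; rewrite cq rn0.
have -> : d * q = det2 (r * cos t, r * sin t) w by rewrite /q; field.
rewrite /d /dot /det2 /=; clear -rn0 cs.
rewrite [LHS]surjective_pairing; congr (_, _).
- rewrite -[LHS]mulr1 -cs; field; exact: rn0.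
- rewrite -[LHS]mulr1 -cs; field; exact: rn0.
Qed.

Lemma is_angle_exists v : v != 0 -> exists t, is_angle v t.
Proof.
case: v => x y xy0.
have key t : 0 < dot (cos t, sin t) (x, y) -> exists t, is_angle (x, y) t.
  move=> h; exists (t + turn (cos t, sin t) (x, y)); apply: is_angle_turn h.
  by exists 1; rewrite ?mul1r.
have [x0|x0|x0] := ltgtP x 0.
- by apply: (key pi); rewrite /dot /= cospi sinpi; lra.
- by apply: (key 0); rewrite /dot /= cos0 sin0; lra.
have [y0|y0|y0] := ltgtP y 0.
- by apply: (key (- (pi / 2))); rewrite /dot /= cosN sinN cos_pihalf sin_pihalf; lra.
- by apply: (key (pi / 2)); rewrite /dot /= cos_pihalf sin_pihalf; lra.
by rewrite x0 y0 eqxx in xy0.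
Qed.

Lemma is_angle_unique v t t' : is_angle v t -> is_angle v t' ->
  cos t = cos t' /\ sin t = sin t'.
Proof.
move=> [r r0 ->] [r' r'0 [E1 E2]].
have rr' : r = r'.
  have : r ^+ 2 = r' ^+ 2.
    have -> : r ^+ 2 = (r * cos t) ^+ 2 + (r * sin t) ^+ 2.
      by rewrite !exprMn -mulrDr cos2Dsin2 mulr1.
    by rewrite E1 E2 !exprMn -mulrDr cos2Dsin2 mulr1.
  by move/eqP; rewrite eqrXn2 ?ltW // => /eqP.
have rn0 : r != 0 by rewrite gt_eqF.
by split; apply: (mulfI rn0); rewrite ?E1 ?E2 rr'.
Qed.

Lemma is_angleN v t : is_angle v t -> is_angle (- v) (t + pi).
Proof. by move=> [r r0 ->]; exists r => //; rewrite cosDpi sinDpi !mulrN. Qed.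

Lemma is_angle_rot v t : is_angle v t -> is_angle (- v.2, v.1) (t + pi / 2).
Proof.
by move=> [r r0 ->]; exists r => //; rewrite cosDpihalf sinDpihalf !mulrN.
Qed.

Lemma angle_diff (t t' : R) : cos t = cos t' -> sin t = sin t' -> cos (t - t') = 1.
Proof. by move=> c s; rewrite cosB c s -!expr2 cos2Dsin2. Qed.

(** If the values at 0 and 1 differed, the intermediate value theorem would give a value at distance
    [m] from [f 0] with [0 < m <= pi], where the cosine of the difference is not 1. *)
Lemma constant_turn (f : R -> R) : continuous f ->
  (forall u, 0 <= u <= 1 -> cos (f u) = cos (f 0) /\ sin (f u) = sin (f 0)) ->
  f 1 = f 0.
Proof.
move=> fc fu; apply/eqP; apply/negPn/negP => ne.
have pi0 := pi_gt0 R.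
pose m := Num.min `|f 1 - f 0| pi.
have m0 : 0 < m by rewrite lt_min normr_gt0 subr_eq0 ne.
have [mf mpi] : m <= `|f 1 - f 0| /\ m <= pi by rewrite /m !ge_min !lexx orbT.
have key (y : R) : `|y - f 0| = m ->
    Num.min (f 0) (f 1) <= y <= Num.max (f 0) (f 1) -> False.
  move=> ym /(IVT ler01) [|u]; first exact: continuous_subspaceT.
  rewrite in_itv /= => u01 fuy; have [c s] := fu u u01.
  have : cos (y - f 0) = cos 0 by rewrite -fuy cos0 angle_diff.
  rewrite -cos_norm ym => /cos_inj; rewrite !in_itv /= lexx (ltW pi0) mpi (ltW m0).
  by move=> /(_ isT isT) m00; rewrite m00 ltxx in m0.
case: (ltgtP (f 0) (f 1)) ne => // h _.
- apply: (key (f 0 + m)); first by rewrite addrAC subrr add0r gtr0_norm.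
  rewrite (min_idPl (ltW h)) (max_idPr (ltW h)).
  by move: mf; rewrite gtr0_norm ?subr_gt0 //; lra.
- apply: (key (f 0 - m)); first by rewrite addrAC subrr add0r normrN gtr0_norm.
  rewrite (min_idPr (ltW h)) (max_idPl (ltW h)).
  by move: mf; rewrite ltr0_norm ?subr_lt0 //; lra.
Qed.

End Angles.

Section Clamp.
Variable R : realType.

(** The retraction of the line onto [0, 1]; it extends maps known on [0, 1] to the whole line. *)
Definition clamp (u : R) : R := (`|u| - `|u - 1| + 1) / 2.

Lemma clamp_id u : 0 <= u <= 1 -> clamp u = u.
Proof.
move=> /andP[u0 u1]; rewrite /clamp ger0_norm // ler0_norm ?subr_le0 //.
by field.
Qed.

Lemma clamp_range u : 0 <= clamp u <= 1.
Proof.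
rewrite /clamp; case: (ler0P u) => h; case: (ler0P (u - 1)) => h'; lra.
Qed.

Lemma continuous_clamp : continuous clamp.
Proof.
move=> u; apply: cvgM; last exact: cvg_cst.
apply: cvgD; last exact: cvg_cst.
apply: cvgB; first by apply: cvg_norm; exact: cvg_id.
by apply: cvg_norm; apply: cvgB; [exact: cvg_id | exact: cvg_cst].
Qed.

End Clamp.

Section Lifts.
Variable R : realType.

Lemma continuous_dot (T : topologicalType) (f g : T -> R * R) :
  continuous f -> continuous g -> continuous (fun y => dot (f y) (g y)).
Proof.
move=> cf cg y; apply: cvgD; apply: cvgM;
  by [exact: (continuous_fst cf) | exact: (continuous_fst cg)
     | exact: (continuous_snd cf) | exact: (continuous_snd cg)].
Qed.

Lemma continuous_det2 (T : topologicalType) (f g : T -> R * R) :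
  continuous f -> continuous g -> continuous (fun y => det2 (f y) (g y)).
Proof.
move=> cf cg y; apply: cvgB; apply: cvgM;
  by [exact: (continuous_fst cf) | exact: (continuous_fst cg)
     | exact: (continuous_snd cf) | exact: (continuous_snd cg)].
Qed.

Lemma continuous_turn (T : topologicalType) (f g : T -> R * R) :
  continuous f -> continuous g -> (forall y, 0 < dot (f y) (g y)) ->
  continuous (fun y => turn (f y) (g y)).
Proof.
move=> cf cg d0; apply: (@continuous_compose _ _ _
  (fun y => det2 (f y) (g y) / dot (f y) (g y)) (@atan R)); last first.
  by move=> ?; exact: continuous_atan.
move=> y; apply: cvgM; first exact: continuous_det2.
by apply: cvgV; [rewrite gt_eqF | exact: continuous_dot].
Qed.

Lemma continuous_bigsum (T : topologicalType) (I : Type) (r : seq I)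
    (f : I -> T -> R) :
  (forall i, continuous (f i)) -> continuous (fun y => \sum_(i <- r) f i y).
Proof.
move=> fc; elim: r => [|i r IH] y.
  by under eq_fun do rewrite big_nil; exact: cvg_cst.
under eq_fun do rewrite big_cons /=.
by apply: cvgD; [exact: fc | exact: IH].
Qed.

(** The angle at [y] is the angle at the origin plus the turns along the segment from the origin to
    [y]. Using the same number of steps for all [y], fine enough for all turns to be acute, makes
    this sum continuous. *)
Lemma square_lift (h : R * R -> R * R) : continuous h ->
  (forall y, 0 <= y.1 <= 1 -> 0 <= y.2 <= 1 -> h y != 0) ->
  exists t : R * R -> R, continuous t /\
    forall y, 0 <= y.1 <= 1 -> 0 <= y.2 <= 1 -> is_angle (h y) (t y).
Proof.
move=> hc h0.
pose sq (y : R * R) := (0 <= y.1 <= 1) && (0 <= y.2 <= 1).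
have K : compact (`[0, 1] `*` `[0, 1] : set (R * R)).
  by apply: compact_setX; exact: segment_compact.
have [e e0 he] : exists2 e : R, 0 < e & forall y, sq y -> forall z,
    `|z - y| < e -> 0 < dot (h y) (h z).
  pose Q (e : R) (y : R * R) := sq y -> forall z, `|z - y| < e -> 0 < dot (h y) (h z).
  have [e e0 he] : exists2 e : R, 0 < e & forall y, (`[0, 1] `*` `[0, 1]) y -> Q e y.
    apply: (compact_uniform K).
      by move=> e e' y _ e'e Qe sy z zy; apply: Qe => //; exact: lt_le_trans e'e.
    move=> x /= []; rewrite /= !in_itv /= => x1 x2.
    have dc : continuous (fun z : (R * R) * (R * R) => dot (h z.1) (h z.2)).
      apply: continuous_dot.
        by apply: (continuous_compose _ hc); apply: continuous_fst => ?; exact: cvg_id.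
      by apply: (continuous_compose _ hc); apply: continuous_snd => ?; exact: cvg_id.
    have := dc (x, x); move=> /cvgr_gt /(_ 0 (dot_gt0 (h0 x x1 x2))).
    move=> /near_normP[e e0 he]; exists (e / 2); first by rewrite divr_gt0.
    have e2 : 0 < e / 2 by rewrite divr_gt0.
    apply/near_normP; exists (e / 2) => // y yx _ z zy.
    apply: (he (y, z)); rewrite prod_normE /= gt_max.
    by have := ler_distD y z x; move: yx zy; lra.
  exists e => // y ys; apply: he => //; move/andP: ys => [y1 y2].
  by split; rewrite /= in_itv.
have [n ne] := small_inverse (divr_gt0 e0 (ltr0n R 2)).
have N0 : 0 < n.+1%:R :> R by rewrite ltr0n.
have [t0 ht0] := is_angle_exists (h0 (0, 0) ltac:(by rewrite /= lexx ler01) ltac:(by rewrite /= lexx ler01)).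
pose q (k : nat) (y : R * R) : R * R :=
  (k%:R / n.+1%:R * clamp y.1, k%:R / n.+1%:R * clamp y.2).
have qc k : continuous (q k).
  have cc (f : R * R -> R) : continuous f ->
      continuous (fun y => k%:R / n.+1%:R * clamp (f y)).
    move=> fc y; apply: cvgM; first exact: cvg_cst.
    exact: (continuous_compose fc (@continuous_clamp R)).
  apply: continuous_pairing; apply: cc.
    by apply: continuous_fst => ?; exact: cvg_id.
  by apply: continuous_snd => ?; exact: cvg_id.
have k01 (k : nat) : (k <= n.+1)%N -> 0 <= (k%:R / n.+1%:R : R) <= 1.
  by move=> kn; rewrite divr_ge0 //= ler_pdivrMr // mul1r ler_nat.
have in01 (k : nat) (u : R) : (k <= n.+1)%N -> 0 <= k%:R / n.+1%:R * clamp u <= 1.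
  move=> /k01/andP[k0 k1]; have /andP[u0 u1] := clamp_range u.
  by rewrite mulr_ge0 //= mulr_ile1.
have d0 (k : 'I_n.+1) y : 0 < dot (h (q k y)) (h (q k.+1 y)).
  apply: he; first by rewrite /sq !in01 // ltnW.
  have step (u : R) : `|k.+1%:R / n.+1%:R * clamp u - k%:R / n.+1%:R * clamp u| < e.
    rewrite -mulrBl -mulrBl -natr1 addrAC subrr add0r mul1r.
    have /andP[u0 u1] := clamp_range u.
    rewrite ger0_norm; last by rewrite mulr_ge0 // invr_ge0.
    apply: le_lt_trans (_ : n.+1%:R^-1 < e).
      by rewrite ler_piMr // invr_ge0.
    by apply: le_lt_trans ne _; lra.
  by rewrite prod_normE /= gt_max !step.
exists (fun y => t0 + \sum_(k < n.+1) turn (h (q k y)) (h (q k.+1 y))); split.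
  move=> y; apply: cvgD; first exact: cvg_cst.
  apply: continuous_bigsum => k; apply: continuous_turn.
  - exact: continuous_compose (qc k) hc.
  - exact: continuous_compose (qc k.+1) hc.
  - exact: d0.
move=> y y1 y2.
have qn : q n.+1 y = y.
  by rewrite /q divff ?gt_eqF // !mul1r !clamp_id //; case: (y).
rewrite -{1}qn.
suff all m : (m <= n.+1)%N ->
    is_angle (h (q m y)) (t0 + \sum_(k < m) turn (h (q k y)) (h (q k.+1 y))).
  exact: all.
elim: m => [|m IH] mn.
  by rewrite big_ord0 addr0 /q !mul0r.
rewrite big_ord_recr /= addrA; apply: is_angle_turn; first exact/IH/ltnW.
exact: (d0 (Ordinal mn)).
Qed.

End Lifts.

(** * Loops of winding number zero *)

Section NullLoops.
Variable R : realType.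
Implicit Types (g : R -> R * R) (t : R -> R).

(* A loop in the punctured plane, parametrized by [0, 1], has winding number
   zero if it admits a closed continuous determination of the angle. *)
Definition null g : Prop := exists t, [/\ continuous t,
  forall u, 0 <= u <= 1 -> is_angle (g u) (t u) & t 0 = t 1].

Let zero01 : 0 <= (0 : R) <= 1. Proof. by rewrite lexx ler01. Qed.
Let one01 : 0 <= (1 : R) <= 1. Proof. by rewrite lexx ler01. Qed.

Lemma null_lift g t : null g -> continuous t ->
  (forall u, 0 <= u <= 1 -> is_angle (g u) (t u)) -> t 0 = t 1.
Proof.
move=> [t' [t'c t'a t'01]] tc ta.
have trig u : 0 <= u <= 1 -> cos (t u - t' u) = 1 /\ sin (t u - t' u) = 0.
  move=> hu; have [c s] := is_angle_unique (ta u hu) (t'a u hu).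
  by rewrite angle_diff // sinB c s mulrC subrr.
suff : t 1 - t' 1 = t 0 - t' 0 by rewrite t'01; move/addIr.
apply: (@constant_turn R (fun u => t u - t' u)).
  by move=> u; apply: cvgB; [exact: tc | exact: t'c].
move=> u hu; have [-> ->] := trig u hu.
by have [-> ->] := trig 0 zero01.
Qed.

Lemma eq_null g g' : (forall u, 0 <= u <= 1 -> g u = g' u) -> null g -> null g'.
Proof.
by move=> E [t [tc ta t01]]; exists t; split=> // u hu; rewrite -E //; apply: ta.
Qed.

Lemma nullN g : null g -> null (fun u => - g u).
Proof.
move=> [t [tc ta t01]]; exists (fun u => t u + pi); split; last by rewrite t01.
  by move=> u; apply: cvgD; [exact: tc | exact: cvg_cst].
by move=> u hu; apply: is_angleN; exact: ta.
Qed.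

Lemma null_rot g : null g -> null (fun u => (- (g u).2, (g u).1)).
Proof.
move=> [t [tc ta t01]]; exists (fun u => t u + pi / 2).
split; last by rewrite t01.
  by move=> u; apply: cvgD; [exact: tc | exact: cvg_cst].
by move=> u hu; apply: is_angle_rot; exact: ta.
Qed.

Lemma null_const (v : R * R) : v != 0 -> null (fun=> v).
Proof.
move=> /is_angle_exists[t ta]; exists (fun=> t).
by split=> // u; exact: cvg_cst.
Qed.

(** The turn from [g] to [g'] is continuous and takes equal values at 0 and 1; adding it to an angle
    of [g] gives an angle of [g']. *)
Lemma null_dot g g' : continuous g -> continuous g' -> g 0 = g 1 ->
  g' 0 = g' 1 -> (forall u, 0 <= u <= 1 -> 0 < dot (g u) (g' u)) ->
  null g -> null g'.
Proof.
move=> gc g'c g01 g'01 d0 [t [tc ta t01]].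
exists (fun u => t u + turn (g (clamp u)) (g' (clamp u))); split.
- move=> u; apply: cvgD; first exact: tc.
  apply: continuous_turn.
  + exact: continuous_compose (@continuous_clamp R) gc.
  + exact: continuous_compose (@continuous_clamp R) g'c.
  + by move=> y; apply: d0; exact: clamp_range.
- by move=> u hu; rewrite clamp_id //; apply: is_angle_turn; [exact: ta|exact: d0].
- by rewrite !clamp_id // t01 g01 g'01.
Qed.

(** The increment of a lifted angle around the loop at stage [s] is a multiple of 2 pi, hence
    independent of [s]. *)
Lemma null_homotopy (h : R * R -> R * R) : continuous h ->
  (forall y, 0 <= y.1 <= 1 -> 0 <= y.2 <= 1 -> h y != 0) ->
  (forall s, 0 <= s <= 1 -> h (0, s) = h (1, s)) ->
  null (fun u => h (u, 0)) -> null (fun u => h (u, 1)).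
Proof.
move=> hc h0 h01 n0; have [t [tc ta]] := square_lift hc h0.
have tc1 (s : R) : continuous (fun u => t (u, s)).
  apply: (@continuous_compose _ _ _ (fun u : R => (u, s)) t) => //.
  by apply: continuous_pairing => ?; [exact: cvg_id | exact: cvg_cst].
have tc2 (u : R) : continuous (fun s => t (u, s)).
  apply: (@continuous_compose _ _ _ (fun s : R => (u, s)) t) => //.
  by apply: continuous_pairing => ?; [exact: cvg_cst | exact: cvg_id].
have t0 : t (0, 0) = t (1, 0).
  by apply: (null_lift n0 (tc1 0)) => u hu; apply: ta.
exists (fun u => t (u, 1)); split=> //.
  by move=> u hu; apply: ta.
have trig s : 0 <= s <= 1 -> cos (t (1, s) - t (0, s)) = 1 /\ sin (t (1, s) - t (0, s)) = 0.
  move=> hs; have a1 := ta (1, s) one01 hs; have a0 := ta (0, s) zero01 hs.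
  rewrite h01 // in a0; have [c s'] := is_angle_unique a1 a0.
  by rewrite angle_diff // sinB c s' mulrC subrr.
suff : t (1, 1) - t (0, 1) = t (1, 0) - t (0, 0).
  by rewrite t0 subrr => /eqP; rewrite subr_eq0 => /eqP ->.
apply: (@constant_turn R (fun s => t (1, s) - t (0, s))).
  by move=> s; apply: cvgB; apply: tc2.
move=> s hs; have [-> ->] := trig s hs.
by have [-> ->] := trig 0 zero01.
Qed.

(** The lifted angle agrees at (0, 0) and (0, 1) along one side, and at (0, 1) and (1, 1) along the
    next: degrees of the two factors add up along the diagonal. *)
Lemma null_diagonal (h : R * R -> R * R) : continuous h ->
  (forall y, 0 <= y.1 <= 1 -> 0 <= y.2 <= 1 -> h y != 0) ->
  (forall u, 0 <= u <= 1 -> h (u, 0) = h (u, 1)) ->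
  null (fun u => h (u, 0)) -> null (fun u => h (0, u)) ->
  null (fun u => h (u, u)).
Proof.
move=> hc h0 h01 n1 n2; have [t [tc ta]] := square_lift hc h0.
have tc1 (s : R) : continuous (fun u => t (u, s)).
  apply: (@continuous_compose _ _ _ (fun u : R => (u, s)) t) => //.
  by apply: continuous_pairing => ?; [exact: cvg_id | exact: cvg_cst].
have tc2 (u : R) : continuous (fun s => t (u, s)).
  apply: (@continuous_compose _ _ _ (fun s : R => (u, s)) t) => //.
  by apply: continuous_pairing => ?; [exact: cvg_cst | exact: cvg_id].
exists (fun u => t (u, u)); split.
- apply: (@continuous_compose _ _ _ (fun u : R => (u, u)) t) => //.
  by apply: continuous_pairing => ?; exact: cvg_id.
- by move=> u hu; apply: ta.
have -> : t (0, 0) = t (0, 1).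
  by apply: (null_lift n2 (tc2 0)) => u hu; apply: ta.
by apply: (null_lift n1 (tc1 1)) => u hu; rewrite h01 //; apply: ta.
Qed.

(** The increment of the angle over half a period is an odd multiple of pi, the same over both
    halves; for a closed angle the two would cancel, so it would be 0. *)
Lemma antiperiodic_not_null g : continuous g ->
  (forall u, g (u + 2^-1) = - g u) -> ~ null g.
Proof.
move=> gc gN [t [tc ta t01]].
have tS : continuous (fun u : R => t (u / 2 + 2^-1)).
  apply: (@continuous_compose _ _ _ (fun u : R => u / 2 + 2^-1) t) => // u.
  by apply: cvgD; [apply: cvgM; [exact: cvg_id|exact: cvg_cst] | exact: cvg_cst].
have tH : continuous (fun u : R => t (u / 2)).
  apply: (@continuous_compose _ _ _ (fun u : R => u / 2) t) => // u.
  by apply: cvgM; [exact: cvg_id|exact: cvg_cst].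
pose f (u : R) := t (u / 2 + 2^-1) - t (u / 2).
have trig u : 0 <= u <= 1 -> cos (f u) = - 1 /\ sin (f u) = 0.
  move=> hu; have a1 : is_angle (- g (u / 2)) (t (u / 2 + 2^-1)).
    by rewrite -gN; apply: ta; lra.
  have a0 : is_angle (- g (u / 2)) (t (u / 2) + pi).
    by apply: is_angleN; apply: ta; lra.
  have [c s] := is_angle_unique a1 a0.
  rewrite /f cosB sinB c s cosDpi sinDpi; split; last by rewrite mulrC; lra.
  by have := cos2Dsin2 (t (u / 2)); rewrite !expr2; lra.
have f10 : f 1 = f 0.
  apply: constant_turn; first by move=> u; apply: cvgB; [exact: tS | exact: tH].
  by move=> u hu; have [-> ->] := trig u hu; have [-> ->] := trig 0 zero01.
have f0 : f 0 = 0.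
  have E : (2^-1 + 2^-1 : R) = 1 by field.
  by move: f10; rewrite /f !mul1r E mul0r add0r -t01; lra.
have [] := trig 0 zero01; rewrite f0 cos0; lra.
Qed.

Definition secant (f : R -> R * R) (a u : R) : R * R := f (u + a) - f u.

Lemma continuous_secant (T : topologicalType) (f : R -> R * R) (a u : T -> R) :
  continuous f -> continuous a -> continuous u ->
  continuous (fun y => secant f (a y) (u y)).
Proof.
move=> fc ac uc y; apply: cvgB; last exact: (continuous_compose uc fc).
apply: (@continuous_compose _ _ _ (fun y => u y + a y) f) => // z.
by apply: cvgD; [exact: uc | exact: ac].
Qed.

(* Only the parity of the turning number matters: for s from a small number
   to 1/2, the secants f (u + s) - f u interpolate between loops homotopic to
   the tangent T and an antiperiodic loop. *)
Lemma tangent_not_null (f T : R -> R * R) (e : R) :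
  continuous f -> continuous T -> (forall u, f (u + 1) = f u) -> T 0 = T 1 ->
  (forall u s, 0 < s < 1 -> f (u + s) <> f u) ->
  0 < e < 2^-1 -> (forall u, 0 <= u <= 1 -> 0 < dot (T u) (secant f e u)) ->
  ~ null T.
Proof.
move=> fc Tc f1 T01 finj e0 dT nT.
have idc : continuous (id : R -> R) by move=> ?; exact: cvg_id.
have cstc (a : R) : continuous (fun _ : R => a) by move=> ?; exact: cvg_cst.
pose s (r : R) : R := e + r * (2^-1 - e).
have sc : continuous s.
  move=> r; apply: cvgD; first exact: cvg_cst.
  by apply: cvgM; [exact: cvg_id | exact: cvg_cst].
pose h (y : R * R) : R * R := secant f (s y.2) y.1.
have secant_loop a : secant f a 0 = secant f a 1.
  have f10 : f 1 = f 0 by rewrite -[in LHS](add0r 1) f1.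
  by rewrite /secant add0r (addrC 1) f1 f10.
have half : null (fun u => h (u, 1)).
  apply: null_homotopy => //.
  - have idc2 : continuous (id : R * R -> R * R) by move=> ?; exact: cvg_id.
    apply: continuous_secant => //; last exact: continuous_fst.
    exact: continuous_compose (continuous_snd idc2) sc.
  - move=> y y1 /andP[y20 y21]; rewrite subr_eq0; apply/eqP/finj.
    have : 0 <= y.2 * (2^-1 - e) by apply: mulr_ge0; lra.
    have : y.2 * (2^-1 - e) <= 2^-1 - e by apply: ler_piMl; lra.
    by rewrite /s; lra.
  - by move=> r _; exact: secant_loop.
  have s0 : s 0 = e by rewrite /s mul0r addr0.
  rewrite /h /= s0; apply: (null_dot _ _ T01 _ dT nT) => //.
  exact: (continuous_secant fc (cstc e) idc).
have s1 : s 1 = 2^-1 by rewrite /s; lra.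
move: half; rewrite /h /= s1; apply: antiperiodic_not_null.
  exact: (continuous_secant fc (cstc _) idc).
move=> u; rewrite /secant opprB -addrA; congr (_ - _).
have -> : (2^-1 + 2^-1 : R) = 1 by field.
exact: f1.
Qed.

End NullLoops.

Lemma norm_le_dot (R : realType) (v : R * R) : `|v| * `|v| <= dot v v.
Proof.
rewrite prod_normE /dot -!expr2; case: (leP `|v.1| `|v.2|) => _.
  by rewrite -normrX ger0_norm ?sqr_ge0 // lerDr sqr_ge0.
by rewrite -normrX ger0_norm ?sqr_ge0 // lerDl sqr_ge0.
Qed.

Lemma dot_bound (R : realType) (v w : R * R) : `|dot v w| <= 2 * (`|v| * `|w|).
Proof.
have le1 (x : R * R) : `|x.1| <= `|x| by rewrite prod_normE le_max lexx.
have le2 (x : R * R) : `|x.2| <= `|x| by rewrite prod_normE le_max lexx orbT.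
apply: le_trans (ler_normD _ _) _; rewrite !normrM.
have := ler_pM (normr_ge0 _) (normr_ge0 _) (le1 v) (le1 w).
have := ler_pM (normr_ge0 _) (normr_ge0 _) (le2 v) (le2 w).
lra.
Qed.

Section Circle.
Variable R : realType.

Definition unit_circle (u : R) : R * R := (cos (2 * pi * u), sin (2 * pi * u)).

Lemma continuous_unit_circle : continuous unit_circle.
Proof.
have lin : continuous (fun u : R => 2 * pi * u).
  by move=> u; apply: cvgM; [exact: cvg_cst | exact: cvg_id].
apply: continuous_pairing.
- by apply: (continuous_compose lin); exact: continuous_cos.
- by apply: (continuous_compose lin); exact: continuous_sin.
Qed.

Lemma unit_circle_not_null : ~ null unit_circle.
Proof.
apply: antiperiodic_not_null; first exact: continuous_unit_circle.
move=> u; rewrite /unit_circle.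
have -> : 2 * pi * (u + 2^-1) = 2 * pi * u + pi :> R by field.
by rewrite cosDpi sinDpi.
Qed.

Lemma dot_unit_circle u : dot (unit_circle u) (unit_circle u) = 1.
Proof. by rewrite /dot -!expr2 cos2Dsin2. Qed.

(** The norm is the maximum norm, hence not constant on the circle. *)
Lemma unit_circle_bounds u : 2^-1 <= `|unit_circle u| <= 1.
Proof.
have := norm_le_dot (unit_circle u); have := dot_bound (unit_circle u) (unit_circle u).
rewrite dot_unit_circle normr1 -!expr2; move: (normr_ge0 (unit_circle u)).
move: `|unit_circle u| => a a0 h1 h2; apply/andP; split.
  rewrite leNgt; apply/negP => h; have : a * a < 2^-1 * 2^-1 by apply: ltr_pM.
  by rewrite -expr2; lra.
by rewrite -(@ler_pXn2r _ 2) ?nnegrE // expr1n.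
Qed.

End Circle.

(** * Winding numbers and the two sides of a Jordan curve *)

Section JordanSides.
Variable R : realType.
Variable f : R -> R * R.
Hypothesis fc : continuous f.
Hypothesis f1 : forall u, f (u + 1) = f u.

Definition curve_image : set (R * R) := [set y | exists u, f u = y].

Local Notation D := (~` curve_image).

Lemma fractional_part (u : R) :
  exists2 v : R, 0 <= v <= 1 & exists k : int, u = v + k%:~R.
Proof.
exists (u - (Num.floor u)%:~R); last by exists (Num.floor u); rewrite subrK.
by have := floor_le u; have := floorD1_gt u; rewrite intrD1; lra.
Qed.

Let f_unit u : exists2 v : R, 0 <= v <= 1 & f u = f v.
Proof.
have [v v01 [k ->]] := fractional_part u; exists v => //.
by rewrite (int_periodic f1).
Qed.

Let f01 (x : R * R) : f 0 - x = f 1 - x.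
Proof. by rewrite -(f1 0) add0r. Qed.

Let loop_cont (x : R * R) : continuous (fun u => f u - x).
Proof. by move=> u; apply: cvgB; [exact: fc | exact: cvg_cst]. Qed.

Let image_compact : compact curve_image.
Proof.
have -> : curve_image = f @` `[0, 1].
  apply/seteqP; split=> y /= [u].
    by move=> <-; have [v v01 ->] := f_unit u; exists v; rewrite //= in_itv.
  by move=> _ <-; exists u.
apply: continuous_compact; last exact: segment_compact.
exact: continuous_subspaceT.
Qed.

Let image_closed : closed curve_image.
Proof. by apply: compact_closed image_compact; exact: norm_hausdorff. Qed.

Let near_dot (y : R * R) : D y ->
  \forall z \near y, forall u, 0 < dot (f u - y) (f u - z).
Proof.
move=> Dy.
have : \forall z \near y, forall u, 0 <= u <= 1 -> 0 < dot (f u - y) (f u - z).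
  apply: near_segment => u _.
  have dc : continuous (fun p : R * (R * R) => dot (f p.1 - y) (f p.1 - p.2)).
    have idc : continuous (id : R * (R * R) -> R * (R * R)) by move=> ?; exact: cvg_id.
    have fc1 := continuous_compose (continuous_fst idc) fc.
    apply: continuous_dot => p; apply: cvgB; try exact: fc1.
      exact: cvg_cst.
    exact: (continuous_snd idc).
  have y0 : f u - y != 0.
    by rewrite subr_eq0; apply/eqP => fuy; apply: Dy; exists u.
  by have := @dc (u, y); move=> /cvgr_gt /(_ 0 (dot_gt0 y0)).
apply: filterS => z hz u; have [v v01 ->] := f_unit u.
exact: hz.
Qed.

Let D_near (y : R * R) : D y -> \forall z \near y, D z.
Proof.
move=> /near_dot; apply: filterS => z hz [u fuz].
by have := hz u; rewrite fuz subrr /dot /= !mulr0 addr0 ltxx.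
Qed.

Let null_near (y : R * R) : D y ->
  \forall z \near y, null (fun u => f u - y) <-> null (fun u => f u - z).
Proof.
move=> /near_dot; apply: filterS => z hz; split; apply: null_dot => //.
by move=> u _; rewrite /dot mulrC [X in _ + X]mulrC; exact: hz.
Qed.

Let image_bounded : exists2 M, 0 < M & forall u, `|f u| <= M.
Proof.
have /compact_bounded := image_compact; rewrite /bounded_near => hb.
have [M [M0 hM]] : exists M, 0 < M /\ curve_image `<=` [set x | `|x| <= M].
  have : \forall M \near +oo, 0 < M /\ curve_image `<=` [set x | `|x| <= M].
    by apply: filterI => //; exact: nbhs_pinfty_gt.
  by move=> /filter_ex.
by exists M => // u; apply: hM; exists u.
Qed.

Let null_far : exists2 M, 0 < M & forall x : R * R, M < `|x| ->
  null (fun u => f u - x).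
Proof.
have [M M0 hM] := image_bounded; exists (2 * M); first by rewrite mulr_gt0.
move=> x xM.
have x0 : 0 < `|x| by apply: lt_trans xM; rewrite mulr_gt0.
have nx : - x != 0 by rewrite oppr_eq0 -normr_gt0.
apply: (@null_dot R (fun=> - x)) (null_const nx) => //.
  by move=> ?; exact: cvg_cst.
move=> u _.
have -> : dot (- x) (f u - x) = dot x x - dot x (f u) by rewrite /dot /=; ring.
have h1 : dot x (f u) <= 2 * M * `|x|.
  apply: le_trans (ler_norm _) _; apply: le_trans (dot_bound _ _) _.
  by rewrite -mulrA ler_pM2l // mulrC ler_wpM2r.
have h2 := norm_le_dot x.
have : 2 * M * `|x| < `|x| * `|x| by rewrite ltr_pM2r.
lra.
Qed.

(** Being null is locally constant off the curve and holds for all points far away; an unbounded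
    component contains such points. *)
Lemma outside_null x : outside curve_image x -> null (fun u => f u - x).
Proof.
move=> [Dx unb]; set A := connected_component D x in unb.
have [M M0 hM] := null_far.
have [y Ay yM] : exists2 y, A y & M < `|y|.
  apply: contrapT => no; apply: unb; exists M; split; first exact: num_real.
  move=> M' MM' y Ay /=; apply: le_trans (ltW MM'); rewrite leNgt; apply/negP => h.
  by apply: no; exists y.
have Ax : A x by exact: connected_component_refl.
have AD : A `<=` D by exact: connected_component_sub.
pose S := [set z | null (fun u => f u - z)].
have SE : A `&` S = A.
  apply: (@component_connected _ D x).
  - by exists y; split=> //; exact: hM.
  - exists (D `&` S).
      rewrite openE => z [Dz Sz]; apply: filterI; first exact: D_near.
      by apply: filterS (null_near Dz) => w hw; apply/hw.
    by apply/seteqP; split=> z [Az]; [move=> Sz; split=> //; split=> //; exact: AD | case].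
  - exists (~` (D `&` ~` S)).
      apply: open_closedC; rewrite openE => z [Dz Sz].
      apply: filterI; first exact: D_near.
      by apply: filterS (null_near Dz) => w hw Sw; apply: Sz; apply/hw.
    apply/seteqP; split=> z [Az Sz]; split=> //; first by case.
    by apply: contrapT => nSz; apply: Sz; split=> //; exact: AD.
have [] : (A `&` S) x by rewrite SE.
by [].
Qed.

Hypothesis f_inj : forall u v, f u = f v -> circle_eq u v.

Let f_inj01 (t : R -> R) u v : t 0 = t 1 -> 0 <= u <= 1 -> 0 <= v <= 1 ->
  f u = f v -> t u = t v.
Proof.
move=> t01 /andP[u0 u1] /andP[v0 v1] /f_inj; rewrite /circle_eq.
have [->|uv] := eqVneq u v; first by [].
move=> /intrP[k kE].
have [k1|k1|k1] := ltgtP k 0.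
- have : k%:~R <= -1 :> R by rewrite -[-1]/((-1)%:~R) ler_int; lia.
  rewrite -kE => h; have -> : u = 0 by lra.
  by have -> : v = 1 by lra.
- have : 1 <= k%:~R :> R by rewrite -[1]/(1%:~R) ler_int; lia.
  rewrite -kE => h; have -> : u = 1 by lra.
  by have -> : v = 0 by lra.
- by move: uv; rewrite -subr_eq0 kE k1 eqxx.
Qed.

(* Tietze's theorem extends an angle along the curve to the whole plane. *)
Let extend_angle (t : R -> R) : continuous t -> t 0 = t 1 ->
  exists2 T : R * R -> R, continuous T & forall u, 0 <= u <= 1 -> T (f u) = t u.
Proof.
move=> tc t01.
(* The parameter is ambiguous only between 0 and 1, where [t] takes the same value. *)
pose inv (y : R * R) : R := xget 0 [set u | 0 <= u <= 1 /\ f u = y].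
pose psi (y : R * R) : R := t (inv y).
have psiE u : 0 <= u <= 1 -> psi (f u) = t u.
  move=> hu; have [] : 0 <= inv (f u) <= 1 /\ f (inv (f u)) = f u.
    by apply: (@xgetPex _ 0 [set v | 0 <= v <= 1 /\ f v = f u]); exists u.
  by move=> h1 h2; apply: f_inj01.
(* Preimages of closed sets under [psi] are images under [f] of compact sets of parameters. *)
have psic : {within curve_image, continuous psi}.
  apply/continuous_closedP => E Ecl; apply/closed_subspaceP.
  exists (f @` (`[0, 1] `&` t @^-1` E)).
    apply: compact_closed; first exact: norm_hausdorff.
    apply: continuous_compact; first exact: continuous_subspaceT.
    apply: (subclosed_compact _ (@segment_compact R 0 1)); last exact: subIsetl.
    apply: closedI; first exact: itv_closed.
    by move/continuous_closedP: tc => /(_ _ Ecl).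
  apply/seteqP; split=> y /= [].
    move=> [u [u01 Etu] <-] _; split; last by exists u.
    rewrite /= in_itv /= in u01; change (E (psi (f u))).
    by rewrite psiE.
  change (E (psi y) -> curve_image y -> (f @` (`[0, 1] `&` t @^-1` E) `&` curve_image) y).
  move=> Ey [u fu]; split; last by exists u.
  have [v v01 E'] := f_unit u; exists v; last by rewrite -E'.
  by split; rewrite /= ?in_itv //= -psiE // -E' fu.
have [M M0 hM] : exists2 M : R, 0 < M & forall u, 0 <= u <= 1 -> `|t u| <= M.
  have : compact (t @` `[0, 1]).
    by apply: continuous_compact; [exact: continuous_subspaceT | exact: segment_compact].
  move=> /compact_bounded; rewrite /bounded_near => hb.
  have : \forall M \near +oo, 0 < M /\ t @` `[0, 1] `<=` [set x | `|x| <= M].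
    by apply: filterI => //; exact: nbhs_pinfty_gt.
  move=> /filter_ex[M [M0 hM]]; exists M => // u u01.
  by apply: hM; exists u; rewrite //= in_itv.
have psiM y : curve_image y -> `|psi y| <= M.
  by move=> [u <-]; have [v v01 ->] := f_unit u; rewrite psiE //; exact: hM.
have [T [TE Tc _]] := continuous_bounded_extension (@pseudometric_normal R (R * R)%type)
  image_closed M0 psic psiM.
exists T => // u u01; rewrite -TE ?psiE //.
by apply/mem_set; exists u.
Qed.

Let segment_component (x y z : R * R) (e : R) : (forall w, `|w - y| < e -> D w) ->
  `|z - y| < e -> connected_component D x z -> connected_component D x y.
Proof.
move=> hD zy Az; apply: connected_component_trans Az _.
pose seg (s : R) : R * R := z + s *: (y - z).
have segc : continuous seg.
  by move=> s; apply: cvgD; [exact: cvg_cst | apply: cvgZr_tmp; exact: cvg_id].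
apply: (@connected_component_max _ _ (seg @` `[0, 1])).
- by exists 0; rewrite /= ?in_itv /= ?lexx ?ler01 // /seg scale0r addr0.
- move=> w [s]; rewrite /= in_itv /= => /andP[s0 s1] <-; apply: hD.
  have -> : seg s - y = (1 - s) *: (z - y) by rewrite /seg; pair_ring.
  rewrite pair_normZ ger0_norm ?subr_ge0 //.
  by apply: le_lt_trans zy; apply: ler_piMl => //; lra.
- apply: connected_continuous_connected; first exact: segment_connected.
  exact: continuous_subspaceT.
- by exists 1; rewrite /= ?in_itv /= ?lexx ?ler01 // /seg scale1r addrC subrK.
Qed.

(** Given a closed angle, extend it to the plane and use it to replace the field [y - x] on the
    bounded component of [x]. The result is continuous, has no zero in the plane, and is unchanged
    on large circles. Contracting such a circle makes its loop null, yet that loop winds once. *)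
Lemma inside_not_null x : inside curve_image x -> ~ null (fun u => f u - x).
Proof.
move=> [Dx bnd] [t [tc ta t01]]; set A := connected_component D x in bnd.
have [T Tc TE] := extend_angle tc t01.
have [e e0 hD] : exists2 e, 0 < e & forall z, `|z - x| < e -> D z.
  exact/near_normP/D_near.
have [M M0 hM] : exists2 M : R, 0 < M & A `<=` [set y | `|y| <= M].
  have : \forall M \near +oo, 0 < M /\ A `<=` [set y | `|y| <= M].
    by apply: filterI => //; exact: nbhs_pinfty_gt.
  by move=> /filter_ex[M [M0 hM]]; exists M.
pose norm2 (y : R * R) : R := Num.sqrt (dot (y - x) (y - x)).
(* The maximum of [e] and the Euclidean distance to [x]: positive everywhere, and equal to that
   distance on the curve, which keeps at least [e] away from [x]. *)
pose N (y : R * R) : R := (norm2 y + e + `|norm2 y - e|) / 2.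
have N0 y : 0 < N y.
  by rewrite /N; have := sqrtr_ge0 (dot (y - x) (y - x)); rewrite -/(norm2 y);
    have := normr_ge0 (norm2 y - e); lra.
have norm2c : continuous norm2.
  apply: (@continuous_compose _ _ _ (fun y : R * R => dot (y - x) (y - x)) Num.sqrt).
    by apply: continuous_dot => y; apply: cvgB; by [exact: cvg_id | exact: cvg_cst].
  exact: sqrt_continuous.
have Nc : continuous N.
  move=> y; apply: cvgM; last exact: cvg_cst.
  apply: cvgD; first by apply: cvgD; [exact: norm2c | exact: cvg_cst].
  by apply: cvg_norm; apply: cvgB; [exact: norm2c | exact: cvg_cst].
pose r1 (y : R * R) : R * R := y - x.
pose r2 (y : R * R) : R * R := (N y * cos (T y), N y * sin (T y)).
have r1c : continuous r1 by move=> y; apply: cvgB; [exact: cvg_id | exact: cvg_cst].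
have r2c : continuous r2.
  apply: continuous_pairing => y; apply: cvgM; try exact: Nc.
    exact: (continuous_compose Tc (@continuous_cos R)).
  exact: (continuous_compose Tc (@continuous_sin R)).
have r12 y : curve_image y -> r1 y = r2 y.
  move=> [u <-]; have [v v01 ->] := f_unit u.
  have [r r0 E] := ta v v01; rewrite /r1 /r2 TE // E.
  have nE : norm2 (f v) = r.
    rewrite /norm2 E /dot /= -!expr2 !exprMn -mulrDr cos2Dsin2 mulr1.
    by rewrite sqrtr_sqr gtr0_norm.
  have er : e <= r.
    rewrite leNgt; apply/negP => re; apply: (hD (f v)); last by exists v.
    rewrite E; apply: le_lt_trans re.
    rewrite -(@ler_pXn2r _ 2) ?nnegrE ?(ltW r0) // expr2.
    apply: le_trans (norm_le_dot _) _.
    by rewrite /dot /= -!expr2 !exprMn -mulrDr cos2Dsin2 mulr1.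
  by rewrite /N nE ger0_norm ?subr_ge0 //; congr (_ * _, _ * _); field.
pose r (y : R * R) : R * R := if pselect (A y) then r2 y else r1 y.
(* On the curve both formulas agree; off the curve, components are open, so nearby points use the
   same formula. *)
have rc : continuous r.
  move=> y; apply/cvgrPdist_lt => d d0.
  have h1 : \forall z \near y, `|r1 y - r1 z| < d.
    by have /cvgrPdist_lt/(_ d d0) := r1c y.
  have h2 : \forall z \near y, `|r2 y - r2 z| < d.
    by have /cvgrPdist_lt/(_ d d0) := r2c y.
  have [Cy|Dy] := pselect (curve_image y).
    have rE z : r z = r1 z \/ r z = r2 z by rewrite /r; case: pselect; [right|left].
    have ry : r y = r1 y by case: (rE y) => // ->; rewrite r12.
    apply: filterS2 h1 h2 => z z1 z2; rewrite ry.
    by case: (rE z) => -> //; rewrite r12.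
  have [ey ey0 hy] : exists2 ey, 0 < ey & forall z, `|z - y| < ey -> D z.
    exact/near_normP/D_near.
  have ey2 : 0 < ey / 2 by rewrite divr_gt0.
  have nz : \forall z \near y, `|z - y| < ey / 2.
    by apply/near_normP; exists (ey / 2).
  rewrite /r; case: pselect => Ay.
    apply: filterS2 h2 nz => z z2 zy; case: pselect => // nAz; exfalso; apply: nAz.
    apply: (segment_component (y := z) (z := y) (e := ey / 2)) => //.
    - by move=> w wz; apply: hy; have := ler_distD z w y; lra.
    - by rewrite distrC.
  apply: filterS2 h1 nz => z z1 zy; case: pselect => // Az; exfalso; apply: Ay.
  by apply: (segment_component hy _ Az); lra.
have Ax : A x by exact: connected_component_refl.
have r0 y : r y != 0.
  rewrite /r; case: pselect => Ay.
    apply/eqP => -[h1 h2]; have Ny := lt0r_neq0 (N0 y).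
    have c0 : cos (T y) = 0 by apply: (mulfI Ny); rewrite h1 mulr0.
    have s0 : sin (T y) = 0 by apply: (mulfI Ny); rewrite h2 mulr0.
    by have := cos2Dsin2 (T y); rewrite c0 s0 expr0n /= addr0; lra.
  rewrite subr_eq0; apply/eqP => yx; apply: Ay; rewrite yx; exact: Ax.
(* Half of [L] exceeds the bound [M] of the component, since unit vectors have norm at least 1/2;
   and [L] exceeds the bound [2 * |x|] for the inner product of [x] with a unit vector. *)
pose L : R := 2 * M + 2 * `|x| + 1.
have L0 : 0 < L by have := normr_ge0 x; rewrite /L; lra.
have circle_r u : r (L *: unit_circle u) = L *: unit_circle u - x.
  rewrite /r; case: pselect => // /hM /=; rewrite pair_normZ gtr0_norm // => hL.
  have /andP[h _] := unit_circle_bounds u.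
  have : L * 2^-1 <= L * `|unit_circle u| by rewrite ler_pM2l.
  by move=> hL'; exfalso; have := normr_ge0 x; move: hL hL'; rewrite /L; lra.
have uc := @continuous_unit_circle R.
have uc01 : unit_circle (0 : R) = unit_circle 1.
  by rewrite /unit_circle mulr0 mulr1 mulr_natl cos0 sin0 cos2pi sin2pi.
pose h (y : R * R) : R * R := r (y.2 * L * cos (2 * pi * y.1), y.2 * L * sin (2 * pi * y.1)).
have hc : continuous h.
  have idc : continuous (id : R * R -> R * R) by move=> ?; exact: cvg_id.
  have c1 := continuous_fst idc; have c2 := continuous_snd idc.
  have ang : continuous (fun y : R * R => 2 * pi * y.1).
    by move=> y; apply: cvgM; [exact: cvg_cst | exact: c1].
  have rad : continuous (fun y : R * R => y.2 * L).
    by move=> y; apply: cvgM; [exact: c2 | exact: cvg_cst].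
  apply: (@continuous_compose _ _ _ (fun y : R * R =>
    (y.2 * L * cos (2 * pi * y.1), y.2 * L * sin (2 * pi * y.1))) r) => //.
  apply: continuous_pairing => y; apply: cvgM; try exact: rad.
    exact: (continuous_compose ang (@continuous_cos R)).
  exact: (continuous_compose ang (@continuous_sin R)).
apply: (@unit_circle_not_null R).
have null1 : null (fun u => h (u, 1)).
  apply: null_homotopy => //; first by move=> y _ _; exact: r0.
    move=> s _; have [c s'] : cos (2 * pi * (0 : R)) = cos (2 * pi * 1) /\
        sin (2 * pi * (0 : R)) = sin (2 * pi * 1) by case: uc01.
    by rewrite /h /= c s'.
  apply: (@eq_null R (fun=> r (0, 0))); last exact: null_const.
  by move=> u _; rewrite /h /= !mul0r.
have null2 : null (fun u => L *: unit_circle u - x).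
  apply: eq_null null1 => u _; rewrite -circle_r /h /= mul1r.
  by rewrite /unit_circle; congr r.
have Lc : continuous (fun u => L *: unit_circle u - x).
  move=> u; apply: cvgB; last exact: cvg_cst.
  by apply: cvgZl_tmp; exact: uc.
apply: (null_dot Lc uc _ uc01 _ null2); first by rewrite uc01.
move=> u _.
have -> : dot (L *: unit_circle u - x) (unit_circle u) =
    L * dot (unit_circle u) (unit_circle u) - dot x (unit_circle u).
  by rewrite /dot /= !scale_mul; ring.
rewrite dot_unit_circle mulr1.
have := dot_bound x (unit_circle u); rewrite ler_norml => /andP[_ hb].
have /andP[_ h1] := unit_circle_bounds u.
have : `|x| * `|unit_circle u| <= `|x| by apply: ler_piMr.
by rewrite /L; lra.
Qed.

End JordanSides.

(** * Strict differentiability *)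

Section StrictDerivative.
Variable R : realType.

(* The estimate is uniform in the base point z, hence directional derivatives
   are additive and it passes to maps that agree with F on a smaller set. *)
Definition strict_derivative (V W : normedModType R) (F : V -> W) (y v : V)
    (w : W) : Prop :=
  forall e : R, 0 < e -> exists2 d : R, 0 < d & forall z (h : R),
    `|z - y| < d -> `|h| < d -> `|F (z + h *: v) - F z - h *: w| <= e * `|h|.

(** A property of the pair of spaces: it is proved for real values by the mean value theorem and
    passes to products componentwise. *)
Definition C1_strict (V W : normedModType R) : Prop :=
  forall (F : V -> W) (U : set V) (y v : V), open U -> U y ->
  (forall x, U x -> derivable F x v) ->
  {for y, continuous (fun x => 'D_v F x)} -> strict_derivative F y v ('D_v F y).

(** Mean value theorem on the segment from [z] to [z + h *: v]. The radius [r], within which the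
    derivative varies by less than [e], is shared equally between [z - y] and [h *: v]. *)
Lemma C1_strict_real (V : normedModType R) : C1_strict V R.
Proof.
move=> F U y v Uo Uy dF dc e e0.
have [r r0 hr] : exists2 r : R, 0 < r & forall x, `|x - y| < r ->
    U x /\ `|'D_v F y - 'D_v F x| < e.
  apply/near_normP; apply: filterI.
    by move: Uo; rewrite openE => /(_ y Uy).
  by move: dc => /cvgrPdist_lt/(_ e e0).
have v1 : 0 < `|v| + 1 by rewrite ltr_wpDl.
pose d := Num.min (r / 2) (r / 2 / (`|v| + 1)).
exists d; first by rewrite lt_min !divr_gt0.
move=> z h; rewrite lt_min => /andP[zy _]; rewrite lt_min => /andP[_ hd].
have near s : `|s| <= `|h| -> `|z + s *: v - y| < r.
  move=> sh; have -> : z + s *: v - y = (z - y) + s *: v by rewrite addrAC.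
  apply: le_lt_trans (ler_normD _ _) _; rewrite normrZ.
  have : `|h| * (`|v| + 1) < r / 2 by rewrite -ltr_pdivlMr.
  have : `|s| * `|v| <= `|h| * (`|v| + 1) by apply: ler_pM => //; lra.
  lra.
pose f (s : R) : R := F (z + s *: v).
have df (s : R) : `|s| <= `|h| -> is_derive s (1 : R) f ('D_v F (z + s *: v)).
  move=> sh; have [Us _] := hr _ (near s sh); have := dF _ Us.
  rewrite /derivable /derive => cv.
  have E : (fun k : R => k^-1 *: ((f \o shift s) (k *: 1) - f s)) =
      (fun k : R => k^-1 *: ((F \o shift (z + s *: v)) (k *: v) - F (z + s *: v))).
    apply/funext => k /=; rewrite /f /=; congr (_ *: (F _ - _)).
    by rewrite [_ *: 1]mulr1 scalerDl addrCA.
  by apply: DeriveDef; rewrite /derivable /derive E.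
have mvt : exists2 c, `|c| <= `|h| & f h - f 0 = 'D_v F (z + c *: v) * h.
  have between (a b : R) : a <= b -> (forall c, a <= c <= b -> `|c| <= `|h|) ->
      exists2 c, `|c| <= `|h| & f b - f a = 'D_v F (z + c *: v) * (b - a).
    move=> ab abh; have [| |c] := @MVT_segment R f (fun s => 'D_v F (z + s *: v)) a b ab.
    - by move=> s; rewrite in_itv /= => /andP[/ltW s1 /ltW s2]; apply/df/abh/andP.
    - by apply: derivable_within_continuous => s; rewrite in_itv /= => /abh /df [].
    - by rewrite in_itv /= => /abh ch E; exists c.
  have [h0|/ltW h0] := leP 0 h.
    have [|c ch] := between _ _ h0; last by rewrite subr0; exists c.
    by move=> c /andP[c0 c1]; rewrite !ger0_norm.
  have [|c ch E] := between _ _ h0.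
    by move=> c /andP[c0 c1]; rewrite !ler0_norm // lerN2.
  by exists c => //; rewrite -[LHS]opprB E sub0r mulrN opprK.
have [c ch E] := mvt; move: E; rewrite /f scale0r addr0 => ->.
have [_ hc] := hr _ (near c ch).
have -> : 'D_v F (z + c *: v) * h - h *: 'D_v F y =
    ('D_v F (z + c *: v) - 'D_v F y) * h.
  by rewrite mulrBl [h *: _]mulrC.
by rewrite normrM ler_wpM2r // distrC ltW.
Qed.

Lemma strict_derivative_pair (V W1 W2 : normedModType R) (F : V -> W1 * W2)
    (y v : V) (w : W1 * W2) :
  strict_derivative (fun x => (F x).1) y v w.1 ->
  strict_derivative (fun x => (F x).2) y v w.2 -> strict_derivative F y v w.
Proof.
move=> h1 h2 e e0; have [d1 d10 hd1] := h1 e e0; have [d2 d20 hd2] := h2 e e0.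
exists (Num.min d1 d2); first by rewrite lt_min d10.
move=> z h; rewrite !lt_min => /andP[zy1 zy2] /andP[hh1 hh2].
by rewrite prod_normE /= ge_max hd1 // hd2.
Qed.

Lemma derive_fst (V W1 W2 : normedModType R) (F : V -> W1 * W2) (x v : V) :
  derivable F x v -> is_derive x v (fun z => (F z).1) ('D_v F x).1.
Proof.
move=> dF; have c : (fun h : R => h^-1 *: ((fun z => (F z).1) (h *: v + x) - (F x).1))
    @ 0^' --> ('D_v F x).1.
  exact: (cvg_comp _ _ (dF : _ --> 'D_v F x) (cvg_fst)).
apply: DeriveDef; first by apply/cvg_ex; exists ('D_v F x).1.
exact: cvg_lim.
Qed.

Lemma derive_snd (V W1 W2 : normedModType R) (F : V -> W1 * W2) (x v : V) :
  derivable F x v -> is_derive x v (fun z => (F z).2) ('D_v F x).2.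
Proof.
move=> dF; have c : (fun h : R => h^-1 *: ((fun z => (F z).2) (h *: v + x) - (F x).2))
    @ 0^' --> ('D_v F x).2.
  exact: (cvg_comp _ _ (dF : _ --> 'D_v F x) (cvg_snd)).
apply: DeriveDef; first by apply/cvg_ex; exists ('D_v F x).2.
exact: cvg_lim.
Qed.

Lemma C1_strict_pair (V W1 W2 : normedModType R) :
  C1_strict V W1 -> C1_strict V W2 -> C1_strict V (W1 * W2)%type.
Proof.
move=> C1 C2 F U y v Uo Uy dF dc.
have near_eq (W : normedModType R) (f g : V -> W) : (forall x, U x -> f x = g x) ->
    {for y, continuous f} -> {for y, continuous g}.
  move=> E; rewrite /prop_for /continuous_at E //; apply: cvg_trans.
  apply: near_eq_cvg; have : \forall x \near y, U x.
    by move: Uo; rewrite openE => /(_ y Uy).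
  by apply: filterS => x Ux; rewrite E.
apply: strict_derivative_pair.
- rewrite -(derive_val (is_derive := derive_fst (dF _ Uy))).
  apply: (C1 _ U) => //.
    by move=> x Ux; apply: (ex_derive (is_derive := derive_fst (dF _ Ux))).
  apply: (near_eq _ (fun x => ('D_v F x).1)).
    by move=> x Ux; rewrite (derive_val (is_derive := derive_fst (dF _ Ux))).
  by apply: (cvg_comp _ _ dc); exact: cvg_fst.
- rewrite -(derive_val (is_derive := derive_snd (dF _ Uy))).
  apply: (C2 _ U) => //.
    by move=> x Ux; apply: (ex_derive (is_derive := derive_snd (dF _ Ux))).
  apply: (near_eq _ (fun x => ('D_v F x).2)).
    by move=> x Ux; rewrite (derive_val (is_derive := derive_snd (dF _ Ux))).
  by apply: (cvg_comp _ _ dc); exact: cvg_snd.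
Qed.

End StrictDerivative.

Section StrictDerivativeTheory.
Variables (R : realType) (V W : normedModType R).

Lemma strict_is_derive (F : V -> W) (y v : V) (w : W) :
  (forall e : R, 0 < e -> exists2 d : R, 0 < d & forall h : R,
    `|h| < d -> `|F (y + h *: v) - F y - h *: w| <= e * `|h|) ->
  is_derive y v F w.
Proof.
move=> st; suff c : (fun h : R => h^-1 *: (F (h *: v + y) - F y)) @ 0^' --> w.
  by apply: DeriveDef; [apply/cvg_ex; exists w | exact: cvg_lim].
apply/cvgrPdist_le => e e0.
have [d d0 hd] := st e e0.
near=> h; have h0 : h != 0 by near: h; exact: nbhs_dnbhs_neq.
have hh : `|h| < d by near: h; apply: dnbhs0_lt.
have := hd _ hh; rewrite /= [h *: v + y]addrC.
have {1}-> : F (y + h *: v) - F y - h *: w = - (h *: (w - h^-1 *: (F (y + h *: v) - F y))).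
  by rewrite scalerBr scalerA divff // scale1r opprB.
by rewrite normrN normrZ [e * _]mulrC ler_pM2l // normr_gt0.
Unshelve. all: by end_near. Qed.

Lemma strict_derivative_add (F : V -> W) (y v1 v2 : V) (w1 w2 : W) (a b : R) :
  strict_derivative F y v1 w1 -> strict_derivative F y v2 w2 ->
  'D_(a *: v1 + b *: v2) F y = a *: w1 + b *: w2.
Proof.
move=> s1 s2; apply: derive_val; apply: strict_is_derive => e e0.
pose m := `|a| + `|b| + 1; pose e' := e / m.
have m0 : 0 < m by rewrite /m; have := normr_ge0 a; have := normr_ge0 b; lra.
have e'0 : 0 < e' by rewrite divr_gt0.
have [d1 d10 h1] := s1 _ e'0; have [d2 d20 h2] := s2 _ e'0.
have v11 : 0 < `|v1| + 1 by rewrite ltr_wpDl.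
pose d := Num.min d1 d2 / m / (`|v1| + 1).
have d0 : 0 < d by rewrite !divr_gt0 // lt_min d10.
exists d => // h hd.
have hm : `|h| * (`|v1| + 1) * m < Num.min d1 d2 by rewrite -!ltr_pdivlMr.
have small c : `|c| <= m -> `|h * c| < Num.min d1 d2.
  move=> cm; apply: le_lt_trans hm; rewrite normrM.
  by apply: ler_pM => //; apply: ler_peMr => //; rewrite lerDr.
have am : `|a| <= m by rewrite /m; have := normr_ge0 b; lra.
have bm : `|b| <= m by rewrite /m; have := normr_ge0 a; lra.
have := small _ am; have := small _ bm; rewrite !lt_min => /andP[_ hb] /andP[ha _].
have near : `|y + (h * a) *: v1 - y| < d2.
  suff : `|y + (h * a) *: v1 - y| < Num.min d1 d2 by rewrite lt_min => /andP[].
  rewrite [y + _]addrC addrK normrZ normrM; apply: le_lt_trans hm; rewrite mulrAC.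
  by rewrite ler_pM ?mulr_ge0 // ler_wpM2l // lerDl.
have {h1}H1 := h1 y (h * a); rewrite subrr normr0 in H1.
have {}H1 := H1 d10 ha; have H2 := h2 _ _ near hb.
(* The increment is split at the displaced point [y + (h * a) *: v1], where the estimate along [v2]
   is available by uniformity in the base point. *)
have -> : F (y + h *: (a *: v1 + b *: v2)) - F y - h *: (a *: w1 + b *: w2) =
  (F (y + (h * a) *: v1 + (h * b) *: v2) - F (y + (h * a) *: v1) - (h * b) *: w2) +
  (F (y + (h * a) *: v1) - F y - (h * a) *: w1).
  rewrite !scalerDr !scalerA addrA [RHS]addrACA subrKA -opprD.
  by congr (_ - _); rewrite addrC.
apply: le_trans (ler_normD _ _) _; apply: le_trans (lerD H2 H1) _.
rewrite !normrM -mulrDr -mulrDr mulrCA [e * _]mulrC ler_wpM2l //.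
rewrite /e' mulrAC ler_pdivrMr // ler_wpM2l ?ltW // /m; lra.
Qed.

End StrictDerivativeTheory.

(** * The embedded torus *)

Lemma det2_independent (R : realType) (v w : R * R) :
  (forall a b : R, a *: v + b *: w = 0 -> a = 0 /\ b = 0) -> det2 v w != 0.
Proof.
move=> dir; apply/negP => /eqP vw.
(* If the determinant vanishes, so do both combinations with coefficients taken from one coordinate
   of the vectors; then [v] and [w] are zero and certainly dependent. *)
have [k1 k2] : w.1 = 0 /\ - v.1 = 0.
  apply: dir; move: vw; rewrite /det2 => vw.
  by rewrite [LHS]surjective_pairing; congr (_, _); rewrite /= !scale_mul; lra.
have [k3 k4] : w.2 = 0 /\ - v.2 = 0.
  apply: dir; move: vw; rewrite /det2 => vw.
  by rewrite [LHS]surjective_pairing; congr (_, _); rewrite /= !scale_mul; lra.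
have [/eqP] : (1 : R) = 0 /\ (0 : R) = 0; last by rewrite oner_eq0.
by apply: dir; rewrite scale0r scale1r addr0 [LHS]surjective_pairing; congr (_, _); lra.
Qed.

Section EmbeddedTorus.
Variable R : realType.
Notation source := (R * R * R)%type.
Notation target := ((R * R) * R * (R * R))%type.

Lemma norm_fst_le (W1 W2 : normedModType R) (y : W1 * W2) : `|y.1| <= `|y|.
Proof. by rewrite prod_normE le_max lexx. Qed.

Lemma norm_snd_le (W1 W2 : normedModType R) (y : W1 * W2) : `|y.2| <= `|y|.
Proof. by rewrite prod_normE le_max lexx orbT. Qed.

Lemma C1_strict_target : C1_strict (source : normedModType R) target.
Proof. by do !apply: C1_strict_pair; exact: C1_strict_real. Qed.

Lemma immersion_local (g : source -> target) (x : source) :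
  immersion (@thick_torus R) g -> thick_torus x ->
  exists F : source -> target, [/\
    exists2 r : R, 0 < r & forall y, `|y - x| < r -> thick_torus y -> F y = g y,
    {for x, continuous F},
    forall v, strict_derivative F x v ('D_v F x) &
    forall v, 'D_v F x = 0 -> v = 0].
Proof.
move=> [sm im] xT; have [F [U [Uo Ux sF FE]]] := sm x xT.
exists F; split.
- have : \forall y \near x, U y by move: Uo; rewrite openE => /(_ x Ux).
  by move=> /near_normP[r r0 h]; exists r => // y /h; exact: FE.
- by have [+ _] := sF 0%N; apply.
- move=> v; have [_ /(_ v)[dF [+ _]]] := sF 1%N => dc.
  by apply: (C1_strict_target Uo Ux dF); exact: dc.
- by apply: im => //; exists U; split.
Qed.

Variable g : source -> target.
Hypothesis g_emb : smooth_embedding g.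
Hypothesis g_level : forall p t u, 0 <= t <= 1 -> (g (p, t, u)).1.2 = t.
Hypothesis g_fiber : forall p t, 0 <= t <= 1 ->
  exists q, forall u, Defs.proj (g (p, t, u)) = q.

(** Clamping the level makes the family continuous for all real [t], constant below 0 and above 1.
    The fiber parameter 0 is an arbitrary choice, by [baseE]. *)
Definition base (p t : R) : R * R := (g (p, clamp t, 0)).1.1.
Definition fiber (p t u : R) : R * R := (g (p, clamp t, u)).2.

Let clampT (x : source) : source := (x.1.1, clamp x.1.2, x.2).

Lemma baseE p t u : (g (p, clamp t, u)).1.1 = base p t.
Proof. by have [q h] := g_fiber p (clamp_range t); rewrite /base -!/(Defs.proj _) !h. Qed.

Lemma base_periodic p t : base (p + 1) t = base p t.
Proof. by rewrite /base (embedding_periodic_base g_emb) // clamp_range. Qed.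

Lemma fiber_periodic_base p t u : fiber (p + 1) t u = fiber p t u.
Proof. by rewrite /fiber (embedding_periodic_base g_emb) // clamp_range. Qed.

Lemma fiber_periodic p t u : fiber p t (u + 1) = fiber p t u.
Proof. by rewrite /fiber (embedding_periodic_fiber g_emb) // clamp_range. Qed.

(** For [p = q] this says that each fiber circle is a simple closed curve. *)
Lemma fiber_disjoint p q t u v : base p t = base q t ->
  fiber p t u = fiber q t v -> circle_eq p q /\ circle_eq u v.
Proof.
move=> bE fE; have [] // := @embedding_injective _ g g_emb p (clamp t) u q (clamp t) v.
- exact: clamp_range.
- exact: clamp_range.
rewrite [LHS]surjective_pairing [RHS]surjective_pairing; congr (_, _) => //.
rewrite [LHS]surjective_pairing [RHS]surjective_pairing; congr (_, _).
  by rewrite !baseE.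
by rewrite !g_level ?clamp_range.
Qed.

Lemma clampT_near (x y : source) : `|clampT y - clampT x| <= `|y - x|.
Proof.
have clamp_near (s t : R) : `|clamp s - clamp t| <= `|s - t|.
  rewrite /clamp; case: (ler0P s) => h1; case: (ler0P (s - 1)) => h2;
  case: (ler0P t) => h3; case: (ler0P (t - 1)) => h4;
  rewrite ler_norml; case: (ler0P (s - t)) => h5; apply/andP; split; lra.
rewrite !prod_normE /= !ge_max !le_max lexx lexx /= orbT.
by rewrite clamp_near !orbT.
Qed.

Lemma clampT_torus (x : source) : thick_torus (clampT x).
Proof. exact: clamp_range. Qed.

Lemma continuous_torus : continuous (fun x : source => g (clampT x)).
Proof.
move=> x; have [F [[r r0 FE] cF _ _]] := immersion_local (embedding_immersion g_emb) (clampT_torus x).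
apply/cvgrPdist_lt => e e0; move/cvgrPdist_lt: cF => /(_ e e0)/near_normP[d d0 hd].
suff near_x : \forall y \near x, `|g (clampT x) - g (clampT y)| < e by exact: near_x.
apply/near_normP; exists (Num.min r d); first by rewrite lt_min r0.
move=> y; rewrite lt_min => /andP[yr yd].
rewrite -FE ?subrr ?normr0 //; last exact: clampT_torus.
rewrite -FE; last exact: clampT_torus.
  by apply: hd; apply: le_lt_trans yd; exact: clampT_near.
by apply: le_lt_trans yr; exact: clampT_near.
Qed.

Lemma continuous_base : continuous (fun z : R * R => base z.1 z.2).
Proof.
apply: (@continuous_compose _ _ _ (fun z : R * R => g (z.1, clamp z.2, 0)) (fun x => x.1.1)).
  apply: (@continuous_compose _ _ _ (fun z : R * R => (z, 0 : R)) (fun x => g (clampT x))).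
    by apply: continuous_pairing => x; [exact: cvg_id|exact: cvg_cst].
  exact: continuous_torus.
apply: continuous_fst; apply: (@continuous_fst _ _ _ id) => x; exact: cvg_id.
Qed.

Lemma continuous_fiber : continuous (fun z : source => fiber z.1.1 z.1.2 z.2).
Proof.
apply: (@continuous_compose _ _ _ (fun z : source => g (clampT z)) (fun x => x.2)).
  exact: continuous_torus.
apply: (@continuous_snd _ _ _ id) => x; exact: cvg_id.
Qed.

(** Within a level, the derivative of [g] along the base circle is [(w, A)] and along the fiber
    circle [(0, B)], since fibers lie over points. If [w] vanishes, injectivity of the differential
    makes [A] and [B] independent. *)
Lemma torus_derivatives p0 t0 u0 : exists (w A B : R * R), [/\
  forall e : R, 0 < e -> exists2 d : R, 0 < d & forall p t h : R,
    `|p - p0| < d -> `|t - t0| < d -> `|h| < d ->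
    `|base (p + h) t - base p t - h *: w| <= e * `|h|,
  forall e : R, 0 < e -> exists2 d : R, 0 < d & forall p t u h : R,
    `|p - p0| < d -> `|t - t0| < d -> `|u - u0| < d -> `|h| < d ->
    `|fiber (p + h) t u - fiber p t u - h *: A| <= e * `|h|,
  forall e : R, 0 < e -> exists2 d : R, 0 < d & forall p t u h : R,
    `|p - p0| < d -> `|t - t0| < d -> `|u - u0| < d -> `|h| < d ->
    `|fiber p t (u + h) - fiber p t u - h *: B| <= e * `|h| &
  w <> 0 \/ det2 A B != 0].
Proof.
pose x : source := (p0, clamp t0, u0).
have [F [[r r0 FE] cF sF im]] := @immersion_local g x (embedding_immersion g_emb) (clamp_range t0).
pose e1 : source := (1, 0, 0); pose e2 : source := (0, 0, 1).
set wp := 'D_e1 F x; set wu := 'D_e2 F x.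
(* Directions without level component keep points inside the thick torus, where the extension [F]
   equals [g], also at the boundary levels. *)
have st (v : source) : v.1.2 = 0 -> `|v| <= 1 ->
    forall e : R, 0 < e -> exists2 d : R, 0 < d & forall p t u h : R,
    `|p - p0| < d -> `|t - t0| < d -> `|u - u0| < d -> `|h| < d ->
    `|g (p + h * v.1.1, clamp t, u + h * v.2) - g (p, clamp t, u) - h *: 'D_v F x| <= e * `|h|.
  move=> v0 v1 e e0; have [d d0 hd] := sF v e e0.
  exists (Num.min (r / 2) d); first by rewrite lt_min d0 divr_gt0.
  move=> p t u h; rewrite !lt_min => /andP[pr pd] /andP[tr td] /andP[ur ud] /andP[hr hhd].
  pose z : source := (p, clamp t, u).
  have zx (c : R) : `|p - p0| < c -> `|t - t0| < c -> `|u - u0| < c -> `|z - x| < c.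
    move=> h1 h2 h3; apply: le_lt_trans (@clampT_near (p0, t0, u0) (p, t, u)) _.
    by rewrite !prod_normE /= !gt_max h1 h2 h3.
  have zr := zx _ pr tr ur.
  have zhE : z + h *: v = (p + h * v.1.1, clamp t, u + h * v.2).
    case: v v0 {v1 hd} => [[va vb] vc] /= ->; rewrite /z.
    by rewrite -[LHS]/(p + h * va, clamp t + h * 0, u + h * vc) mulr0 addr0.
  rewrite -zhE -!FE; first exact: hd (zx _ pd td ud) hhd.
  - by apply: lt_trans zr _; lra.
  - exact: clamp_range.
  - rewrite addrAC; apply: le_lt_trans (ler_normD _ _) _; rewrite normrZ.
    have hv : `|h| * `|v| <= `|h| by rewrite ler_piMr.
    by apply: le_lt_trans (lerD (ltW zr) hv) _; lra.
  - by rewrite zhE; exact: clamp_range.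
have n1 : `|e1| <= 1 by rewrite !prod_normE /= !ge_max normr1 normr0 lexx ler01.
have n2 : `|e2| <= 1 by rewrite !prod_normE /= !ge_max normr1 normr0 lexx ler01.
have s1 := st e1 erefl n1; have s2 := st e2 erefl n2.
have Dab (a b : R) : 'D_(a *: e1 + b *: e2) F x = a *: wp + b *: wu.
  exact: strict_derivative_add (sF e1) (sF e2).
rewrite -/wp in s1; rewrite -/wu in s2.
clearbody wp wu.
have le1 (y : target) : `|y.1.1| <= `|y| := le_trans (norm_fst_le y.1) (norm_fst_le y).
have le12 (y : target) : `|y.1.2| <= `|y| := le_trans (norm_snd_le y.1) (norm_fst_le y).
exists wp.1.1, wp.2, wu.2; split.
- move=> e e0; have [d d0 hd] := s1 e e0; exists d => // p t h pd td hh.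
  have u0d : `|u0 - u0| < d by rewrite subrr normr0.
  have := hd p t u0 h pd td u0d hh; rewrite /= mulr0 addr0 mulr1.
  apply: le_trans; rewrite -(baseE (p + h) t u0) -(baseE p t u0).
  exact: (le1 (g _ - g _ - h *: wp)).
- move=> e e0; have [d d0 hd] := s1 e e0; exists d => // p t u h pd td ud hh.
  have := hd p t u h pd td ud hh; rewrite /= mulr0 addr0 mulr1.
  by apply: le_trans; exact: (norm_snd_le (g _ - g _ - h *: wp)).
- move=> e e0; have [d d0 hd] := s2 e e0; exists d => // p t u h pd td ud hh.
  have := hd p t u h pd td ud hh; rewrite /= mulr0 addr0 mulr1.
  by apply: le_trans; exact: (norm_snd_le (g _ - g _ - h *: wu)).
apply: contrapT => /not_orP[/contrapT w0 /negP/negPn/eqP AB].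
have pp d : 0 < d -> `|p0 - p0| < d by rewrite subrr normr0.
have tt d : 0 < d -> `|t0 - t0| < d by rewrite subrr normr0.
have uu d : 0 < d -> `|u0 - u0| < d by rewrite subrr normr0.
have small (W : normedModType R) (w : W) : (forall e : R, 0 < e ->
    exists2 d : R, 0 < d & forall h : R, `|h| < d -> `|h *: w| <= e * `|h|) -> w = 0.
  move=> hw; apply/eqP/negPn/negP => wn0.
  have wpos : 0 < `|w| by rewrite normr_gt0.
  have [|d d0 hd] := hw (`|w| / 2); first by rewrite divr_gt0.
  have := hd (d / 2); rewrite gtr0_norm ?divr_gt0 // normrZ gtr0_norm ?divr_gt0 //.
  have dd : d / 2 < d by lra.
  by move=> /(_ dd); rewrite mulrC ler_pM2r ?divr_gt0 //; lra.
have wp12 : wp.1.2 = 0.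
  apply: small => e e0; have [d d0 hd] := s1 e e0; exists d => // h hh.
  have := hd _ _ _ _ (pp _ d0) (tt _ d0) (uu _ d0) hh.
  rewrite /= mulr0 addr0 mulr1; apply: le_trans; apply: le_trans (le12 (g _ - g _ - h *: wp)).
  by rewrite /= !g_level ?clamp_range // subrr sub0r normrN.
have wu1 : wu.1 = 0.
  apply: small => e e0; have [d d0 hd] := s2 e e0; exists d => // h hh.
  have := hd _ _ _ _ (pp _ d0) (tt _ d0) (uu _ d0) hh.
  rewrite /= mulr0 addr0 mulr1; apply: le_trans; apply: le_trans (norm_fst_le (g _ - g _ - h *: wu)).
  have [q hq] := g_fiber p0 (clamp_range t0).
  rewrite -[X in _ <= `|X|]/((Defs.proj (g _) - Defs.proj (g _)) - h *: wu.1).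
  by rewrite !hq subrr sub0r normrN.
have dir (a b : R) : a *: wp.2 + b *: wu.2 = 0 -> a = 0 /\ b = 0.
  move=> ab; have : a *: e1 + b *: e2 = 0.
    apply: im; rewrite Dab; case: wp w0 wp12 wu1 ab {s1 Dab AB} => [[x1 x2] x3] /= -> ->.
    case: wu {s2} => x4 x5 /= -> ab.
    rewrite -[LHS]/((a *: (0 : R * R * R) + b *: (0 : R * R * R)), a *: x3 + b *: x5) ab.
    by rewrite !scaler0 addr0.
  by move=> [] /=; rewrite /= !scale_mul; lra.
by have := det2_independent dir; rewrite AB eqxx.
Qed.

End EmbeddedTorus.

(** * Unlinked fibers *)

Section CircleEq.
Variable R : realType.
Implicit Types p q r : R.

Lemma circle_eqP p q : circle_eq p q <-> exists k : int, p = q + k%:~R.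
Proof.
split=> [/intrP[k pq]|[k ->]]; first by exists k; rewrite -pq addrC subrK.
by apply/intrP; exists k; rewrite addrC addKr.
Qed.

Lemma circle_eq_refl p : circle_eq p p.
Proof. by apply/circle_eqP; exists 0; rewrite addr0. Qed.

Lemma circle_eq_sym p q : circle_eq p q -> circle_eq q p.
Proof. by rewrite /circle_eq -opprB rpredN. Qed.

Lemma circle_eq_trans p q r : circle_eq p q -> circle_eq q r -> circle_eq p r.
Proof. by rewrite /circle_eq => pq qr; rewrite -(subrKA q) rpredD. Qed.

Lemma circle_eqD1 p : circle_eq (p + 1) p.
Proof. by apply/circle_eqP; exists 1. Qed.

Lemma circle_eq_lt1 p q : circle_eq p q -> `|p - q| < 1 -> p = q.
Proof.
move=> /circle_eqP[k ->]; rewrite addrAC subrr add0r -intr_norm.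
rewrite -[1]/(1%:~R) ltr_int => k1; suff -> : k = 0 by rewrite addr0.
by lia.
Qed.

Lemma periodic_circle_eq (Y : Type) (f : R -> Y) p q :
  (forall p, f (p + 1) = f p) -> circle_eq p q -> f p = f q.
Proof. by move=> f1 /circle_eqP[k ->]; rewrite int_periodic. Qed.

End CircleEq.

Section LinearApproximation.
Variable R : realType.

Lemma near_quotient_dot (a : R * R) : a != 0 -> exists2 r : R, 0 < r &
  forall (x z : R * R) (h : R), `|x - a| < r -> h != 0 ->
    `|z - h *: a| <= r * `|h| -> 0 < dot x (h^-1 *: z).
Proof.
move=> a0.
have c : continuous (fun y : (R * R) * (R * R) => dot y.1 y.2).
  by apply: continuous_dot => y; [exact: cvg_fst|exact: cvg_snd].
have := c (a, a); move=> /cvgr_gt /(_ 0 (dot_gt0 a0)) => near_a.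
have /near_normP[r r0 hr] : \forall y \near ((a, a) : (R * R) * (R * R)), 0 < dot y.1 y.2.
  exact: near_a.
exists (r / 2); first by rewrite divr_gt0.
move=> x z h xa h0 zh; apply: (hr (x, h^-1 *: z)).
rewrite prod_normE /= gt_max; apply/andP; split.
  by apply: lt_le_trans xa _; rewrite ler_piMr ?ltW // invf_lt1 ?ltr1n.
have -> : h^-1 *: z - a = h^-1 *: (z - h *: a).
  by rewrite scalerBr scalerA mulVf // scale1r.
rewrite pair_normZ normfV mulrC ltr_pdivrMr ?normr_gt0 //.
apply: le_lt_trans zh _; rewrite ltr_pM2r ?normr_gt0 //; lra.
Qed.

Lemma approximation_unique (z : R -> R * R) (a a' : R * R) (e e' d d' : R) :
  0 < d -> 0 < d' ->
  (forall h, `|h| < d -> `|z h - h *: a| <= e * `|h|) ->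
  (forall h, `|h| < d' -> `|z h - h *: a'| <= e' * `|h|) -> `|a - a'| <= e + e'.
Proof.
move=> d0 d'0 ha ha'; pose h := Num.min d d' / 2.
have h0 : 0 < h by rewrite divr_gt0 // lt_min d0.
have : h < Num.min d d' by rewrite ltr_pdivrMr // ltr_pMr ?ltr1n // lt_min d0.
rewrite lt_min => /andP[hd hd'].
have nh : `|h| = h by rewrite gtr0_norm.
have := ha h; have := ha' h; rewrite nh => /(_ hd') h1 /(_ hd) h2.
rewrite -(ler_pM2l h0) -{1}nh -pair_normZ.
have -> : h *: (a - a') = (z h - h *: a') - (z h - h *: a).
  by rewrite scalerBr opprB [RHS]addrC subrKA.
by apply: le_trans (ler_normB _ _) _; rewrite mulrC mulrDl addrC lerD.
Qed.

(** Difference quotients make an acute angle with the derivative, for all [u] of the compact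
    interval at once; this is the form needed by [null_dot]. *)
Lemma near_quotient (Y : normedModType R) (y0 : Y) (D : R -> R * R)
    (z : R -> Y -> R * R) (k : Y -> R) :
  continuous D -> (forall u, D u != 0) ->
  (forall u0 (e : R), 0 < e -> exists2 d : R, 0 < d & forall u y,
    `|u - u0| < d -> `|y - y0| < d -> `|z u y - k y *: D u0| <= e * `|k y|) ->
  \forall y \near y0, forall u, 0 <= u <= 1 -> k y != 0 ->
    0 < dot (D u) ((k y)^-1 *: z u y).
Proof.
move=> Dc D0 zD.
apply: (near_segment (P := fun u y => k y != 0 -> 0 < dot (D u) ((k y)^-1 *: z u y))).
move=> u0 _; have [r r0 hr] := near_quotient_dot (D0 u0).
have [d d0 hd] := zD u0 r r0.
have := Dc u0; move=> /cvgr_dist_lt /(_ r r0) near_u0.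
have /near_normP[d' d'0 hd'] : \forall u \near u0, `|D u0 - D u| < r by exact: near_u0.
suff near_y : \forall x \near ((u0, y0) : R * Y), k x.2 != 0 ->
    0 < dot (D x.1) ((k x.2)^-1 *: z x.1 x.2) by exact: near_y.
apply/near_normP; exists (Num.min d d'); first by rewrite lt_min d0.
move=> [u y]; rewrite prod_normE /= lt_min !gt_max => /andP[/andP[ud yd] /andP[ud' _]] ky.
by apply: hr => //; [rewrite distrC hd' | exact: hd].
Qed.

Lemma nonzero_sign (g : R -> R) : continuous g -> (forall u, g u != 0) ->
  (forall u, 0 <= u -> 0 < g u) \/ (forall u, 0 <= u -> g u < 0).
Proof.
move=> gc g0.
have ivt u : 0 <= u -> ~ (Num.min (g 0) (g u) <= 0 <= Num.max (g 0) (g u)).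
  move=> u0 /(IVT u0 (continuous_subspaceT gc))[c _ gc0].
  by have := g0 c; rewrite gc0 eqxx.
have [g00|g00|g00] := ltgtP 0 (g 0).
- left=> u u0; rewrite ltNge; apply/negP => gu; apply: (ivt u u0).
  by rewrite ge_min gu orbT le_max ltW.
- right=> u u0; rewrite ltNge; apply/negP => gu; apply: (ivt u u0).
  by rewrite le_max gu orbT ge_min ltW.
- by have := g0 0; rewrite -g00 eqxx.
Qed.

End LinearApproximation.

Section FiberedFamily.
Variable R : realType.
Variables (b : R -> R -> R * R) (f : R -> R -> R -> R * R).
Hypothesis b_cont : continuous (fun z : R * R => b z.1 z.2).
Hypothesis f_cont : continuous (fun z : R * R * R => f z.1.1 z.1.2 z.2).
Hypothesis b_per : forall p t, b (p + 1) t = b p t.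
Hypothesis f_per_base : forall p t u, f (p + 1) t u = f p t u.
Hypothesis f_per : forall p t u, f p t (u + 1) = f p t u.
Hypothesis disjoint : forall p q t u v, b p t = b q t -> f p t u = f q t v ->
  circle_eq p q /\ circle_eq u v.
Hypothesis derivatives : forall p0 t0 u0, exists (w A B : R * R), [/\
  forall e : R, 0 < e -> exists2 d : R, 0 < d & forall p t h : R,
    `|p - p0| < d -> `|t - t0| < d -> `|h| < d ->
    `|b (p + h) t - b p t - h *: w| <= e * `|h|,
  forall e : R, 0 < e -> exists2 d : R, 0 < d & forall p t u h : R,
    `|p - p0| < d -> `|t - t0| < d -> `|u - u0| < d -> `|h| < d ->
    `|f (p + h) t u - f p t u - h *: A| <= e * `|h|,
  forall e : R, 0 < e -> exists2 d : R, 0 < d & forall p t u h : R,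
    `|p - p0| < d -> `|t - t0| < d -> `|u - u0| < d -> `|h| < d ->
    `|f p t (u + h) - f p t u - h *: B| <= e * `|h| &
  w <> 0 \/ det2 A B != 0].

(* Each of the two circles has winding number zero around a point of the other
   one, that is, neither of them is inside the other one. *)
Definition unlinked p q t : Prop := [/\ ~ circle_eq p q, b p t = b q t,
  null (fun u => f p t u - f q t 0) & null (fun u => f q t u - f p t 0)].

Lemma unlinked_sym p q t : unlinked p q t -> unlinked q p t.
Proof. by move=> [pq bE n1 n2]; split=> // /circle_eq_sym. Qed.

Lemma unlinked_per p q t : unlinked (p + 1) q t = unlinked p q t.
Proof.
have fE : f (p + 1) t = f p t by apply/funext => u; rewrite f_per_base.
apply/propext; rewrite /unlinked fE b_per; split=> -[pq bE n1 n2]; split=> //.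
  by apply: contra_not pq; apply: circle_eq_trans; exact: circle_eqD1.
apply: contra_not pq; apply: circle_eq_trans; apply: circle_eq_sym; exact: circle_eqD1.
Qed.

Lemma continuous_f (T : topologicalType) (p t u : T -> R) : continuous p ->
  continuous t -> continuous u -> continuous (fun y => f (p y) (t y) (u y)).
Proof.
move=> cp ct cu; apply: (@continuous_compose _ _ _ (fun y => (p y, t y, u y)) _ _ f_cont).
by apply: continuous_pairing => //; exact: continuous_pairing.
Qed.

Lemma continuous_f_sub (T : topologicalType) (p q t u v : T -> R) : continuous p ->
  continuous q -> continuous t -> continuous u -> continuous v ->
  continuous (fun y => f (p y) (t y) (u y) - f (q y) (t y) (v y)).
Proof. by move=> cp cq ct cu cv y; apply: cvgB; exact: continuous_f. Qed.

Lemma near_dot (X : topologicalType) (y : X) (h : R * X -> R * R) :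
  continuous h -> (forall u, 0 <= u <= 1 -> h (u, y) != 0) ->
  \forall z \near y, forall u, 0 <= u <= 1 -> 0 < dot (h (u, y)) (h (u, z)).
Proof.
move=> ch h0; apply: (near_segment (P := fun u z => 0 < dot (h (u, y)) (h (u, z)))).
move=> u u01.
have c : continuous (fun x : R * X => dot (h (x.1, y)) (h x)).
  apply: continuous_dot => //; apply: continuous_compose ch.
  by apply: continuous_pairing => x; [exact: cvg_fst|exact: cvg_cst].
have := c (u, y); move=> /cvgr_gt /(_ 0 (dot_gt0 (h0 u u01))).
by apply: filterS => -[].
Qed.

Let idc (T : topologicalType) : continuous (fun x : T => x).
Proof. by move=> x; exact: cvg_id. Qed.

Let cstc (T : topologicalType) (c : R) : continuous (fun _ : T => c).
Proof. by move=> x; exact: cvg_cst. Qed.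

Lemma sep p q t u v : ~ circle_eq p q -> b p t = b q t -> f p t u - f q t v != 0.
Proof. by move=> pq bE; rewrite subr_eq0; apply/eqP => /(disjoint bE)[]. Qed.

(** The two loops are nowhere zero at the given double point, so at nearby triples they make acute
    angles with the given ones, and nullness passes both ways. *)
Lemma unlinked_near p q t : ~ circle_eq p q -> b p t = b q t ->
  \forall y \near (p, q, t), b y.1.1 y.2 = b y.1.2 y.2 ->
    (unlinked y.1.1 y.1.2 y.2 <-> unlinked p q t).
Proof.
move=> pq bE; have qp : ~ circle_eq q p by move/circle_eq_sym.
pose h1 (x : R * (R * R * R)) := f x.2.1.1 x.2.2 x.1 - f x.2.1.2 x.2.2 0.
pose h2 (x : R * (R * R * R)) := f x.2.1.2 x.2.2 x.1 - f x.2.1.1 x.2.2 0.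
have uc := continuous_fst (@idc (R * (R * R * R))%type).
have yc := continuous_snd (@idc (R * (R * R * R))%type).
have tc := continuous_snd yc.
have pc := continuous_fst (continuous_fst yc); have qc := continuous_snd (continuous_fst yc).
have c1 : continuous h1.
  exact: (continuous_f_sub pc qc tc uc (@cstc _ 0)).
have c2 : continuous h2.
  exact: (continuous_f_sub qc pc tc uc (@cstc _ 0)).
have n1 := @near_dot _ (p, q, t) h1 c1 (fun u _ => sep u 0 pq bE).
have n2 := @near_dot _ (p, q, t) h2 c2 (fun u _ => sep u 0 qp (esym bE)).
apply: filterS2 n1 n2 => -[[p' q'] t'] /= d1 d2 bE'.
have loop x y s : f x s 0 - f y s 0 = f x s 1 - f y s 0.
  by rewrite -[1]add0r f_per.
have dotC (v w : R * R) : dot v w = dot w v by rewrite /dot; ring.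
have cf x y s : continuous (fun u : R => f x s u - f y s 0).
  by apply: continuous_f_sub => //; exact: cstc.
split=> -[pq' _ m1 m2]; split=> //.
- apply: (null_dot (cf _ _ _) (cf _ _ _) (loop _ _ _) (loop _ _ _) _ m1) => u /d1.
  by rewrite /h1 /= dotC.
- apply: (null_dot (cf _ _ _) (cf _ _ _) (loop _ _ _) (loop _ _ _) _ m2) => u /d2.
  by rewrite /h2 /= dotC.
(* If the nearby parameters named the same point of the circle, the nearby loop would vanish at
   [u = 0], against the acute angle. *)
- move=> pq1; have /d1 : 0 <= (0 : R) <= 1 by rewrite lexx ler01.
  rewrite /h1 /= (periodic_circle_eq (f := fun x => f x t' 0) _ pq1) //.
  by rewrite subrr /dot /= !mulr0 addr0 ltxx.
- by apply: (null_dot (cf _ _ _) (cf _ _ _) (loop _ _ _) (loop _ _ _) _ m1) => u /d1.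
- by apply: (null_dot (cf _ _ _) (cf _ _ _) (loop _ _ _) (loop _ _ _) _ m2) => u /d2.
Qed.

(* If circles close to the given one were unlinked, then the loop of their
   differences would be null, hence also its direction A, and the independent
   tangent direction B of the circle. *)
Lemma tangent_linked (p0 t0 : R) (A B : R -> R * R) :
  (forall u0, [/\ forall e : R, 0 < e -> exists2 d : R, 0 < d & forall p t u h : R,
    `|p - p0| < d -> `|t - t0| < d -> `|u - u0| < d -> `|h| < d ->
    `|f (p + h) t u - f p t u - h *: A u0| <= e * `|h|,
  forall e : R, 0 < e -> exists2 d : R, 0 < d & forall p t u h : R,
    `|p - p0| < d -> `|t - t0| < d -> `|u - u0| < d -> `|h| < d ->
    `|f p t (u + h) - f p t u - h *: B u0| <= e * `|h| &
  det2 (A u0) (B u0) != 0]) ->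
  \forall y \near (p0, p0, t0), ~ unlinked y.1.1 y.1.2 y.2.
Proof.
move=> AB.
(* Continuity of [A] and [B] follows from the estimates: near [u0] both [D u0] and [D u] approximate
   the same increments. *)
have cont (z : R -> R -> R * R) (D : R -> R * R) :
    (forall u0 (e : R), 0 < e -> exists2 d : R, 0 < d & forall u h : R,
      `|u - u0| < d -> `|h| < d -> `|z u h - h *: D u0| <= e * `|h|) -> continuous D.
  move=> zD u0; apply/cvgrPdist_le => e e0.
  have e2 : 0 < e / 2 by rewrite divr_gt0.
  have [d d0 hd] := zD u0 _ e2.
  suff near_u0 : \forall u \near u0, `|D u0 - D u| <= e by exact: near_u0.
  apply/near_normP; exists d => // u ud; have [d' d'0 hd'] := zD u _ e2.
  rewrite [e]splitr; apply: (approximation_unique (z := z u) d0 d'0) => h hh.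
    exact: hd.
  by apply: hd' => //; rewrite subrr normr0.
have per (z : R -> R -> R * R) (D : R -> R * R) : (forall u h, z (u + 1) h = z u h) ->
    (forall u0 (e : R), 0 < e -> exists2 d : R, 0 < d & forall u h : R,
      `|u - u0| < d -> `|h| < d -> `|z u h - h *: D u0| <= e * `|h|) ->
    forall u, D u = D (u + 1).
  move=> z1 zD u; apply/eqP; rewrite -subr_eq0 -normr_le0; apply/ler_addgt0Pr => e e0.
  have e2 : 0 < e / 2 by rewrite divr_gt0.
  have [d d0 hd] := zD u _ e2; have [d' d'0 hd'] := zD (u + 1) _ e2.
  rewrite add0r [e]splitr; apply: (approximation_unique (z := z u) d0 d'0) => h hh.
    by apply: hd => //; rewrite subrr normr0.
  by rewrite -z1; apply: hd' => //; rewrite subrr normr0.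
have zA u0 (e : R) : 0 < e -> exists2 d : R, 0 < d & forall u h : R,
    `|u - u0| < d -> `|h| < d -> `|f (p0 + h) t0 u - f p0 t0 u - h *: A u0| <= e * `|h|.
  move=> e0; have [/(_ e e0)[d d0 hd] _ _] := AB u0; exists d => // u h ud hh.
  by apply: hd; rewrite ?subrr ?normr0.
have zB u0 (e : R) : 0 < e -> exists2 d : R, 0 < d & forall u h : R,
    `|u - u0| < d -> `|h| < d -> `|f p0 t0 (u + h) - f p0 t0 u - h *: B u0| <= e * `|h|.
  move=> e0; have [_ /(_ e e0)[d d0 hd] _] := AB u0; exists d => // u h ud hh.
  by apply: hd; rewrite ?subrr ?normr0.
have cA := cont _ _ zA; have cB := cont _ _ zB.
have pA : forall u, A u = A (u + 1).
  by apply: (per _ _ _ zA) => u h; rewrite !f_per.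
have pB : forall u, B u = B (u + 1).
  by apply: (per _ _ _ zB) => u h; rewrite addrAC !f_per.
have A01 : A 0 = A 1 by rewrite pA add0r.
have B01 : B 0 = B 1 by rewrite pB add0r.
have det0 u : det2 (A u) (B u) != 0 by have [] := AB u.
have A0 u : A u != 0.
  by apply: contra (det0 u) => /eqP ->; rewrite /det2 !mul0r subrr.
have B0 u : B u != 0.
  by apply: contra (det0 u) => /eqP ->; rewrite /det2 !mulr0 subrr.
have dotZ (v w : R * R) (k : R) : dot v (k *: w) = k * dot v w.
  by rewrite /dot /= !scale_mul; ring.
have cf (p t : R) : continuous (f p t).
  exact: (continuous_f (@cstc _ p) (@cstc _ t) (@idc R)).
have nB : ~ null B.
  have zB0 u0 (e : R) : 0 < e -> exists2 d : R, 0 < d & forall u h : R,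
      `|u - u0| < d -> `|h - 0| < d ->
      `|f p0 t0 (u + h) - f p0 t0 u - h *: B u0| <= e * `|h|.
    move=> e0; have [d d0 hd] := zB u0 e e0; exists d => // u h ud.
    by rewrite subr0; exact: hd.
  have /near_normP[e e0 he] := near_quotient (k := fun h : R => h) cB B0 zB0.
  pose h := Num.min e 2^-1 / 2.
  have m0 : 0 < Num.min e 2^-1 by rewrite lt_min e0 invr_gt0 /=.
  have h0 : 0 < h by rewrite divr_gt0.
  have : h < Num.min e 2^-1 by rewrite ltr_pdivrMr // ltr_pMr ?ltr1n.
  rewrite lt_min => /andP[h1 h2].
  apply: (tangent_not_null (f := f p0 t0) (e := h)) => //.
  - move=> u s /andP[s0 s1] /(disjoint erefl)[_ /circle_eq_lt1].
    by rewrite addrAC subrr add0r gtr0_norm // => /(_ s1); lra.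
  - by rewrite h0.
  move=> u u01; have := he h; rewrite subr0 gtr0_norm // => /(_ h1 u u01).
  rewrite gt_eqF // => /(_ isT); rewrite /= dotZ => d0.
  by rewrite -(pmulr_rgt0 _ (_ : 0 < h^-1)) ?invr_gt0.
(* The inner product of [A] turned by a right angle with [B] is [det2 (A u) (B u)], of constant
   sign; so if [A] were null, [B] or [- B] would be too. *)
have nA : ~ null A.
  move=> /null_rot nR; pose A' u : R * R := (- (A u).2, (A u).1).
  have A'c : continuous A'.
    apply: continuous_pairing; last exact: continuous_fst.
    by move=> u; apply: cvgN; exact: continuous_snd.
  have A'01 : A' 0 = A' 1 by rewrite /A' A01.
  have dc : continuous (fun u => det2 (A u) (B u)) by exact: continuous_det2.
  have dE u : dot (A' u) (B u) = det2 (A u) (B u) by rewrite /dot /det2 /=; ring.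
  have [pos|neg] := nonzero_sign dc det0; apply: nB.
    by apply: (null_dot A'c cB A'01 B01 _ nR) => u /andP[u0 _]; rewrite dE pos.
  have NB01 : - B 0 = - B 1 by rewrite B01.
  have NBc : continuous (fun u => - B u) by move=> u; apply: cvgN; exact: cB.
  have dN u : dot (A' u) (- B u) = - det2 (A u) (B u) by rewrite -dE /dot /=; ring.
  have /nullN : null (fun u => - B u).
    by apply: (null_dot A'c NBc A'01 NB01 _ nR) => u /andP[u0 _]; rewrite dN oppr_gt0 neg.
  by apply: eq_null => u _; rewrite opprK.
have zA0 u0 (e : R) : 0 < e -> exists2 d : R, 0 < d & forall (u : R) (y : R * R * R),
    `|u - u0| < d -> `|y - (p0, p0, t0)| < d ->
    `|f y.1.1 y.2 u - f y.1.2 y.2 u - (y.1.1 - y.1.2) *: A u0| <= e * `|y.1.1 - y.1.2|.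
  move=> e0; have [/(_ e e0)[d d0 hd] _ _] := AB u0.
  exists (d / 2); first by rewrite divr_gt0.
  move=> u [[p q] t] ud; rewrite !prod_normE /= !gt_max => /andP[/andP[pd qd] td].
  have dd : d / 2 < d by lra.
  have := hd q t u (p - q) (lt_trans qd dd) (lt_trans td dd) (lt_trans ud dd).
  rewrite [q + _]addrC subrK; apply.
  rewrite -(subrKA p0); apply: le_lt_trans (ler_normD _ _) _.
  by rewrite [X in _ + X]distrC [d]splitr ltrD.
have := near_quotient (k := fun y : R * R * R => y.1.1 - y.1.2) cA A0 zA0.
apply: filterS => -[[p q] t] /= quot [pq bE n1 n2]; apply: nA.
have pq0 : p - q != 0.
  by rewrite subr_eq0; apply/eqP => pqE; apply: pq; rewrite pqE; exact: circle_eq_refl.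
pose h (x : R * R) := f p t x.1 - f q t x.2.
have hc : continuous h.
  exact: (continuous_f_sub (@cstc _ p) (@cstc _ q) (@cstc _ t)
    (continuous_fst (@idc (R * R)%type)) (continuous_snd (@idc (R * R)%type))).
(* The diagonal of the map from the torus formed by the differences of points of the two circles;
   being unlinked makes both of its factor loops null. *)
have nD : null (fun u => f p t u - f q t u).
  apply: (null_diagonal hc); rewrite /h /=.
  - by move=> x _ _; exact: sep.
  - by move=> u _; rewrite -[in RHS](add0r 1) f_per.
  - exact: n1.
  by apply: (eq_null _ (nullN n2)) => u _; rewrite opprB.
have dotC (v w : R * R) : dot v w = dot w v by rewrite /dot; ring.
have Dc : continuous (fun u => f p t u - f q t u).
  exact: (continuous_f_sub (@cstc _ p) (@cstc _ q) (@cstc _ t) (@idc R) (@idc R)).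
have D01 : f p t 0 - f q t 0 = f p t 1 - f q t 1 by rewrite -[1]add0r !f_per.
have [pq1|pq1|pq1] := ltgtP 0 (p - q); last by rewrite -pq1 eqxx in pq0.
  apply: (null_dot Dc cA D01 A01 _ nD) => u u01.
  rewrite dotC -(pmulr_rgt0 _ (_ : 0 < (p - q)^-1)) ?invr_gt0 // -dotZ.
  exact: quot.
have NDc : continuous (fun u => - (f p t u - f q t u)) by move=> u; apply: cvgN; exact: Dc.
apply: (null_dot NDc cA _ A01 _ (nullN nD)) => [|u u01]; first by rewrite D01.
rewrite dotC -(pmulr_rgt0 _ (_ : 0 < - (p - q)^-1)) ?oppr_gt0 ?invr_lt0 //.
by rewrite -dotZ scalerN scaleNr opprK; exact: quot.
Qed.

Lemma unlinked_diagonal (p0 t0 : R) : \forall y \near (p0, p0, t0), ~ unlinked y.1.1 y.1.2 y.2.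
Proof.
have [reg|nreg] := pselect (exists w, w <> 0 /\ forall e : R, 0 < e ->
    exists2 d : R, 0 < d & forall p t h : R,
    `|p - p0| < d -> `|t - t0| < d -> `|h| < d ->
    `|b (p + h) t - b p t - h *: w| <= e * `|h|).
  have [w [/eqP w0 wst]] := reg.
  have w2 : 0 < `|w| / 2 by rewrite divr_gt0 // normr_gt0.
  have [d d0 hd] := wst _ w2.
  suff near_y : \forall y \near (p0, p0, t0), ~ unlinked y.1.1 y.1.2 y.2 by exact: near_y.
  apply/near_normP; exists (d / 2); first by rewrite divr_gt0.
  move=> [[p q] t]; rewrite !prod_normE /= !gt_max => /andP[/andP[pd qd] td] [pq bE _ _].
  have dd : d / 2 < d by lra.
  have hpq : `|p - q| < d.
    rewrite -(subrKA p0); apply: le_lt_trans (ler_normD _ _) _.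
    by rewrite [X in _ + X]distrC [d]splitr ltrD.
  have := hd q t (p - q) (lt_trans qd dd) (lt_trans td dd) hpq.
  rewrite [q + _]addrC subrK bE subrr sub0r normrN pair_normZ mulrC.
  rewrite ler_pM2r; last first.
    rewrite normr_gt0 subr_eq0; apply/eqP => pqE; apply: pq; rewrite pqE.
    exact: circle_eq_refl.
  by apply/negP; rewrite -ltNge; lra.
(* A base velocity at [(p0, t0)] does not involve [u0]: if none is nonzero, the independent
   alternative holds at every point of the fiber. *)
have /choice[AB hAB] : forall u0, exists D : (R * R) * (R * R), [/\
    forall e : R, 0 < e -> exists2 d : R, 0 < d & forall p t u h : R,
    `|p - p0| < d -> `|t - t0| < d -> `|u - u0| < d -> `|h| < d ->
    `|f (p + h) t u - f p t u - h *: D.1| <= e * `|h|,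
  forall e : R, 0 < e -> exists2 d : R, 0 < d & forall p t u h : R,
    `|p - p0| < d -> `|t - t0| < d -> `|u - u0| < d -> `|h| < d ->
    `|f p t (u + h) - f p t u - h *: D.2| <= e * `|h| &
  det2 D.1 D.2 != 0].
  move=> u0; have [w [A [B [hw hA hB det0]]]] := derivatives p0 t0 u0.
  exists (A, B); split=> //; case: det0 => // w0.
  by exfalso; apply: nreg; exists w.
exact: (tangent_linked hAB).
Qed.

(** When [p] and [q] name the same point, an integer shift leads to the diagonal, near which no
    triple is unlinked; both sides of the equivalence are then false. *)
Lemma unlinked_local (p q t : R) : b p t = b q t ->
  \forall y \near (p, q, t), b y.1.1 y.2 = b y.1.2 y.2 ->
    (unlinked y.1.1 y.1.2 y.2 <-> unlinked p q t).
Proof.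
move=> bE; have [pq|] := pselect (circle_eq p q); last by move=> pq; exact: unlinked_near.
have [k pE] := (circle_eqP p q).1 pq.
have diag : \forall y \near (q, q, t), ~ unlinked y.1.1 y.1.2 y.2.
  exact: unlinked_diagonal.
have {diag} /near_normP[e e0 he] := diag.
suff near_y : \forall y \near (p, q, t), ~ unlinked y.1.1 y.1.2 y.2.
  by apply: filterS near_y => y ny _; split=> [//|[]].
apply/near_normP; exists e => // -[[p' q'] t'] ye.
rewrite -(int_periodic (f := fun p => unlinked p q' t') _ (- k)); last first.
  by move=> r; exact: unlinked_per.
apply: (he (p' + (- k)%:~R, q', t')); move: ye.
rewrite !prod_normE /= !gt_max pE.
by have -> : p' + (- k)%:~R - q = p' - (q + k%:~R) by rewrite rmorphN /=; ring.
Qed.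

End FiberedFamily.

(** * Parameters of the crossings *)

Section CrossingParameters.
Variable R : realType.

Lemma avoid_seq (l : seq R) (c d : R) : c < d -> exists2 a, c < a < d & a \notin l.
Proof.
elim: l c d => [|x l IH] c d cd; first by exists ((c + d) / 2) => //; lra.
have [xm|mx] := leP x ((c + d) / 2).
  have [|a /andP[a1 a2] al] := IH ((c + d) / 2) d; first by lra.
  exists a; first by rewrite a2; lra.
  by rewrite inE negb_or al gt_eqF //; apply: le_lt_trans a1.
have [|a /andP[a1 a2] al] := IH c ((c + d) / 2); first by lra.
exists a; first by rewrite a1; lra.
by rewrite inE negb_or al lt_eqF //; apply: lt_trans mx.
Qed.

Lemma avoid_circle (l : seq R) : exists a, forall x, x \in l -> ~ circle_eq a x.
Proof.
have [a /andP[a0 a1] al] := @avoid_seq [seq x - (Num.floor x)%:~R | x <- l] 0 1 ltr01.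
exists a => x xl ax; move: al; apply/negP/negPn/mapP; exists x => //.
apply: circle_eq_lt1.
  apply: circle_eq_trans ax _; apply/circle_eqP; exists (Num.floor x).
  by rewrite subrK.
have := floor_le x; have := floorD1_gt x; rewrite intrD1 => h1 h2.
by rewrite ltr_norml; apply/andP; split; lra.
Qed.

Lemma circle_window (a x : R) : ~ circle_eq x a ->
  exists2 y, circle_eq y x & a < y < a + 1.
Proof.
move=> xa; have := floor_le (x - a); have := floorD1_gt (x - a); rewrite intrD1 => h1 h2.
have yx : circle_eq (x - (Num.floor (x - a))%:~R) x.
  by apply/circle_eqP; exists (- Num.floor (x - a)); rewrite rmorphN.
exists (x - (Num.floor (x - a))%:~R) => //.
rewrite lt_neqAle -andbA; apply/and3P; split; [|lra|lra].
by apply: contra_notT xa => /negPn/eqP aE; apply: circle_eq_sym; rewrite [X in circle_eq X _]aE.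
Qed.

Variables (c : R -> R * R) (W : R -> R -> Prop) (X : set (R * R)).
Hypothesis X_fin : finite_set X.
Hypothesis W_sym : forall p q, W p q -> W q p.
Hypothesis c_per : forall p, c (p + 1) = c p.
Hypothesis W_per : forall p q, W (p + 1) q = W p q.
Hypothesis W_irr : forall p q, W p q -> ~ circle_eq p q.
Hypothesis W_c : forall p q, W p q -> c p = c q.
Hypothesis W_X : forall p q, W p q -> X (c p).
Hypothesis X_W : forall x, X x -> exists p q, W p q /\ c p = x.
Hypothesis no_triple : forall p q r, c p = c q -> c q = c r ->
  [\/ circle_eq p q, circle_eq q r | circle_eq p r].

Lemma W_circle p q p' q' : circle_eq p p' -> circle_eq q q' -> W p q -> W p' q'.
Proof.
move=> pp' qq'; rewrite (periodic_circle_eq (f := fun p => W p q) _ pp') //.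
move=> /W_sym; rewrite (periodic_circle_eq (f := fun q => W q p') _ qq') //.
exact: W_sym.
Qed.

Lemma W_pair p p' q' : W p' q' -> c p = c p' -> circle_eq p p' \/ circle_eq p q'.
Proof.
move=> Wpq cE; have [|/(W_irr Wpq)//|] := no_triple cE (W_c Wpq); by [left|right].
Qed.

(** Without triple points, a crossing point has one pair of parameters up to order and integers, so
    ordered representatives in one period are counted by the points. The base point [a] is left
    free, as both ends of the family must share it. *)
Lemma crossing_parameters : exists l : seq R, forall a,
  (forall x, x \in l -> ~ circle_eq a x) ->
  (forall p q, W p q -> ~ circle_eq p a) /\
  exists s : seq (R * R), [/\ uniq s, size s = #|` fset_set X|,
    forall p q, (p, q) \in s -> [/\ a < p, p < q, q < a + 1 & W p q] &
    forall p q, W p q -> a < p -> p < q -> q < a + 1 -> (p, q) \in s].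
Proof.
have /choice[P hP] : forall x, exists pq : R * R, X x -> W pq.1 pq.2 /\ c pq.1 = x.
  move=> x; have [Xx|nX] := pselect (X x); last by exists (0, 0).
  by have [p [q pq]] := X_W Xx; exists (p, q).
exists (flatten [seq [:: (P x).1; (P x).2] | x <- fset_set X]) => a al.
have Pl x : X x -> ~ circle_eq a (P x).1 /\ ~ circle_eq a (P x).2.
  move=> Xx; split; apply: al; apply/flatten_mapP; exists x;
    by rewrite ?in_fset_set ?inE ?eqxx ?orbT.
have avoid p q : W p q -> ~ circle_eq p a.
  move=> Wpq pa; have [n1 n2] := Pl _ (W_X Wpq); have [W' cE] := hP _ (W_X Wpq).
  have [pp|pp] := W_pair W' (esym cE); [apply: n1|apply: n2];
    by apply: circle_eq_trans (circle_eq_sym pa) pp.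
split=> //.
have /choice[Q hQ] : forall x, exists pq : R * R, X x ->
    [/\ W pq.1 pq.2, c pq.1 = x, a < pq.1, pq.1 < pq.2 & pq.2 < a + 1].
  move=> x; have [Xx|nX] := pselect (X x); last by exists (0, 0).
  have [W' cE] := hP _ Xx; move: (P x) W' cE => [p q] /= W' cE.
  have [p' p'p /andP[p1 p2]] := circle_window (avoid _ _ W').
  have [q' q'q /andP[q1 q2]] := circle_window (avoid _ _ (W_sym W')).
  have W'' : W p' q' by apply: W_circle W'; exact: circle_eq_sym.
  have cp : c p' = x by rewrite -cE; exact: periodic_circle_eq.
  have [pq|qp|pq] := ltgtP p' q'.
  - by exists (p', q').
  - by exists (q', p') => _; split=> //=; [exact: W_sym | rewrite -(W_c W'')].
  - by have := W_irr W''; rewrite pq => /(_ (circle_eq_refl _)).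
have inX x : x \in fset_set X -> X x by rewrite in_fset_set // inE.
exists [seq Q x | x <- fset_set X]; split.
- rewrite map_inj_in_uniq ?fset_uniq // => x y /inX/hQ[_ cx _ _ _] /inX/hQ[_ cy _ _ _] E.
  by rewrite -cx E.
- by rewrite size_map.
- move=> p q /mapP[x /inX/hQ[]]; move: (Q x) => [p' q'] /= Wpq _ h1 h2 h3 [-> ->].
  by split.
move=> p q Wpq ap pq qa; have Xx := W_X Wpq; have := hQ _ Xx.
case Qx: (Q (c p)) => [p' q'] /= [W' cE ap' pq' qa'].
have close x y : a < x -> x < a + 1 -> a < y -> y < a + 1 -> circle_eq x y -> x = y.
  by move=> x1 x2 y1 y2 /circle_eq_lt1; apply; rewrite ltr_norml; apply/andP; split; lra.
have pE : p = p' \/ p = q'.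
  by have [h|h] := W_pair W' (esym cE); [left|right]; apply: close h; lra.
have qE : q = p' \/ q = q'.
  have cq : c q = c p' by rewrite cE -(W_c Wpq).
  by have [h|h] := W_pair W' cq; [left|right]; apply: close h; lra.
suff [-> ->] : p = p' /\ q = q'.
  by apply/mapP; exists (c p); rewrite ?Qx // in_fset_set // inE.
by case: pE qE => [pE|pE] [qE|qE]; subst; split=> //; lra.
Qed.

End CrossingParameters.

(** * Lifts of circle diffeomorphisms *)

Section CircleDiffeo.
Variable R : realType.

Lemma smooth_strict (V W : normedModType R) (f : V -> W) (x v : V) :
  C1_strict V W -> smooth_map setT f -> strict_derivative f x v ('D_v f x).
Proof.
move=> C1 sm; have [F [U [Uo Ux sF FE]]] := sm x I.
have [_ /(_ v)[dF [dc _]]] := sF 1%N.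
have st := C1 F U x v Uo Ux dF (dc _ Ux).
have near_x : \forall y \near x, U y by move: Uo; rewrite openE => /(_ x Ux).
have /near_normP[r r0 hr] := near_x.
suff st' : strict_derivative f x v ('D_v F x).
  suff -> : 'D_v f x = 'D_v F x by [].
  apply: derive_val; apply: strict_is_derive => e e0; have [d d0 hd] := st' e e0.
  by exists d => // h hh; apply: hd; rewrite ?subrr ?normr0.
move=> e e0; have [d d0 hd] := st e e0.
have v1 : 0 < `|v| + 1 by rewrite ltr_wpDl.
exists (Num.min d (Num.min (r / 2) (r / 2 / (`|v| + 1)))).
  by rewrite !lt_min d0 !divr_gt0.
move=> z h; rewrite !lt_min => /and3P[zd zr _] /and3P[hd' _ hr'].
have hv : `|h| * (`|v| + 1) < r / 2 by rewrite -ltr_pdivlMr.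
rewrite -!FE ?hd //; apply: hr; first by apply: lt_trans zr _; lra.
rewrite addrAC; apply: le_lt_trans (ler_normD _ _) _; rewrite normrZ.
have : `|h| * `|v| <= `|h| * (`|v| + 1) by rewrite ler_wpM2l // lerDl.
by move=> hv'; apply: le_lt_trans (lerD (lexx _) hv') _; lra.
Qed.

Lemma strict_slope (c : R -> R * R) (p : R) : smooth_map setT c ->
  slope c p (derive1 c p).
Proof.
move=> sm k k0; rewrite derive1E.
have C1 : C1_strict R (R * R)%type by apply: C1_strict_pair; exact: C1_strict_real.
have [d d0 hd] := smooth_strict p 1 C1 sm k0.
exists (d / 2) => [|h hh]; first by rewrite divr_gt0.
have := hd p h; rewrite subrr normr0 [h *: 1]mulr1; apply=> //.
by apply: le_lt_trans hh _; lra.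
Qed.

Variable phi : R -> R.
Hypothesis phi_diffeo : oriented_circle_diffeo phi.

Let phi_per s : phi (s + 1) = phi s + 1.
Proof. by have [_ h _] := phi_diffeo; exact: h. Qed.

Lemma diffeo_int (k : int) s : phi (s + k%:~R) = phi s + k%:~R.
Proof.
have := int_periodic (f := fun s => phi s - s) _ k s => /(_ _)/eqP.
rewrite subr_eq => /(_ _)/eqP ->; last by move=> p; rewrite phi_per; ring.
by ring.
Qed.

Lemma diffeo_derivative s : is_derive s (1 : R) phi (derive1 phi s).
Proof.
have [sm _ _] := phi_diffeo; rewrite derive1E.
apply: strict_is_derive => e e0.
have [d d0 hd] := smooth_strict s 1 (@C1_strict_real R R) sm e0.
by exists d => // h hh; apply: hd; rewrite ?subrr ?normr0.
Qed.

Lemma diffeo_mono s t : s < t -> phi s < phi t.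
Proof.
move=> st; have [_ _ pos] := phi_diffeo.
have [c _ E] : exists2 c, c \in `[s, t] & phi t - phi s = derive1 phi c * (t - s).
  apply: MVT_segment (ltW st) _ _ => [x _|]; first exact: diffeo_derivative.
  by apply: derivable_within_continuous => x _; have [] := diffeo_derivative x.
by rewrite -subr_gt0 E mulr_gt0 // subr_gt0.
Qed.

Lemma diffeo_inj s t : phi s = phi t -> s = t.
Proof.
by have [/diffeo_mono|/diffeo_mono|//] := ltgtP s t => + E; rewrite E ltxx.
Qed.

Lemma diffeo_circle_eq s t : circle_eq (phi s) (phi t) <-> circle_eq s t.
Proof.
split=> /circle_eqP[k E]; apply/circle_eqP; exists k.
  by apply: diffeo_inj; rewrite diffeo_int.
by rewrite E diffeo_int.
Qed.

Lemma diffeo_surj y : exists s, phi s = y.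
Proof.
pose k := Num.floor (y - phi 0).
have h1 := floor_le (y - phi 0); have := floorD1_gt (y - phi 0); rewrite intrD1 => h2.
have E0 : phi k%:~R = phi 0 + k%:~R by rewrite -diffeo_int add0r.
have E1 : phi (k%:~R + 1) = phi 0 + k%:~R + 1 by rewrite phi_per E0.
have kk : k%:~R <= k%:~R + 1 :> R by rewrite lerDl.
have cont : {within `[k%:~R : R, k%:~R + 1], continuous phi}.
  by apply: derivable_within_continuous => x _; have [] := diffeo_derivative x.
have [|c _ cE] := IVT (v := y) kk cont; last by exists c.
rewrite E0 E1 min_l ?max_r ?lerDl //; rewrite -/k in h1 h2; lra.
Qed.

Lemma slope_diffeo (c : R -> R * R) p : smooth_map setT c ->
  slope (fun s => c (phi s)) p (derive1 phi p *: derive1 c (phi p)).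
Proof.
move=> sm k k0; set v := derive1 c (phi p); set m := derive1 phi p.
have [smphi _ pos] := phi_diffeo; have m0 : 0 < m := pos p.
have v1 : 0 < `|v| + 1 by rewrite ltr_wpDl.
(* Each factor of the chain rule gets half of the error [k]; the cap 1 on [k2] gives
   [|j| <= (m + 1) * |h|], which [k1] compensates. *)
pose k1 := k / 2 / (m + 1); pose k2 := Num.min 1 (k / 2 / (`|v| + 1)).
have m1 : 0 < m + 1 by rewrite ltr_wpDl // ltW.
have k10 : 0 < k1 by rewrite !divr_gt0.
have k20 : 0 < k2 by rewrite lt_min ltr01 !divr_gt0.
have [r r0 hr] := strict_slope (phi p) sm k10.
have [d d0 hd] := smooth_strict p 1 (@C1_strict_real R R) smphi k20.
exists (Num.min (d / 2) (r / (m + 1))); first by rewrite lt_min !divr_gt0.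
move=> h; rewrite le_min => /andP[h1 h2].
have := hd p h; rewrite subrr normr0 [h *: 1]mulr1 -derive1E -/m => /(_ d0) H.
have {}H : `|phi (p + h) - phi p - h * m| <= k2 * `|h|.
  by apply: H; apply: le_lt_trans h1 _; lra.
set j := phi (p + h) - phi p in H *.
have H1 : `|phi (p + h) - phi p - h * m| <= 1 * `|h|.
  by apply: le_trans H _; rewrite ler_wpM2r // ge_min lexx.
have H2 : `|phi (p + h) - phi p - h * m| <= k / 2 / (`|v| + 1) * `|h|.
  by apply: le_trans H _; rewrite ler_wpM2r // ge_min lexx orbT.
rewrite -/j in H1 H2.
have jh : `|j| <= (m + 1) * `|h|.
  rewrite -[j](subrK (h * m)); apply: le_trans (ler_normD _ _) _.
  by rewrite normrM (gtr0_norm m0) mulrDl addrC mulrC lerD.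
have jr : `|j| <= r by apply: le_trans jh _; rewrite mulrC -ler_pdivlMr.
have := hr j jr; rewrite /j [phi p + _]addrC subrK -/j -/v => H3.
have -> : c (phi (p + h)) - c (phi p) - h *: (m *: v) =
    (c (phi (p + h)) - c (phi p) - j *: v) + (j - h * m) *: v.
  by pair_ring.
apply: le_trans (ler_normD _ _) _; rewrite pair_normZ.
have H4 : `|c (phi (p + h)) - c (phi p) - j *: v| <= k / 2 * `|h|.
  apply: le_trans H3 _; apply: le_trans (ler_wpM2l (ltW k10) jh) _.
  by rewrite mulrA /k1 divfK ?gt_eqF.
have H5 : `|j - h * m| * `|v| <= k / 2 * `|h|.
  apply: le_trans (ler_pM _ _ H2 (_ : `|v| <= `|v| + 1)) _ => //; first by rewrite lerDl.
  by rewrite mulrAC divfK ?gt_eqF.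
by apply: le_trans (lerD H4 H5) _; rewrite -mulrDl -splitr.
Qed.

End CircleDiffeo.

(** * Virtual crossings as unlinked pairs *)

Section DiagramEnds.
Variable R : realType.
Variable g : R * R * R -> (R * R) * R * (R * R).
Hypothesis g_emb : smooth_embedding g.
Hypothesis g_level : forall p t u, 0 <= t <= 1 -> (g (p, t, u)).1.2 = t.
Hypothesis g_fiber : forall p t, 0 <= t <= 1 ->
  exists q, forall u, Defs.proj (g (p, t, u)) = q.
Variables (tau : R) (delta : virtual_diagram R).
Hypothesis tau01 : 0 <= tau <= 1.
Hypothesis rep : represents g tau delta.

Let W p q := unlinked (base g) (fiber g) p q tau.

(** At a classical crossing, a point of the inner circle lies inside the outer one, so one of the
    two loops is not null; at a virtual crossing each circle is outside the other and both loops are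
    null. *)
Lemma unlinked_ends : exists phi, [/\ oriented_circle_diffeo phi,
  forall p, base g p tau = curve delta (phi p) &
  forall p q, W p q <->
    crossing (curve delta) (phi p) (phi q) /\ mark delta (phi p) = Virtual].
Proof.
have [phi [phiD projE marks]] := rep; exists phi.
have bE p : base g p tau = curve delta (phi p).
  by rewrite /base clamp_id // -!/(Defs.proj _) projE.
split=> // p q.
have fibE r : fiber_circle g r tau = curve_image (fiber g r tau).
  by rewrite /fiber_circle /curve_image /fiber clamp_id.
have fc r : continuous (fiber g r tau).
  by apply: (continuous_f (continuous_fiber g_emb)) => x;
    [exact: cvg_cst|exact: cvg_cst|exact: cvg_id].
have f1 r u : fiber g r tau (u + 1) = fiber g r tau u by exact: fiber_periodic.
have inj r u v : fiber g r tau u = fiber g r tau v -> circle_eq u v.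
  by move=> /(fiber_disjoint g_emb g_level g_fiber erefl)[].
have mem r u : curve_image (fiber g r tau) (fiber g r tau u) by exists u.
split=> [[pq bpq n1 n2]|[cr mk]].
  have cr : crossing (curve delta) (phi p) (phi q).
    by split; [move/(diffeo_circle_eq phiD) | rewrite -!bE].
  split=> //; have := marks p q cr; rewrite /= !fibE; case: (mark _ _) => // sub.
    by have := inside_not_null (fc p) (@f1 p) (@inj p) (sub _ (mem q 0)).
  by have := inside_not_null (fc q) (@f1 q) (@inj q) (sub _ (mem p 0)).
have := marks p q cr; rewrite mk !fibE => -[s1 s2]; have [pq cE] := cr.
split; first by move/(diffeo_circle_eq phiD).
- by rewrite !bE.
- exact: (@outside_null R _ (fc p) (@f1 p) _ (s2 _ (mem q 0))).
- exact: (@outside_null R _ (fc q) (@f1 q) _ (s1 _ (mem p 0))).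
Qed.

Lemma unlinked_slope p q : W p q -> exists v w,
  [/\ slope (base g ^~ tau) p v, slope (base g ^~ tau) q w & det2 v w != 0].
Proof.
have [phi [phiD bE WE]] := unlinked_ends.
move=> /WE[cr _]; have [per [sm _] tr _ _] := curve_generic delta.
exists (derive1 phi p *: derive1 (curve delta) (phi p)).
exists (derive1 phi q *: derive1 (curve delta) (phi q)).
have -> : base g ^~ tau = fun p => curve delta (phi p) by apply/funext.
have [_ _ pos] := phiD.
split; [exact: slope_diffeo|exact: slope_diffeo|].
have := det2_independent (tr _ _ cr).
have -> (m k : R) (v w : R * R) : det2 (m *: v) (k *: w) = m * k * det2 v w.
  by rewrite /det2 /= !scale_mul; ring.
by move=> d0; rewrite !mulf_neq0 // gt_eqF.
Qed.

Lemma virtual_parameters : exists l : seq R, forall a,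
  (forall x, x \in l -> ~ circle_eq a x) ->
  (forall p q, W p q -> ~ circle_eq p a) /\
  exists s : seq (R * R), [/\ uniq s, size s = virtual_crossing_number delta,
    forall p q, (p, q) \in s -> [/\ a < p, p < q, q < a + 1 & W p q] &
    forall p q, W p q -> a < p -> p < q -> q < a + 1 -> (p, q) \in s].
Proof.
have [phi [phiD bE WE]] := unlinked_ends.
have [per _ _ triple fin] := curve_generic delta.
apply: (@crossing_parameters _ (base g ^~ tau)).
- apply: sub_finite_set fin => x [s [t [cr _ cx]]]; by exists s, t.
- by move=> p q; exact: unlinked_sym.
- by move=> p; exact: base_periodic.
- move=> p q; apply: unlinked_per => [r t|r t u].
    exact: base_periodic.
  exact: fiber_periodic_base.
- by move=> p q [].
- by move=> p q [].
- by move=> p q /WE[cr mk]; exists (phi p), (phi q); split.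
- move=> x [s [t [cr mk cx]]]; have [p pE] := diffeo_surj phiD s.
  have [q qE] := diffeo_surj phiD t; exists p, q; split; last by rewrite bE pE.
  by apply/WE; rewrite pE qE.
- move=> p q r; rewrite !bE => h1 h2.
  by case: (triple _ _ _ h1 h2) => /(diffeo_circle_eq phiD) h;
    [apply: Or31|apply: Or32|apply: Or33].
Qed.

End DiagramEnds.

Theorem theorem8p48 (R : realType) (alpha beta : virtual_diagram R) :
  fiberwise_equivalent alpha beta -> virtually_parity_equivalent alpha beta.
Proof.
move=> [g [g_emb [g_level [g_fiber [rep0 [rep1 _]]]]]].
have t0 : 0 <= (0 : R) <= 1 by rewrite lexx ler01.
have t1 : 0 <= (1 : R) <= 1 by rewrite lexx ler01.
have bper := base_periodic g_emb.
have fper := fiber_periodic_base g_emb.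
have [l0 h0] := virtual_parameters g_emb g_level g_fiber t0 rep0.
have [l1 h1] := virtual_parameters g_emb g_level g_fiber t1 rep1.
(* One starting point for the grids at all levels, off the crossing parameters of both ends. *)
have [a al] := avoid_circle (l0 ++ l1).
have [|av0 [s0 [u0 z0 m0 c0]]] := h0 a.
  by move=> x x0; apply: al; rewrite mem_cat x0.
have [|av1 [s1 [u1 z1 m1 c1]]] := h1 a.
  by move=> x x0; apply: al; rewrite mem_cat x0 orbT.
(* Only the values at the levels 0 and 1 matter. *)
pose s (t : R) := if t == 0 then s0 else s1.
have s00 : s 0 = s0 by rewrite /s eqxx.
have s11 : s 1 = s1 by rewrite /s oner_eq0.
rewrite /virtually_parity_equivalent -z0 -z1 -s00 -s11.
apply: (@virtual_parity_invariant R (base g) (unlinked (base g) (fiber g)) _ _ _ _ _ _ _ a).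
- exact: continuous_base.
- exact: bper.
- by move=> p q t; exact: unlinked_sym.
- by move=> p q t; exact: unlinked_per.
- by move=> p t [/(_ (circle_eq_refl p))].
- by move=> p q t [].
- apply: unlinked_local => //.
  + exact: continuous_fiber.
  + exact: fiber_periodic.
  + exact: fiber_disjoint.
  + exact: torus_derivatives.
- move=> t p q k [->|->] /[swap] ->; [move/av0|move/av1]; apply;
    by apply/circle_eqP; exists k.
- by move=> t; rewrite /s; case: ifP.
- by move=> t p q [->|->]; rewrite ?s00 ?s11; [exact: m0|exact: m1].
- by move=> t p q [->|->]; rewrite ?s00 ?s11; [exact: c0|exact: c1].
- move=> t p q [->|->]; rewrite ?s00 ?s11; [move/m0|move/m1] => -[_ _ _].
    exact: (unlinked_slope g_emb g_level g_fiber t0 rep0).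
  exact: (unlinked_slope g_emb g_level g_fiber t1 rep1).
Qed.
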